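(* Let $(\mathcal{X},d,\mu)$ be a complete, separable, connected metric measure space with $\mu$ doubling and supporting a weak $(1,1)$-Poincaré inequality. Let $\Omega\Subset\Omega^*\subset\mathcal{X}$ be bounded open sets, let $u_0\in L^2(\Omega^* )\cap \mathrm{BV}(\Omega^* )$, and let $T\in(0,\infty]$. Then any variational solution $u$ on $\Omega_T$ with Cauchy-Dirichlet datum $u_0$ (a global variational solution if $T=\infty$) satisfies $$\partial_tu\in L^2(\Omega^*_T)\quad\text{and}\quad u\in C^{0,\frac12}\big([0,\tau];L^2(\Omega^* )\big)\ \text{ for all }\tau\in\mathbb{R}\cap(0,T].$$ Furthermore, $$\int_0^T\int_{\Omega^*}|\partial_tu|^2\,d\mu\,dt\le\|Du_0\|(\Omega^* ).$$ Finally, for any $t_1,t_2\in\mathbb{R}$ with $0\le t_1<t_2\le T$, $$\frac1{t_2-t_1}\int_{t_1}^{t_2}\|Du(t)\|(\Omega^* )\,dt\le\|Du_0\|(\Omega^* ).$$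
   Context: **Space.** $(\mathcal{X},d)$ is complete, separable, connected, with a Borel measure $\mu$. Doubling: there is $c\ge1$ with $0<\mu(B_{2r}(x))\le c\,\mu(B_r(x))<\infty$ for all $x\in\mathcal{X}$, $r>0$. Weak $(1,1)$-Poincaré inequality: there are $c_P>0$, $\tau_0\ge1$ such that for all balls $B_\varrho(x_0)$, all $u\in L^1(\mathcal{X})$ and all upper gradients $g$ of $u$, the mean over $B_\varrho(x_0)$ of $|u-u_{\varrho,x_0}|$ is at most $c_P\varrho$ times the mean of $g$ over $B_{\tau_0\varrho}(x_0)$, where $u_{\varrho,x_0}$ is the mean of $u$ over $B_\varrho(x_0)$. A Borel $g\ge0$ is an upper gradient of $u$ if $|u(x)-u(y)|\le\int_\gamma g\,ds$ for every rectifiable curve $\gamma$ joining $x$ to $y$; a nonnegative measurable $g$ is a $1$-weak upper gradient if this holds for all curves outside a family of $1$-modulus zero; the minimal $1$-weak upper gradient $g_u$ is the one of smallest $L^1$-norm. **BV.** For open $A\subset\mathcal{X}$ and $u\in L^1_{\rm loc}(A)$, the total variation is $\|Du\|(A)=\inf\{\liminf_{i}\int_A g_{u_i}\,d\mu: u_i\in \mathrm{Lip}_{\rm loc}(A),\ u_i\to u \text{ in } L^1_{\rm loc}(A)\}$. $\mathrm{BV}(A)$ is the set of $u\in L^1(A)$ with $\|Du\|(A)<\infty$. **Derivations.** A derivation is a linear map $\mathfrak{d}:\mathrm{Lip}_c(\mathcal{X})\to L^0(\mathcal{X})$ (from compactly supported Lipschitz functions to measurable functions) with $\mathfrak{d}(fg)=f\mathfrak{d}(g)+g\mathfrak{d}(f)$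 for which there is a measurable $h$ with $|\mathfrak{d}(f)|(x)\le h(x)\,\mathrm{Lip}_a(f)(x)$ for $\mu$-a.e. $x$ and all $f$, where $\mathrm{Lip}_a(f)(x)=\lim_{r\searrow0}\sup_{y\in B_r(x),\,y\ne x}|f(x)-f(y)|/d(x,y)$. The smallest such $h$ is $|\mathfrak{d}|$. If $|\mathfrak d|\in L^1_{\rm loc}$, $\mathrm{div}(\mathfrak{d})\in L^\infty$ means there is a unique function $\mathrm{div}(\mathfrak{d})\in L^\infty(\mathcal{X})$ with $\int \mathfrak{d}(f)\,d\mu=-\int f\,\mathrm{div}(\mathfrak{d})\,d\mu$ for all $f\in\mathrm{Lip}_c(\mathcal{X})$. $\mathrm{Der}_b(\mathcal{X})$ is the set of derivations with $|\mathfrak{d}|\in L^\infty$ and $\mathrm{div}(\mathfrak{d})\in L^\infty$; $\mathrm{supp}(\mathfrak{d})$ is the support of $|\mathfrak{d}|$. **Weak parabolic space.** For open $A$ and $T>0$, $L^1_w(0,T;\mathrm{BV}(A))$ consists of all $v\in L^1(A\times(0,T))$ such that $v(t):=v(\cdot,t)\in\mathrm{BV}(A)$ for a.e. $t$; $t\mapsto\int_A v(t)\,\mathrm{div}(\mathfrak{d})\,d\mu$ is measurable for all $\mathfrak{d}\in\mathrm{Der}_b(\mathcal{X})$ with $\mathrm{supp}(\mathfrak{d})\Subset A$; and $\int_0^T\|Dv(t)\|(A)\,dt<\infty$. **Boundary values.** $\mathrm{BV}_{u_0}(\Omega)=\{u\in\mathrm{BV}(\Omega^* ): u=u_0 \text{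 a.e. on }\Omega^*\setminus\Omega\}$, and $L^1_w(0,T;\mathrm{BV}_{u_0}(\Omega))$ is the set of $v\in L^1_w(0,T;\mathrm{BV}(\Omega^* ))$ with $v(t)\in\mathrm{BV}_{u_0}(\Omega)$ for a.e. $t\in(0,T)$. Write $\Omega^*_T=\Omega^*\times(0,T)$. **Variational solution.** For $T\in(0,\infty)$, a map $u\in L^1_w(0,T;\mathrm{BV}_{u_0}(\Omega))\cap C^0([0,T];L^2(\Omega^* ))$ is a variational solution on $\Omega_T$ (with datum $u_0$) if $$\int_0^T\|Du(t)\|(\Omega^* )\,dt\le\int_0^T\Big[\int_{\Omega^*}\partial_tv(v-u)\,d\mu+\|Dv(t)\|(\Omega^* )\Big]dt-\tfrac12\|(v-u)(T)\|^2_{L^2(\Omega^* )}+\tfrac12\|v(0)-u_0\|^2_{L^2(\Omega^* )}$$ for every $v\in L^1_w(0,T;\mathrm{BV}_{u_0}(\Omega))$ with (weak) time derivative $\partial_tv\in L^2(\Omega^*_T)$ and $v(0)\in L^2(\Omega^* )$ (such $v$ lies in $C^0([0,T];L^2(\Omega^* ))$). A map $u:\Omega^*\times(0,\infty)\to\mathbb{R}$ is a global variational solution if for every $T\in(0,\infty)$ it lies in $L^1_w(0,T;\mathrm{BV}_{u_0}(\Omega))\cap C^0([0,T];L^2(\Omega^* ))$ and is a variational solution on $\Omega_T$. **Hölder space.** For a Banach space $B$, $C^{0,\alpha}([0,\tau];B)$ is the set of continuous $u:[0,\tau]\to B$ with $\sup_{s\ne t}\|u(s)-u(t)\|_B/|s-t|^\alpha<\infty$.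 *)

(* Defs.v *)
From HB Require Import structures.
From mathcomp Require Import all_boot all_order all_algebra.
From mathcomp Require Import all_classical all_reals all_analysis.
From mathcomp Require Import measurable_realfun.

Set Implicit Arguments.
Unset Strict Implicit.
Unset Printing Implicit Defensive.

Import Order.TTheory GRing.Theory Num.Theory.
Import numFieldNormedType.Exports.

Local Open Scope classical_set_scope.
Local Open Scope ring_scope.

HB.mixin Record isBorel d T & Topological T & Measurable d T := {
  borelE : @measurable d T = <<s @open T >>
}.

#[short(type="borelMetricType")]
HB.structure Definition BorelMetric (R : realType) d :=
  {T of Complete T & Metric R T & Measurable d T & isBorel d T}.

Section metric_measure_space.
Context {R : realType} {d : measure_display} {X : borelMetricType R d}.
Variable mu : {measure set X -> \bar R}.

Local Notation leb := (@lebesgue_measure R).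

Definition separable := exists2 D : set X, countable D & dense D.

Definition doubling := exists2 c : R, 1 <= c &
  forall (x : X) (r : R), 0 < r ->
    [/\ (0 < mu (ball x (2 * r)))%E,
        (mu (ball x (2 * r)) <= c%:E * mu (ball x r))%E &
        (c%:E * mu (ball x r) < +oo)%E].

Definition metric_bounded (A : set X) :=
  exists M : R, forall x y, A x -> A y -> mdist x y <= M.

Definition compactly_contained (B A : set X) :=
  compact (closure B) /\ closure B `<=` A.

(** Curves are parametrised over [0, 1]; only the values of [gamma : R -> X]
    there matter. *)

Definition curve_length (gamma : R -> X) (a b : R) : \bar R :=
  ereal_sup [set (\sum_(i < size s)
      mdist (gamma (nth b (a :: s) i)) (gamma (nth b (a :: s) i.+1)))%:E
    | s in [set s | itv_partition a b s]].

Definition rectifiable (gamma : R -> X) :=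
  {within `[0, 1], continuous gamma} /\ (curve_length gamma 0 1 < +oo)%E.

(* The arc-length parametrisation [0, l] -> X: its value at h is gamma at the
   first time at which gamma has covered length h. *)
Definition arc_length_param (gamma : R -> X) (h : R) : X :=
  gamma (inf [set t | 0 <= t <= 1 /\ (h%:E <= curve_length gamma 0 t)%E]).

Definition line_integral (g : X -> \bar R) (gamma : R -> X) : \bar R :=
  (\int[leb]_(h in `[0%R, fine (curve_length gamma 0 1)])
    g (arc_length_param gamma h))%E.

Definition upper_gradient_along (u : X -> R) (g : X -> \bar R)
    (gamma : R -> X) :=
  (`|u (gamma 0) - u (gamma 1)|%:E <= line_integral g gamma)%E.

Definition upper_gradient (u : X -> R) (g : X -> \bar R) :=
  [/\ measurable_fun setT g, (forall x, 0 <= g x)%E &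
      forall gamma, rectifiable gamma -> upper_gradient_along u g gamma].

Definition average (B : set X) (f : X -> \bar R) : \bar R :=
  (((fine (mu B))^-1)%:E * \int[mu]_(x in B) f x)%E.

Definition poincare := exists cP tau0 : R, [/\ 0 < cP, 1 <= tau0 &
  forall (x0 : X) (rho : R) (u : X -> R) (g : X -> \bar R),
    0 < rho -> mu.-integrable setT (EFin \o u) -> upper_gradient u g ->
    let uB := fine (average (ball x0 rho) (EFin \o u)) in
    (average (ball x0 rho) (fun x => `|u x - uB|%:E)
      <= (cP * rho)%:E * average (ball x0 (tau0 * rho)) g)%E].

Definition modulus1 (Gamma : set (R -> X)) : \bar R :=
  ereal_inf [set (\int[mu]_x rho x)%E | rho in
    [set rho : X -> \bar R | [/\ measurable_fun setT rho,
      (forall x, 0 <= rho x)%E &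
      forall gamma, Gamma gamma -> rectifiable gamma ->
        (1 <= line_integral rho gamma)%E]]].

(* Functions on an open set A are represented by functions on X of which only
   the values on A matter; accordingly only curves in A are tested. *)
Definition weak_upper_gradient (A : set X) (u : X -> R) (g : X -> \bar R) :=
  [/\ measurable_fun A g, (forall x, A x -> 0 <= g x)%E &
      exists2 Gamma : set (R -> X), modulus1 Gamma = 0%E &
        forall gamma, rectifiable gamma ->
          (forall t, 0 <= t <= 1 -> A (gamma t)) -> ~ Gamma gamma ->
          upper_gradient_along u g gamma].

(* If u has no integrable 1-weak upper gradient on A, every 1-weak upper
   gradient is minimal in this sense, and its integral over A is +oo. *)
Definition minimal_weak_upper_gradient (A : set X) (u : X -> R)
    (g : X -> \bar R) :=
  weak_upper_gradient A u g /\
  forall g', weak_upper_gradient A u g' ->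
    (\int[mu]_(x in A) g x <= \int[mu]_(x in A) g' x)%E.

Definition lipschitz_set (A : set X) (f : X -> R) :=
  exists L : R, forall x y, A x -> A y -> `|f x - f y| <= L * mdist x y.

Definition lip_loc (A : set X) (f : X -> R) :=
  forall x, A x -> exists2 U, nbhs x U & lipschitz_set (A `&` U) f.

Definition lip_c (f : X -> R) :=
  lipschitz_set setT f /\ compact (closure [set x | f x != 0]).

Definition cvg_L1loc (A : set X) (ui : nat -> X -> R) (u : X -> R) :=
  forall K, compact K -> K `<=` A ->
    (\int[mu]_(x in K) `|ui i x - u x|%:E)%E @[i --> \oo] --> 0%E.

(* ||Du||(A) *)
Definition total_var (A : set X) (u : X -> R) : \bar R :=
  ereal_inf [set z | exists (ui : nat -> X -> R) (gi : nat -> X -> \bar R),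
    [/\ forall i, lip_loc A (ui i), cvg_L1loc A ui u,
        forall i, minimal_weak_upper_gradient A (ui i) (gi i) &
        z = limn_einf (fun i => (\int[mu]_(x in A) gi i x)%E)]].

Definition BV (A : set X) (u : X -> R) :=
  mu.-integrable A (EFin \o u) /\ (total_var A u < +oo)%E.

(** Derivations are represented by maps on all functions of which only the
    values on [lip_c] matter, elements of L^0 by measurable functions. *)

(* The point y = x contributes 0 / 0 = 0. *)
Definition Lip_a (f : X -> R) (x : X) : \bar R :=
  lim (ereal_sup [set (`|f x - f y| / mdist x y)%:E | y in ball x r]
       @[r --> 0^'+]).

Definition derivation_bound (D : (X -> R) -> (X -> R)) (h : X -> R) :=
  [/\ measurable_fun setT h, forall x, 0 <= h x &
      forall f, lip_c f ->
        \forall x \ae mu, (`|D f x|%:E <= (h x)%:E * Lip_a f x)%E].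

Definition derivation (D : (X -> R) -> (X -> R)) :=
  [/\ forall f, lip_c f -> measurable_fun setT (D f),
      forall (a : R) f g, lip_c f -> lip_c g ->
        D (fun x => a * f x + g x) = (fun x => a * D f x + D g x) %[ae mu],
      forall f g, lip_c f -> lip_c g ->
        D (f \* g) = (fun x => f x * D g x + g x * D f x) %[ae mu] &
      exists h, derivation_bound D h].

(* h is |D| *)
Definition derivation_norm (D : (X -> R) -> (X -> R)) (h : X -> R) :=
  derivation_bound D h /\
  forall h', derivation_bound D h' -> \forall x \ae mu, h x <= h' x.

(* w is div D *)
Definition divergence (D : (X -> R) -> (X -> R)) (w : X -> R) :=
  w \in Lfun mu +oo%E /\
  forall f, lip_c f ->
    (\int[mu]_x (D f x)%:E = - \int[mu]_x (f x * w x)%:E)%E.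

(* D is in Der_b(X), with |D| = h and div D = w; h and w are determined by D
   up to equality almost everywhere *)
Definition Der_b (D : (X -> R) -> (X -> R)) (h w : X -> R) :=
  [/\ derivation D, derivation_norm D h, h \in Lfun mu +oo%E & divergence D w].

Definition ess_support (h : X -> R) : set X :=
  [set x | forall U, nbhs x U -> ~ (\forall y \ae mu, U y -> h y = 0)].

(** A function of space and time is curried as [v : X -> R -> R], so that
    v(t) is [v^~ t]. *)

Definition time_itv (T : \bar R) : set R := [set t | 0 < t /\ (t%:E < T)%E].

Definition L1w_BV (A : set X) (T : R) (v : X -> R -> R) :=
  [/\ (mu \x leb)%E.-integrable (A `*` time_itv T%:E)
        (fun p => (v p.1 p.2)%:E),
      \forall t \ae leb, time_itv T%:E t -> BV A (v^~ t),
      forall D h w, Der_b D h w -> compactly_contained (ess_support h) A ->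
        measurable_fun (time_itv T%:E)
          (fun t => \int[mu]_(x in A) (v x t * w x)%:E)%E &
      (\int[leb]_(t in time_itv T%:E) total_var A (v^~ t) < +oo)%E].

Definition BV_datum (Omega OmegaS : set X) (u0 u : X -> R) :=
  BV OmegaS u /\ u = u0 %[ae mu in OmegaS `\` Omega].

Definition L1w_BV_datum (Omega OmegaS : set X) (u0 : X -> R) (T : R)
    (v : X -> R -> R) :=
  L1w_BV OmegaS T v /\
  \forall t \ae leb, time_itv T%:E t -> BV_datum Omega OmegaS u0 (v^~ t).

Definition in_Lp (A : set X) (p : \bar R) (f : X -> R) :=
  f \_ A \in Lfun mu p.

Definition Lp_norm (A : set X) (p : \bar R) (f : X -> R) : \bar R :=
  'N[mu]_p[EFin \o (f \_ A)].

Definition in_C0_Lp (A : set X) (p : \bar R) (T : R) (V : R -> X -> R) :=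
  forall t, 0 <= t <= T -> in_Lp A p (V t) /\
    Lp_norm A p (V s \- V t) @[s --> within `[0, T] (nbhs t)] --> 0%E.

(* V is the representative of v that is continuous from [0, T] to L^p(A);
   v itself is only given up to null sets of A x (0, T), so that its values at
   the times 0 and T are those of V. *)
Definition C0_representative (A : set X) (p : \bar R) (T : R)
    (v : X -> R -> R) (V : R -> X -> R) :=
  in_C0_Lp A p T V /\
  \forall t \ae leb, time_itv T%:E t -> v^~ t = V t %[ae mu in A].

Definition test_function (T : \bar R) (eta : R -> R) :=
  (forall n t, derivable (eta^`(n))%classic t 1) /\
  exists a b : R, [/\ 0 < a, (b%:E < T)%E &
    forall t, ~~ (a <= t <= b) -> eta t = 0].

(* w is the weak time derivative of v and lies in L^2(A x (0, T)): the
   identity int v(t) eta'(t) dt = - int w(t) eta(t) dt holds in L^1(A). *)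
Definition weak_dt_L2 (A : set X) (T : \bar R) (v w : X -> R -> R) :=
  (fun p => w p.1 p.2) \_ (A `*` time_itv T) \in Lfun (mu \x leb)%E 2%:E /\
  forall eta, test_function T eta -> \forall x \ae mu, A x ->
    (\int[leb]_(t in time_itv T) (v x t * (eta^`())%classic t)%:E
      = - \int[leb]_(t in time_itv T) (w x t * eta t)%:E)%E.

Definition in_holder_L2 (alpha : R) (A : set X) (tau : R) (u : X -> R -> R) :=
  exists2 U, C0_representative A 2%:E tau u U &
    exists C : R, forall s t : R, 0 <= s <= tau -> 0 <= t <= tau ->
      (Lp_norm A 2%:E (U s \- U t)%R <= (C * `|s - t| `^ alpha)%:E)%E.

Definition variational_solution_on (Omega OmegaS : set X) (u0 : X -> R) (T : R)
    (u : X -> R -> R) :=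
  L1w_BV_datum Omega OmegaS u0 T u /\
  exists2 U, C0_representative OmegaS 2%:E T u U &
  forall v dv V,
    L1w_BV_datum Omega OmegaS u0 T v ->
    weak_dt_L2 OmegaS T%:E v dv ->
    (* v(0) a priori exists only as the trace in L^1 *)
    C0_representative OmegaS 1%:E T v V -> in_Lp OmegaS 2%:E (V 0) ->
    (\int[leb]_(t in time_itv T%:E) total_var OmegaS (u^~ t)
     <= \int[leb]_(t in time_itv T%:E)
          (\int[mu]_(x in OmegaS) (dv x t * (v x t - u x t))%:E
           + total_var OmegaS (v^~ t))
        - (2^-1)%:E * Lp_norm OmegaS 2%:E (V T \- U T)%R ^+ 2
        + (2^-1)%:E * Lp_norm OmegaS 2%:E (V 0%R \- u0)%R ^+ 2)%E.

Definition variational_solution (Omega OmegaS : set X) (u0 : X -> R)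
    (T : \bar R) (u : X -> R -> R) :=
  match T with
  | T'%:E => variational_solution_on Omega OmegaS u0 T' u
  | +oo%E => forall T' : R, 0 < T' ->
      variational_solution_on Omega OmegaS u0 T' u
  | -oo%E => False
  end.

End metric_measure_space.

Arguments separable {R d} X.

(* Main.v *)
Require Import Defs.
From HB Require Import structures.
From mathcomp Require Import all_boot all_order all_algebra.
From mathcomp Require Import all_classical all_reals all_analysis.
From mathcomp Require Import measurable_realfun ring lra.

Set Implicit Arguments.
Unset Strict Implicit.
Unset Printing Implicit Defensive.

Import Order.TTheory GRing.Theory Num.Theory.
Import numFieldNormedType.Exports.

Local Open Scope classical_set_scope.
Local Open Scope ring_scope.

(** Why the theorem is true.  Write A for the larger domain, TV for the total
    variation on A and F0 for TV (u0).  A map v is admissible in the variational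
    inequality only if it has the boundary values of u and a time derivative in
    L^2.  Such maps arise by relaxing v towards u: let v solve

      v' = a (u - v),   v(0) = u0

    with a nonnegative step function a of time ([rate], [relaxation],
    [comparison]).  By variation of constants v(t) is a combination, with
    nonnegative coefficients, of u0 and of the values u(s) for s <= t.  Hence v
    equals u0 outside of Omega, and since TV is convex, TV (v(t)) is at most G(t),
    the result of the same relaxation applied to the real function TV (u(s)) and
    the initial value F0 ([total_var_comparison]).  Moreover
    v' (v - u) = - a |u - v|^2.  So the inequality yields

      int TV (u) + int int a |u - v|^2 <= int G.

    Take a equal to 1 / h before t1, to 0 on [t1, t2[ and to 1 / eps from t2 on,
    with h = t2 - t1 + eps.  Exchanging the order of integration bounds the
    integral of G by h F0 + int TV (u) minus the integral of TV (u) over [t1, t2]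
    ([relaxation_integral_le]), and therefore ([comparison_inequality])

      int_t1^t2 TV (u) + int int a |u - v|^2 <= (t2 - t1 + eps) F0.

    As eps tends to 0 this is the last claim of the theorem.  For t1 = t2 = 0 it
    says that the difference quotients w_eps = (u - v) / eps ([yosida]) satisfy
    int int |w_eps|^2 <= F0.  On every fibre in time, for h < k,

      int |w_h - w_k|^2 <= int |w_h|^2 - int |w_k|^2

    ([yosida_monotone]), so the quotients converge in L^2 of space-time
    ([L2_limit]).  Now w_eps is the time derivative of v, and v differs from u by
    eps w_eps; in the limit u is the primitive of an L^2 function with energy at
    most F0 ([exists_velocity]).  The Holder bound is the Cauchy-Schwarz inequality
    in time.

    Behind this are the properties of TV that make it a convex functional:
    it depends only on the class of a function modulo null sets
    ([eq_ae_total_var]), it is lower semicontinuous in L^1 ([total_var_lsc]) and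
    sublinear ([total_var_lincomb]), so that Jensen's inequality holds for
    time integrals ([total_var_time_integral]).  TV is defined by minimal weak upper
    gradients, and the last two facts rest on their existence
    ([exists_minimal_weak_upper_gradient]): along curves, the infimum of a sequence
    of upper gradients is an upper gradient ([increment_le_integral_inf]), and the
    exceptional curves are absorbed in one integrable density.  They also rest
    on an exhaustion of A by compact sets, for which the doubling condition is used
    ([closed_bounded_compact]). *)

(** * Integrals of functions that need not be measurable *)

Section integral_helpers.
Local Open Scope ereal_scope.
Context {R : realType} {d : measure_display} {T : measurableType d}.
Variable mu : {measure set T -> \bar R}.
Import HBNNSimple.

(** The integral of a nonnegative function is the supremum of the integrals of
    the simple functions below it, which is monotone whether or not the
    integrands are measurable. Total variations and values of an arbitrary
    representative are integrated below before they are known to be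
    measurable. *)
Lemma le_integral_pointwise (D : set T) (f g : T -> \bar R) :
  (forall x, D x -> f x <= g x) ->
  \int[mu]_(x in D) f x <= \int[mu]_(x in D) g x.
Proof.
move=> fg; rewrite /integral.
have fg' x : (f \_ D) x <= (g \_ D) x.
  by rewrite /patch; case: ifPn => // /set_mem; exact: fg.
have sub (a b : T -> \bar R) : (forall x, a x <= b x) ->
    ereal_sup [set sintegral mu h | h in [set h : {nnsfun T >-> R} |
      forall x, (h x)%:E <= a x]] <=
    ereal_sup [set sintegral mu h | h in [set h : {nnsfun T >-> R} |
      forall x, (h x)%:E <= b x]].
  move=> ab; apply: le_ereal_sup => _ [h /= ha <-]; exists h => //= x.
  exact: le_trans (ha x) (ab x).
apply: leeB; apply: sub => x.
- by apply: (@funepos_le _ _ setT) => [y _|]; [exact: fg'|rewrite inE].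
- by apply: (@funeneg_le _ _ setT) => [y _|]; [exact: fg'|rewrite inE].
Qed.

(** A simple function below [f] can be cut off on a measurable null set
    outside of which [f <= g]; this does not change its integral. *)
Lemma ae_ge0_le_integral_pointwise (D : set T) (f g : T -> \bar R) :
  (forall x, D x -> 0 <= f x) -> (forall x, D x -> 0 <= g x) ->
  (\forall x \ae mu, D x -> f x <= g x) ->
  \int[mu]_(x in D) f x <= \int[mu]_(x in D) g x.
Proof.
move=> f0 g0 [N [mN N0 fgN]].
rewrite (ge0_integralE _ f0) (ge0_integralE _ g0).
apply: ge_ereal_sup => _ [h /= hf <-].
rewrite -integralT_nnsfun (_ : \int[mu]_x (h x)%:E =
    \int[mu]_x (h x * \1_(~` N) x)%:E); last first.
  apply: ge0_ae_eq_integral => //=.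
  - exact/measurable_EFinP.
  - apply/measurable_EFinP/measurable_funM => //.
    by apply: measurable_indic; exact: measurableC.
  - by move=> x _; rewrite lee_fin fun_ge0.
  - by move=> x _; rewrite lee_fin mulr_ge0 ?fun_ge0.
  - exists N; split => // x /= /not_implyP[_]; apply: contra_notP => Nx.
    by rewrite indicE mem_set// mulr1.
rewrite -(ge0_integralE _ g0) [leRHS]integral_mkcond.
apply: le_integral_pointwise => x _; rewrite indicE.
have [Nx|nNx] := pselect (N x).
  have -> : (x \in ~` N) = false by apply/negbTE; rewrite notin_setE => /(_ Nx).
  rewrite mulr0.
  exact: erestrict_ge0.
rewrite mem_set// mulr1 (le_trans (hf x))// /patch.
case: ifPn => // /set_mem Dx; apply: contra_notT nNx => fg.
by apply: fgN => /= /(_ Dx); exact/negP.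
Qed.

Lemma ge0_ae_eq_integral_pointwise (D : set T) (f g : T -> \bar R) :
  (forall x, D x -> 0 <= f x) -> (forall x, D x -> 0 <= g x) ->
  (\forall x \ae mu, D x -> f x = g x) ->
  \int[mu]_(x in D) f x = \int[mu]_(x in D) g x.
Proof.
move=> f0 g0 fg; apply/eqP; rewrite eq_le; apply/andP; split;
  apply: ae_ge0_le_integral_pointwise => //.
- by apply: filterS fg => x h /h ->.
- by apply: filterS fg => x h /h ->.
Qed.

Lemma ae_eq_integral_pointwise (D : set T) (f g : T -> \bar R) :
  (\forall x \ae mu, D x -> f x = g x) ->
  \int[mu]_(x in D) f x = \int[mu]_(x in D) g x.
Proof.
move=> fg; rewrite [LHS]integralE [RHS]integralE; congr (_ - _);
  apply: ge0_ae_eq_integral_pointwise => //; apply: filterS fg => x H Dx;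
  by rewrite ?funeposE ?funenegE H.
Qed.

End integral_helpers.

(** An instance of [filterS] that fixes the measurable structure of the line. *)
Lemma ae_lebesgue_mono {R : realType} (P Q : R -> Prop) :
  (forall s, P s -> Q s) -> (\forall s \ae (@lebesgue_measure R), P s) ->
  \forall s \ae (@lebesgue_measure R), Q s.
Proof. by move=> PQ [N [mN N0 PN]]; exists N; split => // s /= nQ; apply: PN => /= /PQ. Qed.


(** * Length of curves *)

Section curve_length_theory.
Context {R : realType} {d : measure_display} {X : borelMetricType R d}.
Implicit Types (gamma : R -> X) (a b c : R) (s : seq R).

(** The sums that define [curve_length], as a recursive function so that they can
    be split and concatenated. *)
Fixpoint polygon_length gamma a s : R :=
  if s is x :: s' then mdist (gamma a) (gamma x) + polygon_length gamma x s'
  else 0.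

Lemma polygon_lengthE gamma a b s :
  \sum_(i < size s) mdist (gamma (nth b (a :: s) i))
    (gamma (nth b (a :: s) i.+1)) = polygon_length gamma a s.
Proof.
elim: s a => [|x s IH] a; first by rewrite big_ord0.
by rewrite big_ord_recl /= -IH.
Qed.

Lemma polygon_length_cat gamma a s1 s2 : polygon_length gamma a (s1 ++ s2) =
  polygon_length gamma a s1 + polygon_length gamma (last a s1) s2.
Proof. by elim: s1 a => [|x s IH] a /=; rewrite ?add0r// IH addrA. Qed.

Lemma curve_lengthE gamma a b : curve_length gamma a b =
  ereal_sup [set (polygon_length gamma a s)%:E | s in [set s |
    itv_partition a b s]].
Proof.
congr ereal_sup; apply: eq_imagel => s _.
by rewrite -(polygon_lengthE gamma a b s).
Qed.

Lemma polygon_length_le gamma a b s : itv_partition a b s ->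
  ((polygon_length gamma a s)%:E <= curve_length gamma a b)%E.
Proof. by move=> p; rewrite curve_lengthE; apply: ereal_sup_ubound; exists s. Qed.

Lemma mdist_le_curve_length gamma a b : a <= b ->
  ((mdist (gamma a) (gamma b))%:E <= curve_length gamma a b)%E.
Proof.
rewrite le_eqVlt => /predU1P[<-|ab].
  by rewrite mdistxx; exact: (@polygon_length_le gamma a a [::]).
have := polygon_length_le gamma (itv_partition1 ab).
by rewrite /= addr0.
Qed.

Lemma curve_length_ge0 gamma a b : a <= b -> (0 <= curve_length gamma a b)%E.
Proof.
move=> ab; apply: le_trans (mdist_le_curve_length gamma ab).
by rewrite lee_fin mdist_ge0.
Qed.

Lemma curve_lengthxx gamma a : curve_length gamma a a = 0%E.
Proof.
apply/eqP; rewrite eq_le curve_length_ge0// andbT curve_lengthE.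
by apply: ge_ereal_sup => _ [s /itv_partitionxx -> <-].
Qed.

(** Insert the point [c] into the partition; the triangle inequality makes the
    polygon longer. *)
Lemma polygon_length_split gamma a b c s : a <= c -> c <= b ->
  itv_partition a b s -> exists s1 s2, [/\ itv_partition a c s1,
    itv_partition c b s2 & polygon_length gamma a s <=
      polygon_length gamma a s1 + polygon_length gamma c s2].
Proof.
elim: s a => [|x s IH] a ac cb.
  move=> /itv_partition_nil ab; subst b.
  have ca : c = a by apply/eqP; rewrite eq_le cb ac.
  by subst c; exists [::], [::]; rewrite /= addr0; split.
move=> /[dup] ps /itv_partition_cons p.
move: ac; rewrite le_eqVlt => /predU1P[aceq|ac].
  by subst c; exists [::], (x :: s); rewrite /= add0r; split.
have [cx|xc] := ltP c x.
  exists [:: c], (x :: s); split => //.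
  - exact: itv_partition1.
  - by case: ps => /= /andP[_ ps ls]; split => //=; rewrite cx.
  - by rewrite /= addr0 addrA lerD2r metric_triangle.
have [s1 [s2 [p1 p2 le12]]] := IH x xc cb p.
exists (x :: s1), s2; split => //.
- by case: p1 => p1 l1; split => //=; case: ps => /= /andP[->].
- by rewrite /= -addrA lerD2l.
Qed.

Lemma curve_lengthD gamma a b c : a <= c -> c <= b ->
  (curve_length gamma a b = curve_length gamma a c + curve_length gamma c b)%E.
Proof.
move=> ac cb; apply/eqP; rewrite eq_le; apply/andP; split.
  rewrite [leLHS]curve_lengthE; apply: ge_ereal_sup => _ [s ps <-].
  have [s1 [s2 [p1 p2 le12]]] := polygon_length_split gamma ac cb ps.
  apply: (@le_trans _ _ ((polygon_length gamma a s1)%:E +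
    (polygon_length gamma c s2)%:E)%E); first by rewrite -EFinD lee_fin.
  by apply: leeD; exact: polygon_length_le.
have cat s1 s2 : itv_partition a c s1 -> itv_partition c b s2 ->
    ((polygon_length gamma a s1)%:E + (polygon_length gamma c s2)%:E <=
     curve_length gamma a b)%E.
  move=> p1 p2; have := polygon_length_le gamma (itv_partition_cat p1 p2).
  by rewrite polygon_length_cat; case: p1 => _ /eqP ->; rewrite EFinD.
move: cat; have := curve_length_ge0 gamma (le_trans ac cb).
case: (curve_length gamma a b) => [L| |] // L0 cat; last by rewrite leey.
have step s2 : itv_partition c b s2 -> (curve_length gamma a c <=
    (L - polygon_length gamma c s2)%:E)%E.
  move=> p2; rewrite curve_lengthE; apply: ge_ereal_sup => _ [s1 p1 <-].
  by have := cat _ _ p1 p2; rewrite -EFinD !lee_fin lerBrDr.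
have := curve_length_ge0 gamma ac.
move: step; case: (curve_length gamma a c) => [l| |] // step _; last first.
  have [s2 p2] : exists s2, itv_partition c b s2.
    have [->|cb'] := eqVneq c b; first by exists [::].
    by exists [:: b]; apply: itv_partition1; rewrite lt_neqAle cb'.
  by have := step _ p2; rewrite leye_eq.
rewrite -leeBrDl// [leLHS]curve_lengthE; apply: ge_ereal_sup => _ [s2 p2 <-].
by have := step _ p2; rewrite -EFinB !lee_fin lerBrDr lerBrDl addrC.
Qed.

Lemma polygon_length_comp gamma (phi : R -> R) a s :
  polygon_length (gamma \o phi) a s =
  polygon_length gamma (phi a) [seq phi x | x <- s].
Proof. by elim: s a => [|x s IH] a //=; rewrite IH. Qed.

End curve_length_theory.

Section rectifiable_theory.
Context {R : realType} {d : measure_display} {X : borelMetricType R d}.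
Variables (gamma : R -> X) (gammaR : rectifiable gamma).

Definition length_upto (t : R) : R := fine (curve_length gamma 0 t).
Local Notation ell := length_upto.

Lemma curve_length_between s t : 0 <= s -> s <= t -> t <= 1 ->
  curve_length gamma s t = (ell t - ell s)%:E.
Proof.
move=> s0 st t1.
have fin u : 0 <= u -> u <= 1 -> curve_length gamma 0 u \is a fin_num.
  move=> u0 u1; rewrite ge0_fin_numE ?curve_length_ge0//.
  apply: le_lt_trans gammaR.2.
  by rewrite (curve_lengthD gamma u0 u1) leeDl// curve_length_ge0.
rewrite EFinB !fineK ?fin// ?(le_trans s0)//; last exact: le_trans t1.
rewrite (curve_lengthD gamma s0 st) addeAC subee ?add0e//.
by rewrite fin// (le_trans st).
Qed.

Lemma length_upto0 : ell 0 = 0.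
Proof. by rewrite /length_upto curve_lengthxx. Qed.

Lemma curve_length_upto t : 0 <= t -> t <= 1 ->
  curve_length gamma 0 t = (ell t)%:E.
Proof. by move=> ? ?; rewrite curve_length_between// length_upto0 subr0. Qed.

Lemma mdist_le_length s t : 0 <= s -> s <= t -> t <= 1 ->
  mdist (gamma s) (gamma t) <= ell t - ell s.
Proof.
move=> s0 st t1; rewrite -lee_fin -curve_length_between//.
exact: mdist_le_curve_length.
Qed.

Lemma length_upto_nd s t : 0 <= s -> s <= t -> t <= 1 -> ell s <= ell t.
Proof.
move=> s0 st t1; rewrite -subr_ge0 (le_trans _ (mdist_le_length s0 st t1))//.
exact: mdist_ge0.
Qed.

Lemma curve_cvg t e : 0 <= t -> t <= 1 -> 0 < e -> exists2 dl, 0 < dl &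
  forall s, 0 <= s -> s <= 1 -> `|t - s| < dl -> mdist (gamma t) (gamma s) < e.
Proof.
move=> t0 t1 e0; case: gammaR => /subspace_continuousP/(_ t) + _.
rewrite /= in_itv/= t0 t1 => /(_ isT)/cvg_ball/(_ _ e0).
rewrite near_withinE => -[dl/= dl0 H]; exists dl => // s s0 s1 ts.
by have := H s ts; rewrite /= in_itv/= s0 s1 ballEmdist => /(_ isT).
Qed.

Lemma curve_length_gt a b e : 0 <= a -> a <= b -> b <= 1 -> 0 < e ->
  exists2 s, itv_partition a b s & ell b - ell a - e < polygon_length gamma a s.
Proof.
move=> a0 ab b1 e0.
have := @ub_ereal_sup_adherent _ [set (polygon_length gamma a s)%:E | s in
  [set s | itv_partition a b s]] e e0.
rewrite -curve_lengthE curve_length_between//= => /(_ isT)[_ [s ps <-]].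
by rewrite -EFinB lte_fin; exists s.
Qed.

(** In a partition of [0, t] that almost realises the length, the last point can be
    moved to the left at little cost, because the curve is continuous. *)
Lemma length_upto_left t e : 0 < t -> t <= 1 -> 0 < e -> exists2 dl, 0 < dl &
  forall s, 0 <= s -> t - dl < s -> s <= t -> ell t - e <= ell s.
Proof.
move=> t0 t1 e0; have e20 : 0 < e / 2 by rewrite divr_gt0.
have [s ps +] := curve_length_gt (lexx 0) (ltW t0) t1 e20.
rewrite length_upto0 subr0.
have [dl dl0 H] := curve_cvg (ltW t0) t1 e20.
case: ps; elim/last_ind: s => [|s x _].
  by move=> _ /= /eqP t0'; move: t0; rewrite t0' ltxx.
rewrite rcons_path last_rcons => /andP[ps pt] /eqP xt; subst x.
set p := last 0 s in pt *; rewrite -cats1 polygon_length_cat/= addr0 -/p => lt1.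
exists (Num.min dl (t - p)); first by rewrite lt_min dl0 subr_gt0.
move=> u u0; rewrite ltrBlDr -ltrBlDl lt_min => /andP[ud up] ut.
have pu : p < u by lra.
have pp : itv_partition 0 u (rcons s u).
  by split; rewrite ?last_rcons// rcons_path ps.
have := polygon_length_le gamma pp.
rewrite curve_length_upto//; last exact: le_trans t1.
rewrite lee_fin -cats1 polygon_length_cat/= addr0 -/p => le1.
have u1 := le_trans ut t1.
have tri := metric_triangle (gamma p) (gamma u) (gamma t).
have := H u u0 u1; rewrite ger0_norm ?subr_ge0// => /(_ ud).
rewrite metric_sym => lt2; lra.
Qed.

Lemma length_upto_right t e : 0 <= t -> t < 1 -> 0 < e -> exists2 dl, 0 < dl &
  forall s, t <= s -> s < t + dl -> s <= 1 -> ell s <= ell t + e.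
Proof.
move=> t0 t1 e0; have e20 : 0 < e / 2 by rewrite divr_gt0.
have [s ps] := curve_length_gt t0 (ltW t1) (lexx 1) e20.
have [dl dl0 H] := curve_cvg t0 (ltW t1) e20.
case: ps; case: s => [|x s]; first by move=> _ /= /eqP t1'; move: t1; rewrite t1' ltxx.
move=> /= /andP[tx px] /eqP lx lt1.
exists (Num.min dl (x - t)); first by rewrite lt_min dl0 subr_gt0.
move=> u tu; rewrite -ltrBlDl lt_min => /andP[ud ux] u1.
have ux' : u < x by lra.
have u0 := le_trans t0 tu.
have pp : itv_partition u 1 (x :: s) by split; rewrite /= ?ux' ?lx.
have := polygon_length_le gamma pp.
rewrite curve_length_between// lee_fin /= => le1.
have tri := metric_triangle (gamma t) (gamma u) (gamma x).
have := H u u0 u1; rewrite ler0_norm ?subr_le0// opprB => /(_ ud) => lt2; lra.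
Qed.

(** The arc-length parametrisation is the inverse of this function; continuity
    gives its surjectivity onto [0, l]. *)
Lemma length_upto_continuous : {within `[0, 1], continuous ell}.
Proof.
apply/subspace_continuousP => t /=; rewrite in_itv/= => /andP[t0 t1].
apply/cvgrPdist_le => e e0.
have [dl dl0 Hl] : exists2 dl, 0 < dl &
    forall s, 0 <= s -> t - dl < s -> s <= t -> ell t - e <= ell s.
  move: t0; rewrite le_eqVlt => /predU1P[t0|t0]; last exact: length_upto_left.
  exists 1 => // s s0 _ st; have -> : s = t by apply/eqP; rewrite eq_le st -t0.
  by rewrite lerBlDr lerDl ltW.
have [dr dr0 Hr] : exists2 dl, 0 < dl &
    forall s, t <= s -> s < t + dl -> s <= 1 -> ell s <= ell t + e.
  move: t1; rewrite le_eqVlt => /predU1P[t1|t1]; last exact: length_upto_right.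
  exists 1 => // s ts _ s1; have -> : s = t by apply/eqP; rewrite eq_le ts t1 s1.
  by rewrite lerDl ltW.
rewrite near_withinE; exists (Num.min dl dr); first by rewrite /= lt_min dl0.
move=> s /=; rewrite lt_min => /andP[sl sr]; rewrite in_itv/= => /andP[s0 s1].
have [st|ts] := leP s t.
  rewrite ger0_norm ?subr_ge0; last exact: length_upto_nd.
  rewrite lerBlDr -lerBlDl; apply: Hl => //.
  by move: sl; rewrite ger0_norm ?subr_ge0// ltrBlDr -ltrBlDl.
have {}ts := ltW ts.
rewrite ler0_norm ?subr_le0; last exact: length_upto_nd.
rewrite opprB lerBlDl; apply: Hr => //.
by move: sr; rewrite ler0_norm ?subr_le0// opprB ltrBlDl.
Qed.

End rectifiable_theory.

(** * Arc-length parametrisation *)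

Section arc_length.
Context {R : realType} {d : measure_display} {X : borelMetricType R d}.
Variables (gamma : R -> X) (gammaR : rectifiable gamma).
Local Notation ell := (length_upto gamma).
Local Notation arc := (arc_length_param gamma).

(** [arc_length_param] takes the first time at which a given length is reached;
    the curve is constant between that time and any other time of the same
    length. *)
Lemma arc_length_param_upto t : 0 <= t -> t <= 1 -> arc (ell t) = gamma t.
Proof.
move=> t0 t1; rewrite /arc_length_param.
set S := [set _ | _]; pose tau := inf S.
have St : S t by rewrite /S/= t0 t1; split=> //; rewrite curve_length_upto.
have lbS : lbound S 0 by move=> s /= [/andP[]].
have hS : has_inf S by split; [exists t|exists 0].
have tau0 : 0 <= tau by apply: lb_le_inf => //; exists t.
have taut : tau <= t := ge_inf hS.2 St.
have tau1 : tau <= 1 := le_trans taut t1.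
suff ltau : ell t <= ell tau.
  apply/mdist_positivity/eqP; rewrite eq_le mdist_ge0 andbT.
  rewrite (le_trans (mdist_le_length gammaR tau0 taut t1))//.
  by rewrite subr_le0.
move: taut; rewrite le_eqVlt => /predU1P[->//|taut].
apply/ler_addgt0Pr => e e0.
have [dl dl0 H] := length_upto_right gammaR tau0 (lt_le_trans taut t1) e0.
have [s /[dup] Ss [/andP[s0 s1] ls] sd] := inf_adherent dl0 hS.
have taus : tau <= s := ge_inf hS.2 Ss.
rewrite (le_trans _ (H s taus sd s1))//.
by move: ls; rewrite curve_length_upto.
Qed.

Lemma length_upto_surj h : 0 <= h -> h <= ell 1 ->
  exists t, [/\ 0 <= t, t <= 1 & ell t = h].
Proof.
move=> h0 h1; have l01 : ell 0 <= ell 1 by exact: length_upto_nd.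
have := @IVT _ ell 0 1 h ler01 (length_upto_continuous gammaR).
rewrite min_l// max_r// length_upto0 h0 h1 => /(_ isT)[t].
by rewrite in_itv/= => /andP[t0 t1] tE; exists t.
Qed.

Lemma arc_length_param_lip h h' : 0 <= h -> h <= h' -> h' <= ell 1 ->
  mdist (arc h) (arc h') <= h' - h.
Proof.
move=> h0 hh' h1.
have [s [s0 s1 sE]] := length_upto_surj h0 (le_trans hh' h1).
have [t [t0 t1 tE]] := length_upto_surj (le_trans h0 hh') h1.
rewrite -sE -tE !arc_length_param_upto//.
have [st|ts] := leP s t; first exact: mdist_le_length.
have := length_upto_nd gammaR t0 (ltW ts) s1; rewrite sE tE => h'h.
have E : h = h' by apply/eqP; rewrite eq_le hh' h'h.
rewrite metric_sym (le_trans (mdist_le_length gammaR t0 (ltW ts) s1))//.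
by rewrite sE tE E.
Qed.

Lemma measurable_arc_length_param : measurable_fun `[0, ell 1] arc.
Proof.
have l1 : 0 <= ell 1 by rewrite -(length_upto0 gamma); exact: length_upto_nd.
pose clip h := Num.max 0 (Num.min h (ell 1)).
have clip_ge h : 0 <= clip h by rewrite le_max lexx.
have clip_le h : clip h <= ell 1 by rewrite ge_max l1 ge_min lexx orbT.
have clip_lip h h' : h <= h' -> 0 <= clip h' - clip h <= h' - h.
  rewrite /clip => hh'; apply/andP.
  by case: (leP h (ell 1)) => ?; case: (leP h' (ell 1)) => ?;
    case: (leP 0 h) => ?; case: (leP 0 h') => ?;
    case: (leP 0 (ell 1)) => ?; split; lra.
apply: (@eq_measurable_fun _ _ _ _ _ (arc \o clip)).
  move=> h; rewrite inE/= in_itv/= => /andP[h0 h1].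
  by rewrite /clip min_l// max_r.
apply: (@measurable_funS _ _ _ _ setT) => //.
apply: (measurability (@open X)); first exact: borelE.
move=> _ [V oV <-]; rewrite setTI; apply: open_measurable.
rewrite openE => h /=; rewrite /interior/= => Vh.
move: oV; rewrite openE => /(_ _ Vh)/nbhs_ballP[e /= e0 eV].
exists e => //= h' hh'; apply: eV; rewrite ballEmdist/=.
have [le|/ltW le] := leP h h'.
- have := clip_lip _ _ le; rewrite subr_ge0 => /andP[c1 c2].
  rewrite (le_lt_trans (arc_length_param_lip _ c1 _))//.
  by rewrite (le_lt_trans c2)// (le_lt_trans _ hh')// distrC ler_norm.
- have := clip_lip _ _ le; rewrite subr_ge0 => /andP[c1 c2].
  rewrite metric_sym (le_lt_trans (arc_length_param_lip _ c1 _))//.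
  by rewrite (le_lt_trans c2)// (le_lt_trans _ hh')// ler_norm.
Qed.

Lemma arc_length_param_in (A : set X) h : 0 <= h -> h <= ell 1 ->
  (forall t, 0 <= t <= 1 -> A (gamma t)) -> A (arc h).
Proof.
move=> h0 h1 Ag; have [t [t0 t1 <-]] := length_upto_surj h0 h1.
by rewrite arc_length_param_upto//; apply: Ag; rewrite t0.
Qed.

Lemma measurable_along (A : set X) (g : X -> \bar R) : measurable A ->
  measurable_fun A g -> (forall t, 0 <= t <= 1 -> A (gamma t)) ->
  measurable_fun `[0, ell 1] (g \o arc).
Proof.
move=> mA mg Ag; apply: (measurable_comp mA _ mg measurable_arc_length_param).
move=> _ [h hI <-]; move: hI; rewrite /= in_itv/= => /andP[h0 h1].
exact: arc_length_param_in.
Qed.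

End arc_length.


(** * Line integrals along subcurves *)

Section subcurve.
Context {R : realType} {d : measure_display} {X : borelMetricType R d}.

Lemma curve_length_comp_le (gamma : R -> X) (phi : R -> R) a b :
  {homo phi : x y / x < y} ->
  (curve_length (gamma \o phi) a b <= curve_length gamma (phi a) (phi b))%E.
Proof.
move=> phi_lt; rewrite curve_lengthE; apply: ge_ereal_sup => _ [s [ps ls] <-].
rewrite polygon_length_comp; apply: polygon_length_le; split.
  by rewrite path_map; apply: sub_path ps.
by rewrite last_map (eqP ls).
Qed.

Lemma curve_length_comp (gamma : R -> X) (phi psi : R -> R) a b :
  {homo phi : x y / x < y} -> {homo psi : x y / x < y} ->
  cancel phi psi -> cancel psi phi ->
  curve_length (gamma \o phi) a b = curve_length gamma (phi a) (phi b).
Proof.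
move=> h1 h2 K1 K2; apply/eqP; rewrite eq_le curve_length_comp_le//=.
have := @curve_length_comp_le (gamma \o phi) psi (phi a) (phi b) h2.
rewrite !K1; congr (curve_length _ _ _ <= _)%E.
by apply/funext => x /=; rewrite K2.
Qed.

Definition translation (c : R) : measurableTypeR R -> measurableTypeR R :=
  fun x => (c : R) + (x : R).

Lemma measurable_translation (c : R) : measurable_fun setT (translation c).
Proof. exact: (@measurable_funD _ R R setT (cst c) id). Qed.

HB.instance Definition _ (c : R) :=
  isMeasurableFun.Build _ _ _ _ (translation c) (measurable_translation c).

Lemma lebesgue_measure_translation (c : R) (A : set R) : measurable A ->
  pushforward lebesgue_measure (translation c) A = lebesgue_measure A.
Proof.
move=> mA; apply/esym/lebesgue_measure_unique => //= _ [[a b]] _ <-.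
rewrite /pushforward.
have -> : (translation c) @^-1` `]a, b]%classic = `](a - c), (b - c)]%classic.
  by apply/seteqP; split=> x /=; rewrite /translation !in_itv/= ltrBlDl lerBrDl.
rewrite !lebesgue_measure_itv/= !lte_fin ltrD2r; case: ifPn => // _.
by rewrite -!EFinD opprD addrACA subrr addr0.
Qed.

Lemma ge0_integral_translation (c a b : R) (f : R -> \bar R) :
  measurable_fun `[c + a, c + b] f ->
  (forall x, (c + a <= x <= c + b)%R -> 0 <= f x)%E ->
  (\int[lebesgue_measure]_(h in `[a, b]) f (c + h)%R =
   \int[lebesgue_measure]_(h in `[(c + a)%R, (c + b)%R]) f h)%E.
Proof.
move=> mf f0.
have -> : `[a, b]%classic = (translation c) @^-1` `[c + a, c + b]%classic.
  by apply/seteqP; split=> x /=; rewrite /translation !in_itv/= !lerD2l.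
rewrite -(ge0_integral_pushforward (measurable_translation c))//=.
- apply: eq_measure_integral => //= A mA AS; exact: (lebesgue_measure_translation c mA).
- by move=> x; rewrite inE/= in_itv/=; exact: f0.
Qed.

Variables (gamma : R -> X) (gammaR : rectifiable gamma).
Variables (s t : R) (s0 : 0 <= s) (st : s < t) (t1 : t <= 1).
Local Notation ell := (length_upto gamma).

Definition subcurve (r : R) : X := gamma (s + r * (t - s)).

Let phi r := s + r * (t - s).
Let psi r := (r - s) / (t - s).
Let phiK : cancel phi psi.
Proof. by move=> r; rewrite /phi /psi addrAC subrr add0r mulfK// subr_eq0 gt_eqF. Qed.
Let psiK : cancel psi phi.
Proof. by move=> r; rewrite /phi /psi divfK ?subr_eq0 ?gt_eqF// addrC subrK. Qed.
Let phi_lt : {homo phi : x y / x < y}.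
Proof. by move=> x y xy; rewrite /phi ltrD2l ltr_pM2r// subr_gt0. Qed.
Let psi_lt : {homo psi : x y / x < y}.
Proof.
by move=> x y xy; rewrite /psi ltr_pM2r ?invr_gt0 ?subr_gt0// ltrD2r.
Qed.
Let phi_in r : 0 <= r -> r <= 1 -> s <= phi r <= t.
Proof.
move=> r0 r1; have ts0 : 0 <= t - s by rewrite subr_ge0 ltW.
have := mulr_ge0 r0 ts0.
have : r * (t - s) <= t - s by rewrite ler_piMl// subr_ge0 ltW.
by rewrite /phi; move=> *; apply/andP; split; lra.
Qed.

Lemma length_upto_subcurve r : 0 <= r -> r <= 1 ->
  curve_length subcurve 0 r = (ell (s + r * (t - s)) - ell s)%:E.
Proof.
move=> r0 r1; have /andP[p1 p2] := phi_in r0 r1.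
rewrite -curve_length_between//; last exact: le_trans t1.
rewrite (@curve_length_comp gamma phi psi)//.
by congr curve_length; rewrite /phi mul0r addr0.
Qed.

Lemma rectifiable_subcurve : rectifiable subcurve.
Proof.
split; last by rewrite length_upto_subcurve// ltry.
apply/subspace_continuousP => r /=; rewrite in_itv/= => /andP[r0 r1].
apply/cvg_ballP => e e0; have /andP[p1 p2] := phi_in r0 r1.
have [dl dl0 H] := curve_cvg gammaR (le_trans s0 p1) (le_trans p2 t1) e0.
rewrite near_withinE; exists (dl / (t - s)).
  by rewrite /= divr_gt0// subr_gt0.
move=> u /=; rewrite ltr_pdivlMr ?subr_gt0// in_itv/= => ru /andP[u0 u1].
have /andP[q1 q2] := phi_in u0 u1.
rewrite ballEmdist/=; apply: H => //; [exact: le_trans q1|exact: le_trans t1|].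
rewrite /phi opprD addrACA subrr add0r -mulrBl normrM.
by rewrite (@ger0_norm _ (t - s))// subr_ge0 ltW.
Qed.

Lemma arc_length_subcurve h : 0 <= h -> h <= ell t - ell s ->
  arc_length_param subcurve h = arc_length_param gamma (ell s + h).
Proof.
move=> h0 h1.
have ellE r : 0 <= r -> r <= 1 ->
    length_upto subcurve r = ell (s + r * (t - s)) - ell s.
  by move=> r0 r1; rewrite /length_upto length_upto_subcurve.
have := @length_upto_surj _ _ _ _ rectifiable_subcurve h h0.
rewrite ellE// mul1r (addrC s) subrK => /(_ h1)[r [r0 r1]].
rewrite ellE// => hE; have /andP[q1 q2] := phi_in r0 r1.
rewrite -{1}hE -ellE// (arc_length_param_upto rectifiable_subcurve)//.
have -> : ell s + h = ell (s + r * (t - s)) by rewrite -hE addrC subrK.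
rewrite arc_length_param_upto//; first exact: le_trans q1.
exact: le_trans t1.
Qed.

(** Reparametrising [0, 1] to [s, t] shifts the arc-length parameter by the
    length up to [s]; the claim is the translation invariance of Lebesgue
    measure. *)
Lemma line_integral_subcurve (A : set X) (g : X -> \bar R) : measurable A ->
  measurable_fun A g -> (forall x, A x -> 0 <= g x)%E ->
  (forall r, 0 <= r <= 1 -> A (gamma r)) ->
  line_integral g subcurve = (\int[lebesgue_measure]_(h in `[ell s, ell t])
    g (arc_length_param gamma h))%E.
Proof.
move=> mA mg g0 Ag; rewrite /line_integral length_upto_subcurve//=.
rewrite mul1r (addrC s) subrK.
have lst : ell s <= ell t by apply: length_upto_nd => //; exact: ltW.
have ls0 : 0 <= ell s.
  rewrite -(length_upto0 gamma); apply: length_upto_nd => //.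
  exact: le_trans (ltW st) t1.
have lt1 : ell t <= ell 1.
  by apply: length_upto_nd => //; exact: le_trans (ltW st).
have := @ge0_integral_translation (ell s) 0 (ell t - ell s)
  (g \o arc_length_param gamma).
rewrite addr0 (addrC (ell s)) subrK => <- /=.
- apply: eq_integral => h; rewrite inE/= in_itv/= => /andP[h0 h1].
  by rewrite arc_length_subcurve.
- apply: measurable_funS (measurable_along gammaR mA mg Ag) => //.
  move=> h /=; rewrite !in_itv/= => /andP[h0 h1].
  by rewrite (le_trans ls0)//= (le_trans h1).
- move=> h /andP[h0 h1]; apply: g0.
  by apply: arc_length_param_in => //; [exact: le_trans h0|exact: le_trans lt1].
Qed.

End subcurve.

(** * Increments bounded by the minimum of two densities *)

Section interval_function_min.
Context {R : realType}.
Local Notation leb := (@lebesgue_measure R).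

Lemma measurable_itvR (i : interval R) :
  @measurable _ (measurableTypeR R) [set` i].
Proof. exact: measurable_itv. Qed.

Lemma lebesgue_itv_lty (a b : R) :
  (leb (`[a, b]%classic : set (measurableTypeR R)) < +oo)%E.
Proof.
have := @lebesgue_measure_itv R `[a, b]; rewrite /= => ->.
by case: ifPn => // _; rewrite ?ltry// -EFinB ltry.
Qed.

(** The outer measure defining the Lebesgue-Stieltjes measure is an infimum over
    covers by half-open intervals, and on each of them the bound is the
    hypothesis. *)
Lemma le_integral_lebesgue_stieltjes (C : cumulative R R) (n : R -> \bar R) :
  measurable_fun setT n -> (forall x, 0 <= n x)%E ->
  (forall x y, x < y ->
    (\int[leb]_(t in `]x, y]) n t <= (C y - C x)%:E)%E) ->
  forall E, measurable E ->
    (\int[leb]_(t in E) n t <= lebesgue_stieltjes_measure C E)%E.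
Proof.
move=> mn n0 nC E mE; rewrite /lebesgue_stieltjes_measure /measure_extension.
apply: le_ereal_inf_tmp => _ [F [mF EF] <-].
have mF' k : measurable (F k : set R).
  have /ocitvP[->//|[[a b] _ ->]] := mF k; first exact: measurable_itv.
have -> : (\int[leb]_(t in E) n t = \int[leb]_t ((n \_ E) t))%E.
  exact: integral_mkcond.
apply: (@le_trans _ _ (\int[leb]_t \sum_(k <oo) ((n \_ (F k)) t))%E).
  apply: le_integral_pointwise => x _.
  rewrite {1}/patch; case: ifPn => [/set_mem Ex|_]; last first.
    by apply: nneseries_ge0 => k _ _; exact: erestrict_ge0.
  have [k _ Fkx] := EF _ Ex.
  rewrite (nneseries_split_cond 0 k.+1)/=; last first.
    by move=> i _; exact: erestrict_ge0.
  rewrite add0n big_mkord big_ord_recr/= [X in (_ + X + _)%E]patchE mem_set//.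
  rewrite (le_trans _ (leeDl _ _))//; last first.
    by apply: nneseries_ge0 => *; exact: erestrict_ge0.
  by rewrite leeDr// sume_ge0// => i _; exact: erestrict_ge0.
rewrite integral_nneseries//; last 2 first.
- by move=> k; apply/(measurable_restrictT _ (mF' k)); exact: measurable_funS mn.
- by move=> k x _; exact: erestrict_ge0.
apply: lee_nneseries => [k _ _|k _]; first by apply: integral_ge0 => x _; exact: erestrict_ge0.
rewrite -integral_mkcond.
have /ocitvP[->|[[a b]/= ab ->]] := mF k; first by rewrite integral_set0.
rewrite (_ : wlength _ _ = (C b - C a)%:E); first exact: nC.
by rewrite wlength_itv_bnd ?(ltW ab).
Qed.


Section min_of_two.
Variables (a b : R) (ab : a <= b) (Phi q1 q2 : R -> R).
Hypotheses (iq1 : leb.-integrable `[a, b] (EFin \o q1))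
  (iq2 : leb.-integrable `[a, b] (EFin \o q2)).
Hypotheses (q10 : forall x, 0 <= q1 x) (q20 : forall x, 0 <= q2 x).
Hypothesis Phi1 : forall x y, a <= x -> x <= y -> y <= b ->
  `|Phi y - Phi x| <= \int[leb]_(t in `[x, y]) q1 t.
Hypothesis Phi2 : forall x y, a <= x -> x <= y -> y <= b ->
  `|Phi y - Phi x| <= \int[leb]_(t in `[x, y]) q2 t.

Let m t := Num.max (q1 t) (q2 t).

Let im : leb.-integrable `[a, b] (EFin \o m).
Proof.
have i12 := integrableD (measurable_itvR _) iq1 iq2.
apply: le_integrable i12 => //.
- apply/measurable_EFinP; apply: measurable_maxr; apply/measurable_EFinP;
  by [exact: measurable_int iq1|exact: measurable_int iq2].
- move=> t _; rewrite /= lee_fin !ger0_norm ?addr_ge0//.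
    by rewrite ge_max lerDl lerDr q10 q20.
  by rewrite le_max q10.
Qed.

Let sub f x y : leb.-integrable `[a, b] (EFin \o f) -> a <= x -> y <= b ->
  leb.-integrable `[x, y] (EFin \o f).
Proof.
move=> i ax yb; apply: integrableS i => // t /=; rewrite !in_itv/=.
by move=> /andP[xt ty]; rewrite (le_trans ax)// (le_trans ty).
Qed.

Let I x := \int[leb]_(t in `[a, x]) m t.
Let clip x := Num.max a (Num.min x b).
Let C x := I (clip x) - Phi (clip x).

Let clip_ge x : a <= clip x. Proof. by rewrite le_max lexx. Qed.
Let clip_le x : clip x <= b. Proof. by rewrite ge_max ab ge_min lexx orbT. Qed.
Let clip_lip x y : x <= y -> 0 <= clip y - clip x <= y - x.
Proof.
rewrite /clip => xy; apply/andP.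
by case: (leP x b) => ?; case: (leP y b) => ?; case: (leP a x) => ?;
  case: (leP a y) => ?; case: (leP a b) ab => ? ?; split; lra.
Qed.

Let split_int f x y : leb.-integrable `[a, b] (EFin \o f) ->
  a <= x -> x <= y -> y <= b ->
  \int[leb]_(t in `[a, y]) f t - \int[leb]_(t in `[a, x]) f t =
  \int[leb]_(t in `[x, y]) f t.
Proof.
move=> i ax xy yb; rewrite Rintegral_itvB ?bnd_simp//; last exact: sub.
rewrite Rintegral_itv_obnd_cbnd//.
apply: integrableS (sub i ax yb) => // t /=; rewrite !in_itv/= => /andP[+ ->].
by rewrite andbT; exact: ltW.
Qed.

Let CB x y : x <= y -> C y - C x =
  \int[leb]_(t in `[clip x, clip y]) m t - (Phi (clip y) - Phi (clip x)).
Proof.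
move=> xy; rewrite /C -split_int//; last by have := clip_lip xy; rewrite subr_ge0 => /andP[].
rewrite /I; lra.
Qed.

Let leC q x y : leb.-integrable `[a, b] (EFin \o q) -> x <= y ->
  (forall x y, a <= x -> x <= y -> y <= b ->
    `|Phi y - Phi x| <= \int[leb]_(t in `[x, y]) q t) ->
  \int[leb]_(t in `[clip x, clip y]) (m t - q t) <= C y - C x.
Proof.
move=> i xy Phiq; have := clip_lip xy; rewrite subr_ge0 => /andP[cxy _].
rewrite RintegralB//; [|exact: sub|exact: sub].
by rewrite CB// lerD2l lerN2 (le_trans (ler_norm _))// Phiq.
Qed.

Let C_nd : nondecreasing C.
Proof.
move=> x y xy; rewrite -subr_ge0 (le_trans _ (leC iq1 xy Phi1))//.
by apply: Rintegral_ge0 => t _; rewrite subr_ge0 le_max lexx.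
Qed.

Let C_continuous : continuous C.
Proof.
move=> x; apply/cvgrPdist_le => e e0.
have := @parameterized_integral_continuous R a b m ab im.
move=> /subspace_continuousP/(_ (clip x)).
rewrite /= in_itv/= clip_ge clip_le => /(_ isT)/cvgrPdist_le/(_ (e / 2)).
rewrite divr_gt0// => /(_ isT); rewrite near_withinE => -[dl /= dl0 H].
exists dl => // y /= xy.
have key u v : u <= v -> `|I (clip v) - I (clip u)| <= e / 2 ->
    `|C v - C u| <= e.
  move=> uv; have := clip_lip uv; rewrite subr_ge0 => /andP[cuv _].
  rewrite split_int// CB// => He; rewrite (le_trans (ler_normB _ _))//.
  rewrite [leRHS](splitr e) lerD// (le_trans (Phi1 _ _ _))//.
  rewrite (le_trans _ He)// (le_trans _ (ler_norm _))//.
  by apply: le_Rintegral => //; [exact: sub|exact: sub|move=> t _; rewrite le_max lexx].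
have Hy : `|I (clip x) - I (clip y)| <= e / 2.
  apply: H; last by rewrite /= in_itv/= clip_ge clip_le.
  apply: le_lt_trans xy.
  have [xy|/ltW yx] := leP x y.
    have := clip_lip xy => /andP[c0 c1].
    by rewrite distrC [leRHS]distrC !ger0_norm ?subr_ge0// -subr_ge0.
  have := clip_lip yx => /andP[c0 c1].
  by rewrite !ger0_norm ?subr_ge0// -subr_ge0.
have [xy'|/ltW yx'] := leP x y; last exact: key.
by rewrite distrC; apply: key => //; rewrite distrC.
Qed.

Let C_rc : right_continuous C. Proof. exact: right_continuousW. Qed.

Let C_mixin := isCumulative.Build R _ R C C_nd C_rc.
Let C_pack : cumulative R R := HB.pack C C_mixin.

Let density q (E : set R) : leb.-integrable `[a, b] (EFin \o q) ->
  (forall t, q t <= m t) ->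
  (forall x y, a <= x -> x <= y -> y <= b ->
    `|Phi y - Phi x| <= \int[leb]_(t in `[x, y]) q t) ->
  measurable E -> E `<=` `]a, b] ->
  (\int[leb]_(t in E) (m t - q t)%:E <=
   lebesgue_stieltjes_measure C_pack E)%E.
Proof.
move=> iq qm Phiq mE Eab.
have mab : measurable_fun `]a, b] (fun t => (m t - q t)%:E).
  have := integrableB (measurable_itvR _) im iq.
  by move/(measurable_int leb); apply: measurable_funS => //;
    exact: subset_itv_oc_cc.
have := @le_integral_lebesgue_stieltjes C_pack ((fun t => (m t - q t)%:E) \_ `]a, b]).
rewrite (_ : (\int[leb]_(t in E) (m t - q t)%:E =
    \int[leb]_(t in E) (((fun t => (m t - q t)%:E) \_ `]a, b]) t))%E); last first.
  by apply: eq_integral => t /set_mem /Eab abt; rewrite patchE mem_set.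
apply => //.
- exact/(measurable_restrictT _ _).1.
- by move=> t; apply: erestrict_ge0 => s _; rewrite lee_fin subr_ge0.
move=> x y xy; rewrite -integral_mkcondr.
apply: le_trans (_ : ((\int[leb]_(t in `[clip x, clip y]) (m t - q t))%:E <= _)%E); last first.
  by rewrite lee_fin leC// ltW.
rewrite /Rintegral fineK; last first.
  have := integrable_fin_num _ (integrableB _ (sub im _ _) (sub iq _ _)).
  by apply.
apply: ge0_subset_integral => //=.
- exact: measurableI.
- have := integrableB (measurable_itvR _) (sub im (clip_ge x) (clip_le y)) (sub iq (clip_ge x) (clip_le y)).
  by move/(measurable_int leb).
- by move=> t _; rewrite lee_fin subr_ge0.
- move=> t [] /=; rewrite !in_itv/= => /andP[xt ty] /andP[at' tb].
  by rewrite /clip ge_max !(ltW at')/= ge_min (ltW xt)/= le_max le_min ty tb orbT.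
Qed.

(** A form of the statement that the minimum of two upper gradients is an upper
    gradient along a curve, without differentiating. With [m = max q1 q2] and
    [C] the primitive of [m] minus [Phi], both [m - q1] and [m - q2] are dominated
    on intervals by the increments of [C], hence on all measurable sets by
    the Stieltjes measure of [C]. Splitting [a, b] into [q1 < q2] and its
    complement bounds the integral of [m - min q1 q2] by [C b - C a]. *)
Lemma increment_le_integral_min : Phi b - Phi a <= \int[leb]_(t in `[a, b]) Num.min (q1 t) (q2 t).
Proof.
have [mq1 mq2] : measurable_fun `[a, b] q1 /\ measurable_fun `[a, b] q2.
  by split; apply/measurable_EFinP; [exact: measurable_int iq1|exact: measurable_int iq2].
pose E := `]a, b]%classic `&` [set t | q1 t < q2 t].
pose F := `]a, b]%classic `&` [set t | q2 t <= q1 t].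
have mq1' : measurable_fun `]a, b] q1 by apply: measurable_funS mq1 => //; exact: subset_itv_oc_cc.
have mq2' : measurable_fun `]a, b] q2 by apply: measurable_funS mq2 => //; exact: subset_itv_oc_cc.
have mE : measurable E by exact: (measurable_fun_ltr mq1' mq2' (measurable_itvR _) (Y := [set true])).
have mF : measurable F by exact: (measurable_fun_ler mq2' mq1' (measurable_itvR _) (Y := [set true])).
have EF : `]a, b]%classic = E `|` F.
  apply/seteqP; split=> [t abt|t [][]//].
  by have [?|?] := ltP (q1 t) (q2 t); [left|right].
have EF0 : E `&` F = set0.
  by apply/seteqP; split=> // t [[_ /= tE] [_ /=]]; rewrite leNgt tE.
pose mn t := m t - Num.min (q1 t) (q2 t).
have mnE t : mn t = `|q1 t - q2 t|.
  rewrite /mn /m; case: ltP => q12.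
    by rewrite ler0_norm ?opprB// subr_le0 ltW.
  by rewrite ger0_norm ?subr_ge0.
have imin : leb.-integrable `[a, b] (fun t => (Num.min (q1 t) (q2 t))%:E).
  apply: le_integrable iq1 => //.
    by apply/measurable_EFinP; apply: measurable_minr.
  move=> t _ /=; rewrite lee_fin !ger0_norm ?le_min ?q10 ?q20//.
  by rewrite ge_min lexx.
have mmn : measurable_fun `]a, b] (EFin \o mn).
  have := integrableB (measurable_itvR _) im imin.
  by move/(measurable_int leb); apply: measurable_funS => //;
    exact: subset_itv_oc_cc.
have nuab : lebesgue_stieltjes_measure C_pack `]a, b]%classic = (C b - C a)%:E.
  rewrite /lebesgue_stieltjes_measure /measure_extension measurable_mu_extE/=.
    by rewrite wlength_itv_bnd.
  exact: is_ocitv.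
have main : (\int[leb]_(t in `]a, b]) (mn t)%:E <= (C b - C a)%:E)%E.
  rewrite -nuab EF measureU// ge0_integral_setU//=; last 3 first.
  - by rewrite -EF.
  - by move=> t _; rewrite lee_fin mnE normr_ge0.
  - by apply/disj_setPS; rewrite EF0.
  apply: leeD.
    apply: le_trans (density iq1 _ Phi1 mE _); last 2 first.
    + by move=> t; rewrite le_max lexx.
    + by move=> t [].
    apply: le_integral_pointwise => t [_ /= q12].
    by rewrite lee_fin /mn (min_idPl (ltW q12)).
  apply: le_trans (density iq2 _ Phi2 mF _); last 2 first.
  + by move=> t; rewrite le_max lexx orbT.
  + by move=> t [].
  apply: le_integral_pointwise => t [_ /= q12].
  by rewrite lee_fin /mn (min_idPr q12).
have clipb : clip b = b by rewrite /clip minxx; apply/max_idPr.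
have clipa : clip a = a by rewrite /clip (min_idPl ab) maxxx.
move: main; rewrite CB// clipb clipa integral_itv_obnd_cbnd//.
have -> : (\int[leb]_(t in `[a, b]) (mn t)%:E =
    (\int[leb]_(t in `[a, b]) m t -
     \int[leb]_(t in `[a, b]) Num.min (q1 t) (q2 t))%:E)%E.
  rewrite -RintegralB// /Rintegral fineK//.
  by apply: integrable_fin_num => //; exact: (integrableB _ im imin).
rewrite lee_fin; lra.
Qed.

End min_of_two.

End interval_function_min.

(** * Increments bounded by the infimum of a sequence of densities *)

Section interval_function_inf.
Context {R : realType}.
Local Notation leb := (@lebesgue_measure R).
Variables (l : R) (l0 : 0 <= l) (Phi : R -> R) (q : nat -> R -> R).
Hypotheses (q0 : forall n x, 0 <= q n x)
  (iq : forall n, leb.-integrable `[0, l] (EFin \o q n))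
  (Phiq : forall n x y, 0 <= x -> x <= y -> y <= l ->
    `|Phi y - Phi x| <= \int[leb]_(t in `[x, y]) q n t).

Let r := fix r n x := if n is k.+1 then Num.min (r k x) (q n x) else q 0 x.

Let r0 n x : 0 <= r n x.
Proof. by elim: n => //= n IH; rewrite le_min IH q0. Qed.

Let r_le_q n k x : (k <= n)%N -> r n x <= q k x.
Proof.
elim: n => [|n IH]; first by rewrite leqn0 => /eqP ->.
rewrite leq_eqVlt => /predU1P[->|/IH kn] /=; first by rewrite ge_min lexx orbT.
by rewrite ge_min kn.
Qed.

Let r_rng n x : exists k, r n x = q k x.
Proof.
elim: n => [|n [k IH]]; first by exists 0%N.
by rewrite /=; case: leP => _; [exists k|exists n.+1].
Qed.

Let mr n : measurable_fun `[0, l] (r n).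
Proof.
have mq k : measurable_fun `[0, l] (q k).
  by apply/measurable_EFinP; exact: measurable_int (iq k).
by elim: n => [|k IH]; [exact: mq|exact: (measurable_minr IH (mq k.+1))].
Qed.

Let ir n : leb.-integrable `[0, l] (EFin \o r n).
Proof.
apply: le_integrable (iq 0) => //; first by apply/measurable_EFinP; exact: (mr n).
by move=> t _ /=; rewrite lee_fin !ger0_norm// r_le_q.
Qed.

Let sub (f : R -> R) x y : leb.-integrable `[0, l] (EFin \o f) ->
  0 <= x -> y <= l -> leb.-integrable `[x, y] (EFin \o f).
Proof.
move=> i ax yb; apply: integrableS i => // t /=; rewrite !in_itv/=.
by move=> /andP[xt ty]; rewrite (le_trans ax)// (le_trans ty).
Qed.

Let Phir n x y : 0 <= x -> x <= y -> y <= l ->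
  `|Phi y - Phi x| <= \int[leb]_(t in `[x, y]) r n t.
Proof.
elim: n x y => [|n IH] x y x0 xy yl; first exact: Phiq.
(* the bound of signed increments is applied to Phi and to - Phi *)
rewrite ler_norml lerNl opprB; apply/andP; split.
- have := @increment_le_integral_min R x y xy (-%R \o Phi) (r n) (q n.+1).
  rewrite /= opprK addrC; apply => //; try exact: sub.
  + move=> u v xu uv vy; rewrite opprK addrC distrC.
    by apply: IH => //; [exact: le_trans xu|exact: le_trans yl].
  + move=> u v xu uv vy; rewrite opprK addrC distrC.
    by apply: Phiq => //; [exact: le_trans xu|exact: le_trans yl].
- apply: increment_le_integral_min => //; try exact: sub.
  + move=> u v xu uv vy.
    by apply: IH => //; [exact: le_trans xu|exact: le_trans yl].
  + move=> u v xu uv vy.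
    by apply: Phiq => //; [exact: le_trans xu|exact: le_trans yl].
Qed.

(** The minima of finitely many of the [q n] are bounds by induction, and
    they decrease to the infimum, dominated by [q 0]. *)
Lemma increment_le_integral_inf : (`|Phi l - Phi 0|%:E <=
  \int[leb]_(t in `[0%R, l]) einfs (fun n => (q n t)%:E) 0%N)%E.
Proof.
have cvg_r t : (r n t)%:E @[n --> \oo] --> einfs (fun n => (q n t)%:E) 0%N.
  have -> : einfs (fun n => (q n t)%:E) 0%N =
      ereal_inf (range (fun n => (r n t)%:E)).
    apply/eqP; rewrite eq_le; apply/andP; split.
    - apply: le_ereal_inf_tmp => _ [n _ <-]; have [k ->] := r_rng n t.
      by apply: ereal_inf_lbound; exists k.
    - apply: le_ereal_inf_tmp => _ [k _ <-].
      apply: (@le_trans _ _ (r k t)%:E); last by rewrite lee_fin r_le_q.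
      by apply: ereal_inf_lbound; exists k.
  apply: ereal_nonincreasing_cvgn; apply/nonincreasing_seqP => n /=.
  by rewrite lee_fin ge_min lexx.
have mq k : measurable_fun `[0, l] (EFin \o q k) by exact: measurable_int (iq k).
pose D : set (measurableTypeR R) := `[0, l]%classic.
have dom : {ae leb, forall t n, D t ->
    `|(EFin \o r n) t| <= (EFin \o q 0) t}%E.
  by apply: aeW => t n _ /=; rewrite lee_fin ger0_norm// r_le_q.
have [|||||_ _ H] := @dominated_convergence _ _ _ leb D
  (measurable_itvR _) (fun n => EFin \o r n)
  (fun t => einfs (fun n => (q n t)%:E) 0%N) (EFin \o q 0).
- by move=> n; exact: measurable_int (ir n).
- exact: (measurable_fun_einfs mq 0%N).
- by apply: aeW => t _; exact: cvg_r.
- exact: iq.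
- exact: dom.
apply: (cvge_to_ge H); apply: nearW => n /=.
have := @Phir n 0 l (lexx _) l0 (lexx _); rewrite -lee_fin /Rintegral fineK//.
exact: integrable_fin_num (ir n).
Qed.

End interval_function_inf.

(** * Curve families of modulus zero *)

Section modulus.
Context {R : realType} {d : measure_display} {X : borelMetricType R d}.
Variable mu : {measure set X -> \bar R}.
Local Notation leb := (@lebesgue_measure R).
Local Open Scope ereal_scope.

(** An integrable density is what remains of a family of modulus zero: the
    exceptional curves are those on which its line integral is infinite. *)
Definition density (rho : X -> \bar R) :=
  [/\ measurable_fun setT rho, forall x, 0 <= rho x & \int[mu]_x rho x < +oo].

Lemma measurable_along_setT (g : X -> \bar R) gamma : rectifiable gamma ->
  measurable_fun setT g ->
  measurable_fun `[0%R, fine (curve_length gamma 0 1)]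
    (g \o arc_length_param gamma).
Proof. by move=> gR mg; apply: (measurable_along gR measurableT mg). Qed.

Lemma line_integral_ge0 (g : X -> \bar R) gamma :
  (forall x, 0 <= g x) -> 0 <= line_integral g gamma.
Proof. by move=> g0; apply: integral_ge0. Qed.

(** Countably many exceptional families can be replaced by a single one, by a
    weighted series of the densities. *)
Lemma density_sum (rho : nat -> X -> \bar R) :
  (forall n, density (rho n)) -> exists2 r, density r &
  forall gamma, rectifiable gamma -> line_integral r gamma < +oo ->
  forall n, line_integral (rho n) gamma < +oo.
Proof.
move=> rhoD; pose I n := fine (\int[mu]_x rho n x).
have IE n : \int[mu]_x rho n x = (I n)%:E.
  have [_ r0 ri] := rhoD n; rewrite fineK// ge0_fin_numE//.
  exact: integral_ge0.
have I0 n : (0 <= I n)%R by rewrite fine_ge0// integral_ge0// => x _; have [] := rhoD n.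
(* with these weights the n-th term has integral at most 2^-(n+1) *)
pose c n := ((2 ^+ n.+1)^-1 / (1 + I n))%R.
have c0 n : (0 < c n)%R by rewrite divr_gt0// ?invr_gt0 ?exprn_gt0// ltr_pwDl.
pose r x := \sum_(n <oo) ((c n)%:E * rho n x).
have t0 n x : 0 <= (c n)%:E * rho n x.
  by rewrite mule_ge0 ?lee_fin ?(ltW (c0 n))//; have [] := rhoD n.
have mt n : measurable_fun setT (fun x => (c n)%:E * rho n x).
  by apply: measurable_funeM; have [] := rhoD n.
exists r.
  split.
  - by apply: ge0_emeasurable_sum.
  - by move=> x; apply: nneseries_ge0 => *.
  - rewrite integral_nneseries//.
    apply: le_lt_trans (ltry 1); apply: le_trans (epsilon_trick0 xpredT ler01).
    apply: lee_nneseries => [n _ _|n _]; first exact: integral_ge0.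
    rewrite ge0_integralZl//; last 3 first.
    + by have [] := rhoD n.
    + by have [] := rhoD n.
    + by rewrite lee_fin ltW.
    rewrite IE -EFinM lee_fin /c natrX div1r -mulrA ler_piMr ?invr_ge0 ?exprn_ge0//.
    by rewrite mulrC ler_pdivrMr ?mul1r ?lerDr// ltr_pwDl.
move=> gamma gR rfin n.
have mn k : measurable_fun `[0%R, fine (curve_length gamma 0 1)]
    (fun h => (c k)%:E * rho k (arc_length_param gamma h)).
  by apply: (measurable_along_setT gR (mt k)).
have : (c n)%:E * line_integral (rho n) gamma <= line_integral r gamma.
  rewrite /line_integral -ge0_integralZl//=; last 3 first.
  - by apply: (measurable_along_setT gR); have [] := rhoD n.
  - by move=> h _; have [] := rhoD n.
  - by rewrite lee_fin ltW.
  apply: le_integral_pointwise => h _; rewrite /r.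
  rewrite (nneseries_split_cond 0%N n.+1)//= add0n big_mkord big_ord_recr/=.
  by rewrite (le_trans _ (leeDl _ _)) ?nneseries_ge0// leeDr// sume_ge0.
have := line_integral_ge0 gamma (_ : forall x, 0 <= rho n x).
case: (rhoD n) => _ r0 _ /(_ r0).
case: (line_integral (rho n) gamma) => [v| |]// _; first by rewrite ltry.
by rewrite gt0_muley ?lte_fin// leye_eq => /eqP rE; rewrite rE in rfin.
Qed.

(** Sum admissible densities of mass [2^-(n+1)]: each of them contributes at least
    one to the line integral. *)
Lemma modulus1_eq0_density Gamma : modulus1 mu Gamma = 0 ->
  exists2 rho, density rho & forall gamma, Gamma gamma -> rectifiable gamma ->
    line_integral rho gamma = +oo.
Proof.
move=> G0.
have adm n : exists rho : X -> \bar R, [/\ measurable_fun setT rho,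
    forall x, 0 <= rho x, \int[mu]_x rho x <= (1 / (2 ^ n.+1)%:R)%:E &
    forall gamma, Gamma gamma -> rectifiable gamma -> 1 <= line_integral rho gamma].
  have : modulus1 mu Gamma < (1 / (2 ^ n.+1)%:R)%:E.
    by rewrite G0 lte_fin divr_gt0// ltr0n expn_gt0.
  move=> /ereal_inf_lt[_ [rho [mrho rho0 rho1] <-] lt].
  by exists rho; split => //; exact: ltW.
move/choice : adm => [rho rhoP].
have r0 n x : 0 <= rho n x by have [] := rhoP n.
have mr n : measurable_fun setT (rho n) by have [] := rhoP n.
exists (fun x => \sum_(n <oo) rho n x).
  split; [by apply: ge0_emeasurable_sum|by move=> x; apply: nneseries_ge0|].
  rewrite integral_nneseries//.
  apply: le_lt_trans (ltry 1); apply: le_trans (epsilon_trick0 xpredT ler01).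
  apply: lee_nneseries => [n _ _|n _]; first exact: integral_ge0.
  by have [] := rhoP n.
move=> gamma Gg gR; rewrite /line_integral integral_nneseries//; last first.
  by move=> n; exact: measurable_along_setT.
apply/eqyP => M M0.
apply: le_trans (nneseries_lim_ge (Num.truncn M).+1 _); last first.
  by move=> n _ _; exact: line_integral_ge0.
apply: (@le_trans _ _ (\sum_(0 <= i < (Num.truncn M).+1) 1%:E)).
  by rewrite sumEFin lee_fin big_mkord sumr_const card_ord ltW// truncnS_gt.
by apply: lee_sum => n _; have [_ _ _] := rhoP n; apply.
Qed.


Lemma density_modulus1_eq0 (Gamma : set (R -> X)) rho : density rho ->
  (forall gamma, Gamma gamma -> rectifiable gamma ->
    line_integral rho gamma = +oo) ->
  modulus1 mu Gamma = 0.
Proof.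
move=> [mrho rho0 rhoi] Goo; apply/eqP; rewrite eq_le; apply/andP; split; last first.
  by apply: le_ereal_inf_tmp => _ [g [_ g0 _] <-]; exact: integral_ge0.
pose I := fine (\int[mu]_x rho x).
have IE : \int[mu]_x rho x = I%:E.
  by rewrite fineK// ge0_fin_numE// integral_ge0.
have I0 : (0 <= I)%R by rewrite fine_ge0// integral_ge0.
apply/lee_addgt0Pr => e e0; rewrite add0e.
pose c : R := (e / (1 + I))%R.
have c0 : (0 < c)%R by rewrite divr_gt0// ltr_pwDl.
apply: (@le_trans _ _ (\int[mu]_x (c%:E * rho x))).
  apply: ereal_inf_lbound; exists (fun x => c%:E * rho x) => //; split.
  - exact: measurable_funeM.
  - by move=> x; rewrite mule_ge0// lee_fin ltW.
  - move=> gamma Gg gR; rewrite /line_integral ge0_integralZl//=.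
    + by have := Goo _ Gg gR; rewrite /line_integral => ->; rewrite gt0_muley ?lte_fin// leey.
    + exact: (measurable_along_setT gR).
    + by rewrite lee_fin ltW.
rewrite ge0_integralZl//; last by rewrite lee_fin ltW.
rewrite IE -EFinM lee_fin /c -mulrA ler_piMr ?(ltW e0)//.
by rewrite mulrC ler_pdivrMr ?mul1r ?lerDr// ltr_pwDl.
Qed.

End modulus.

(** * Minimal weak upper gradients *)

Section weak_upper_gradient_theory.
Context {R : realType} {d : measure_display} {X : borelMetricType R d}.
Variable mu : {measure set X -> \bar R}.
Local Notation leb := (@lebesgue_measure R).
Local Open Scope ereal_scope.
Variables (A : set X) (mA : measurable A).

Definition curve_in (gamma : R -> X) := forall t : R, (0 <= t <= 1)%R -> A (gamma t).

Lemma weak_upper_gradient_density u g : weak_upper_gradient mu A u g ->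
  exists2 rho, density mu rho & forall gamma, rectifiable gamma ->
    curve_in gamma -> line_integral rho gamma < +oo ->
    upper_gradient_along u g gamma.
Proof.
move=> [mg g0 [Gamma /modulus1_eq0_density[rho rhoD rhoG] ug]].
exists rho => // gamma gR gA rfin; apply: ug => // Gg.
by move: rfin; rewrite rhoG.
Qed.

Lemma density_weak_upper_gradient u g rho : measurable_fun A g ->
  (forall x, A x -> 0 <= g x) -> density mu rho ->
  (forall gamma, rectifiable gamma -> curve_in gamma ->
    line_integral rho gamma < +oo -> upper_gradient_along u g gamma) ->
  weak_upper_gradient mu A u g.
Proof.
move=> mg g0 rhoD ug; split => //.
exists [set gamma | line_integral rho gamma = +oo].
  exact: (density_modulus1_eq0 rhoD).
move=> gamma gR gA /= rn; apply: ug => //.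
by rewrite ltey; apply/eqP.
Qed.

(** Along a curve of positive length the line integral is infinite; along a curve
    of length zero the end points coincide. *)
Lemma weak_upper_gradient_pinfty u : weak_upper_gradient mu A u (cst +oo).
Proof.
apply: (@density_weak_upper_gradient _ _ (cst 0)).
- exact: measurable_cst.
- by move=> x _; rewrite leey.
- by split; [exact: measurable_cst|by []|rewrite integral0 ltry].
move=> gamma gR gA _; rewrite /upper_gradient_along /line_integral integral_cst//=.
have [l0|l0] := ltP 0%R (fine (curve_length gamma 0 1)).
  rewrite lebesgue_measure_itv/= lte_fin l0 gt0_mulye ?leey//.
  by rewrite -EFinB lte_fin subr_gt0.
have := mdist_le_length gR (lexx 0%R) ler01 (lexx 1%R).
rewrite length_upto0 subr0 => /le_trans/(_ l0) d0.
have -> : gamma 0%R = gamma 1%R.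
  by apply/mdist_positivity/eqP; rewrite eq_le d0 mdist_ge0.
by rewrite subrr normr0 mule_ge0// leey.
Qed.

(** The exceptional density has finite line integral along every subcurve as well,
    so the upper gradient inequality holds on all subcurves and bounds all
    increments of [u] along the curve, not only the one between its end points. *)
Lemma increment_le_line_integral u g rho gamma : measurable_fun A g ->
  (forall x, A x -> 0 <= g x) -> density mu rho ->
  (forall gamma, rectifiable gamma -> curve_in gamma ->
    line_integral rho gamma < +oo -> upper_gradient_along u g gamma) ->
  rectifiable gamma -> curve_in gamma -> line_integral rho gamma < +oo ->
  forall x y : R, (0 <= x)%R -> (x <= y)%R -> (y <= length_upto gamma 1)%R ->
  `|u (arc_length_param gamma y) - u (arc_length_param gamma x)|%:E <=
  \int[leb]_(h in `[x, y]) g (arc_length_param gamma h).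
Proof.
move=> mg g0 [mr r0 ri] ug gR gA rfin x y x0 xy yl.
move: xy; rewrite le_eqVlt => /predU1P[xy|xy].
  subst y; rewrite subrr normr0; apply: integral_ge0 => h /=.
  rewrite in_itv/= => /andP[xh hx]; apply: g0.
  by apply: arc_length_param_in => //; [exact: le_trans xh|exact: le_trans yl].
have [s [s0 s1 sx]] := length_upto_surj gR x0 (le_trans (ltW xy) yl).
have [t [t0 t1 ty]] := length_upto_surj gR (le_trans x0 (ltW xy)) yl.
have st : (s < t)%R.
  rewrite ltNge; apply/negP => ts; move: xy; rewrite ltNge => /negP; apply.
  by rewrite -sx -ty; exact: length_upto_nd.
have subA : curve_in (subcurve gamma s t).
  move=> r /andP[r0' r1]; apply: gA.
  have ts0 : (0 <= t - s)%R by rewrite subr_ge0 ltW.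
  have := mulr_ge0 r0' ts0.
  have : (r * (t - s) <= t - s)%R by rewrite ler_piMl.
  by move=> *; apply/andP; split; lra.
have := ug _ (rectifiable_subcurve gR s0 st t1) subA.
rewrite /upper_gradient_along (line_integral_subcurve gR s0 st t1 measurableT mr)//.
rewrite (line_integral_subcurve gR s0 st t1 mA mg)//.
rewrite -sx -ty !arc_length_param_upto// /subcurve mul0r addr0 mul1r.
rewrite addrCA subrr addr0 distrC; apply.
apply: le_lt_trans rfin; rewrite /line_integral.
apply: ge0_subset_integral => //=.
- exact: (measurable_along gR measurableT mr).
- apply: subset_itv; rewrite bnd_simp.
    by rewrite -(length_upto0 gamma); apply: length_upto_nd.
  exact: length_upto_nd.
Qed.

(** The infimum of a minimising sequence is a weak upper gradient by
    [increment_le_integral_inf], applied along every curve on which all members of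
    the sequence, and the densities of their exceptional families, have finite
    line integral. [total_var] only sees approximations that possess a minimal
    weak upper gradient; by this lemma any weak upper gradient will do. *)
Lemma exists_minimal_weak_upper_gradient u :
  exists g, minimal_weak_upper_gradient mu A u g.
Proof.
pose W := [set \int[mu]_(x in A) g x | g in [set g | weak_upper_gradient mu A u g]].
have W0 z : W z -> 0 <= z.
  by move=> [g [_ g0 _] <-]; exact: integral_ge0.
have [Woo|] := eqVneq (ereal_inf W) +oo.
  exists (cst +oo); split; first exact: weak_upper_gradient_pinfty.
  move=> g' g'W; rewrite (_ : \int[mu]_(x in A) g' x = +oo) ?leey//.
  apply/eqP; rewrite eq_le leey/= -Woo; apply: ereal_inf_lbound.
  by exists g'.
have infW0 : 0 <= ereal_inf W by exact: le_ereal_inf_tmp.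
move=> Wfin; have {}Wfin : ereal_inf W \is a fin_num.
  by rewrite ge0_fin_numE// ltey.
pose m := fine (ereal_inf W).
have mE : ereal_inf W = m%:E by rewrite fineK.
have ex n : exists g, [/\ weak_upper_gradient mu A u g &
    \int[mu]_(x in A) g x < (m + n.+1%:R^-1)%:E].
  have [z [g gW <-] lt] := @lb_ereal_inf_adherent _ W (n.+1%:R^-1) ltac:(by []) Wfin.
  by exists g; split => //; rewrite EFinD -mE.
move/choice : ex => [g gP].
have gW n : weak_upper_gradient mu A u (g n) by have [] := gP n.
have mg n : measurable_fun A (g n) by have [] := gW n.
have g0 n x : A x -> 0 <= g n x by have [_ + _] := gW n; apply.
have exr n : exists rho, density mu rho /\ forall gamma, rectifiable gamma ->
    curve_in gamma -> line_integral rho gamma < +oo ->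
    upper_gradient_along u (g n) gamma.
  by have [rho ? ?] := weak_upper_gradient_density (gW n); exists rho.
move/choice : exr => [rho rhoP].
have rhoD n : density mu (fun x => rho n x + (g n \_ A) x).
  have [[mr r0 ri] _] := rhoP n; have gA0 x : 0 <= (g n \_ A) x.
    by apply: erestrict_ge0; exact: g0.
  have mgA : measurable_fun setT (g n \_ A) by exact/(measurable_restrictT _ _).1.
  split; [exact: emeasurable_funD|by move=> x; rewrite adde_ge0|].
  rewrite ge0_integralD// lte_add_pinfty// -integral_mkcond.
  by have [_ /lt_trans] := gP n; apply; exact: ltry.
have [r rD rP] := density_sum rhoD.
pose h x := einfs (fun n => g n x) 0%N.
have h_le n x : h x <= g n x by apply: ereal_inf_lbound; exists n.
have mh : measurable_fun A h by exact: measurable_fun_einfs.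
have h0 x : A x -> 0 <= h x.
  by move=> Ax; apply: le_ereal_inf_tmp => _ [n _ <-]; exact: g0.
exists h; split; last first.
  move=> g' g'W; apply: (@le_trans _ _ m%:E); last first.
    by rewrite -mE; apply: ereal_inf_lbound; exists g'.
  apply/lee_addgt0Pr => e e0.
  have [n ne] : exists n, (n.+1%:R^-1 <= e)%R.
    exists (Num.truncn e^-1); rewrite invf_ple ?posrE//.
    by rewrite ltW// truncnS_gt.
  have [_ /ltW gm] := gP n; apply: le_trans (le_trans gm _); last first.
    by rewrite EFinD leeD2l// lee_fin.
  exact: le_integral_pointwise.
apply: (density_weak_upper_gradient mh h0 rD) => gamma gR gA rfin.
have rg n : line_integral (fun x => rho n x + (g n \_ A) x) gamma < +oo.
  exact: rP.
have arcA t : (0 <= t <= length_upto gamma 1)%R -> A (arc_length_param gamma t).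
  by move=> /andP[t0 t1]; exact: arc_length_param_in.
have rr n : line_integral (rho n) gamma < +oo.
  apply: le_lt_trans (rg n); apply: le_integral_pointwise => t _.
  by rewrite leeDl//; apply: erestrict_ge0; exact: g0.
pose l := length_upto gamma 1.
pose D : set (measurableTypeR R) := `[0%R, l]%classic.
have ig n : leb.-integrable D (g n \o arc_length_param gamma).
  apply/integrableP; split; first exact: (measurable_along gR mA (mg n) gA).
  apply: le_lt_trans (rg n); apply: le_integral_pointwise => t.
  rewrite /D/= in_itv/= => tl; have At := arcA _ tl.
  rewrite gee0_abs ?g0// patchE mem_set// leeDr//.
  by have [[_ r0 _] _] := rhoP n.
pose G n := (g n \o arc_length_param gamma) \_ D.
have G0 n t : 0 <= G n t.
  by apply: erestrict_ge0 => s; rewrite /D/= in_itv/= => /arcA; exact: g0.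
pose q n t : R := fine (G n t).
have GD n t : D t -> G n t = g n (arc_length_param gamma t).
  by move=> Dt; rewrite /G patchE mem_set.
have mD : measurable D by exact: measurable_itvR.
have qE n : {ae leb, forall t, D t -> (q n t)%:E = g n (arc_length_param gamma t)}.
  apply: filterS (integrable_ae mD (ig n)) => t /= H Dt.
  by rewrite /q fineK ?GD//; exact: H.
have mq n : measurable_fun D (EFin \o q n).
  apply/measurable_EFinP; apply: measurableT_comp => //.
  apply: (eq_measurable_fun (g n \o arc_length_param gamma)).
    by move=> t /set_mem Dt; rewrite GD.
  exact: measurable_int (ig n).
have iq n : leb.-integrable D (EFin \o q n).
  apply/integrableP; split => //; have /integrableP[_] := ig n.
  apply: le_lt_trans; apply: ae_ge0_le_integral_pointwise => //.
  by apply: filterS (qE n) => t /= H Dt; rewrite -H.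
have l0 : (0 <= l)%R by rewrite -(length_upto0 gamma); exact: length_upto_nd.
have main := @increment_le_integral_inf R l l0 (u \o arc_length_param gamma) q.
rewrite /upper_gradient_along distrC.
have := arc_length_param_upto gR ler01 (lexx _).
have := arc_length_param_upto gR (lexx _) ler01.
rewrite length_upto0 -/l => <- <-.
apply: le_trans (main _ iq _) _.
- by move=> n x; rewrite fine_ge0.
- move=> n x y x0 xy yl; rewrite -lee_fin.
  have := increment_le_line_integral (mg n) (g0 n) (rhoP n).1 (rhoP n).2 gR gA (rr n) x0 xy yl.
  move=> /le_trans; apply.
  have subD : `[x, y]%classic `<=` D.
    apply: subset_itv; rewrite bnd_simp//.
  rewrite /Rintegral fineK; last first.
    apply: integrable_fin_num; [exact: measurable_itvR|].
    by apply: integrableS (iq n) => //; exact: measurable_itvR.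
  apply: ae_ge0_le_integral_pointwise.
  + by move=> t /subD Dt /=; rewrite -GD.
  + by move=> t _; rewrite lee_fin fine_ge0.
  + by apply: filterS (qE n) => t /= H /subD Dt; rewrite H.
rewrite /line_integral.
apply: ae_ge0_le_integral_pointwise.
- by move=> t _; apply: le_ereal_inf_tmp => _ [n _ <-]; rewrite lee_fin fine_ge0.
- by move=> t; rewrite /= in_itv/= => /arcA; exact: h0.
have : {ae leb, forall t n, D t -> (q n t)%:E = g n (arc_length_param gamma t)}.
  exact/ae_foralln.
apply: filterS => t /= H Dt; apply: le_ereal_inf_tmp => _ [n _ <-].
by rewrite -H//; apply: ereal_inf_lbound; exists n.
Qed.

End weak_upper_gradient_theory.

(** * Doubling complete spaces are proper *)

Section doubling_proper.
Context {R : realType} {d : measure_display} {X : borelMetricType R d}.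
Variable mu : {measure set X -> \bar R}.
Hypothesis mu_doubling : doubling mu.

Lemma measurable_open (A : set X) : open A -> measurable A.
Proof. by move=> oA; rewrite borelE; exact: sub_sigma_algebra. Qed.

Lemma open_mball (x : X) (r : R) : open (ball x r).
Proof.
rewrite openE => y; rewrite ballEmdist/= => xy; apply/nbhs_ballP.
exists (r - mdist x y); first by rewrite /= subr_gt0.
move=> z; rewrite !ballEmdist/= ltrBrDl; apply: le_lt_trans.
exact: metric_triangle.
Qed.

Lemma measurable_mball (x : X) (r : R) : measurable (ball x r).
Proof. exact/measurable_open/open_mball. Qed.

Lemma mball_lty (x : X) (r : R) : (mu (ball x r) < +oo)%E.
Proof.
have [r0|r0] := ltP 0 r; last first.
  rewrite (_ : ball x r = set0) ?measure0//; apply/seteqP; split=> // y.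
  by rewrite ballEmdist/= => /lt_le_trans/(_ r0); rewrite ltNge mdist_ge0.
have [c c1 /(_ x r r0)[_ _]] := mu_doubling.
apply: le_lt_trans; rewrite -[leLHS]mul1e.
by apply: lee_wpmul2r => //; rewrite lee_fin.
Qed.

Lemma mball_gt0 (x : X) (r : R) : 0 < r -> (0 < mu (ball x r))%E.
Proof.
move=> r0; have [c c1 /(_ x (r / 2))[|+ _ _]] := mu_doubling.
  by rewrite divr_gt0.
by rewrite mulrC divfK.
Qed.

Lemma mball_iter_doubling : exists2 c : R, 0 < c & forall x (r : R) k, 0 < r ->
  (mu (ball x (2 ^+ k * r)) <= (c ^+ k)%:E * mu (ball x r))%E.
Proof.
have [c c1 H] := mu_doubling; have c0 : 0 < c by exact: lt_le_trans c1.
exists c => // x r k r0; elim: k => [|k IH]; first by rewrite !expr0 mul1r mul1e.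
rewrite exprS -mulrA; have [] := H x (2 ^+ k * r).
  by rewrite mulr_gt0 ?exprn_gt0.
move=> _ + _ => /le_trans; apply; rewrite exprS EFinM -muleA.
by apply: lee_wpmul2l => //; rewrite lee_fin ltW.
Qed.

Let cover_by (r : R) (s : seq X) := [set y | exists2 x, x \in s & ball x r y].

(** Balls of half the separation are disjoint. *)
Lemma separated_measure (e kappa : R) (s : seq X) :
  pairwise (fun x y => e <= mdist x y) s ->
  (forall x, x \in s -> (kappa%:E <= mu (ball x (e / 2)))%E) ->
  (((size s)%:R * kappa)%:E <= mu (cover_by (e / 2) s))%E.
Proof.
elim: s => [|x s IH] /=; first by rewrite mul0r.
move=> /andP[xs ps] ks.
have mU : measurable (cover_by (e / 2) s).
  apply: measurable_open; rewrite openE => y [z zs zy].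
  have := open_mball z (e / 2); rewrite openE => /(_ _ zy).
  by apply: filterS => w; exists z.
have -> : cover_by (e / 2) (x :: s) = ball x (e / 2) `|` cover_by (e / 2) s.
  apply/seteqP; split => y.
    by move=> [z]; rewrite inE => /predU1P[->|zs] zy; [left|right; exists z].
  by move=> [xy|[z zs zy]]; [exists x => //; rewrite mem_head|exists z => //; rewrite inE zs orbT].
rewrite measureU//; last 2 first.
- exact: measurable_mball.
- apply/seteqP; split=> // y [xy [z zs zy]].
  have := allP xs _ zs; rewrite leNgt => /negP; apply.
  move: xy zy; rewrite !ballEmdist/= => xy zy.
  rewrite (le_lt_trans (metric_triangle x y z))// (splitr e) ltrD//.
  by rewrite metric_sym.
rewrite -natr1 mulrDl mul1r addrC EFinD; apply: leeD.
  by apply: ks; rewrite mem_head.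
by apply: IH => // z zs; apply: ks; rewrite inE zs orbT.
Qed.

(** By doubling, all balls of radius [e / 2] with centre in the given ball have
    measure at least [kappa], a fixed fraction of the measure of an enlarged ball.
    Hence a separated family in it is bounded in number, and a maximal one is
    a net. *)
Lemma mball_finite_net (x0 : X) (r e : R) : 0 < r -> 0 < e ->
  exists s : seq X, ball x0 r `<=` cover_by e s.
Proof.
move=> r0 e0; have [c c0 cP] := mball_iter_doubling.
(* k doublings lead from radius e / 2 to a ball that contains the large one *)
have [k kP] : exists k, 2 * r + e <= 2 ^+ k * (e / 2).
  exists (Num.truncn ((2 * r + e) / (e / 2))).+1.
  rewrite -ler_pdivrMr ?divr_gt0//; set z := (X in X <= _).
  rewrite (@le_trans _ _ (Num.truncn z).+1%:R)// ?(ltW (truncnS_gt _))//.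
  by rewrite -natrX ler_nat ltnW// ltn_expl.
pose V := fine (mu (ball x0 (r + e))).
have VE : mu (ball x0 (r + e)) = V%:E.
  by rewrite fineK// ge0_fin_numE// mball_lty.
have V0 : 0 < V by rewrite -lte_fin -VE mball_gt0// addr_gt0.
pose kappa := V / c ^+ k.
have kappa0 : 0 < kappa by rewrite divr_gt0// exprn_gt0.
have kappaP x : ball x0 r x -> (kappa%:E <= mu (ball x (e / 2)))%E.
  move=> xr; have := cP x (e / 2) k; rewrite divr_gt0// => /(_ isT) H.
  have : (V%:E <= (c ^+ k)%:E * mu (ball x (e / 2)))%E.
    rewrite (le_trans _ H)// -VE le_measure ?inE//; try exact: measurable_mball.
    move=> y; move: xr; rewrite !ballEmdist/= => xr yr; apply: lt_le_trans kP.
    rewrite (le_lt_trans (metric_triangle _ x0 _))// metric_sym.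
    lra.
  have -> : kappa%:E = ((c ^+ k)^-1%:E * V%:E)%E by rewrite -EFinM mulrC.
  by rewrite lee_pdivrMl// exprn_gt0.
apply: contrapT => nocover.
have build n : exists s : seq X, [/\ size s = n,
    pairwise (fun x y => e <= mdist x y) s & forall x, x \in s -> ball x0 r x].
  elim: n => [|n [s [sn ps sr]]]; first by exists [::].
  have [y [yr ys]] : exists y, ball x0 r y /\ ~ cover_by e s y.
    apply: contrapT => H; apply: nocover; exists s => y yr.
    by apply: contrapT => ys; apply: H; exists y.
  exists (y :: s); split => /=; first by rewrite sn.
  - rewrite ps andbT; apply/allP => x xs; rewrite leNgt; apply/negP => yx.
    by apply: ys; exists x => //; rewrite ballEmdist/= metric_sym.
  - by move=> x; rewrite inE => /predU1P[->//|]; exact: sr.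
have [s [sn ps sr]] := build (Num.truncn (V / kappa)).+1.
have := separated_measure ps (fun x xs => kappaP x (sr x xs)).
rewrite leNgt => /negP; apply.
apply: (@le_lt_trans _ _ V%:E).
  rewrite -VE le_measure ?inE//; last 2 first.
  - exact: measurable_mball.
  - move=> y [x xs]; have := sr x xs; rewrite !ballEmdist/= => xr yx.
    by rewrite (le_lt_trans (metric_triangle _ x _))//; lra.
  apply: measurable_open; rewrite openE => y [z zs zy].
  have := open_mball z (e / 2); rewrite openE => /(_ _ zy).
  by apply: filterS => w; exists z.
by rewrite lte_fin sn -ltr_pdivrMr// truncnS_gt.
Qed.

(** By total boundedness an ultrafilter on a ball contains arbitrarily small balls,
    hence is Cauchy. *)
Lemma closed_bounded_compact (x0 : X) (r : R) (K : set X) : closed K ->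
  K `<=` ball x0 r -> compact K.
Proof.
move=> cK Kr; rewrite compact_ultra => F FU FK.
have Fr : F (ball x0 r) by apply: filterS FK.
have [r0|r0] := ltP 0 r; last first.
  have [y] := filter_ex Fr.
  by rewrite ballEmdist/= => /lt_le_trans/(_ r0); rewrite ltNge mdist_ge0.
have Fcauchy : cauchy F.
  apply/cauchy_exP => e e0.
  have [s rs] := mball_finite_net x0 r0 e0.
  have : F (cover_by e s) by exact: filterS Fr.
  elim: s {rs} => [|x s IH] Fs.
    by have [y [z]] := filter_ex Fs; rewrite in_nil.
  have [Fx|FnB] := in_ultra_setVsetC (ball x e) FU; first by exists x.
  apply: IH; apply: filterS (filterI Fs FnB) => y [[z]].
  by rewrite inE => /predU1P[->|zs] zy nxy; [|exists z].
have /cvg_ex[p Fp] : cvg F by exact: cauchy_cvg.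
exists p; split => //.
exact: (@closed_cvg _ _ F _ id K cK FK p Fp).
Qed.

Section exhaustion.
Variables (A : set X) (oA : open A) (bA : metric_bounded A).

Lemma metric_bounded_mball : exists x0 r, A `<=` ball x0 r.
Proof.
have [M AM] := bA; have [[x0 Ax0]|A0] := pselect (A !=set0).
  exists x0, (M + 1) => x Ax; rewrite ballEmdist/=.
  by rewrite (le_lt_trans (AM _ _ Ax0 Ax))// ltrDl.
exists point, 1 => x Ax; exfalso; apply: A0; by exists x.
Qed.

Lemma metric_bounded_lty : (mu A < +oo)%E.
Proof.
have [x0 [r Ar]] := metric_bounded_mball.
apply: le_lt_trans (mball_lty x0 r); rewrite le_measure ?inE//.
- exact: measurable_open.
- exact: measurable_mball.
Qed.

(** An exhaustion of an open set by compact sets: the points at distance at least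
    [1 / (j + 1)] from the complement. *)
Definition inner_part (j : nat) : set X :=
  [set x | A x /\ ball x j.+1%:R^-1 `<=` A].

Lemma inner_part_sub j : inner_part j `<=` A.
Proof. by move=> x []. Qed.

Lemma inner_part_compact j : compact (inner_part j).
Proof.
have [x0 [r Ar]] := metric_bounded_mball.
apply: (@closed_bounded_compact x0 r); last by move=> x [/Ar].
have cE : inner_part j = [set x | ball x j.+1%:R^-1 `<=` A].
  apply/seteqP; split=> [x []//|x /= xA]; split => //; apply: xA.
  by apply: ballxx.
rewrite cE closedE => x; rewrite -[_ -> _]/(_ -> ball x _ `<=` A) => clx.
move=> y; rewrite ballEmdist/= => xy.
apply: contrapT => nAy; apply: clx; apply/nbhs_ballP.
exists (j.+1%:R^-1 - mdist x y); first by rewrite /= subr_gt0.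
move=> z; rewrite ballEmdist/= ltrBrDl => xz zA; apply: nAy; apply: zA.
rewrite ballEmdist/= (le_lt_trans (metric_triangle z x y))//.
by rewrite metric_sym addrC.
Qed.

Lemma compact_inner_part K : compact K -> K `<=` A ->
  exists j, K `<=` inner_part j.
Proof.
move=> /compact_near_coveringP cK KA.
have := cK nat \oo (fun j x => inner_part j x) _.
case=> [x Kx|N _ H]; last by exists N; exact: (H N (leqnn N)).
have := oA; rewrite openE => /(_ x (KA _ Kx)) /nbhs_ballP[e /= e0 eA].
have e20 : 0 < e / 2 by rewrite divr_gt0.
exists (ball x (e / 2), [set j | (Num.truncn (e / 2)^-1 <= j)%N]).
  by split; [exact: nbhsx_ballx|exists (Num.truncn (e / 2)^-1) => // j].
move=> [y j] [/= xy jN].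
have je : j.+1%:R^-1 <= e / 2.
  rewrite invf_ple ?posrE// (@le_trans _ _ (Num.truncn (e / 2)^-1).+1%:R)//.
    by rewrite ltW// truncnS_gt.
  by rewrite ler_nat.
have yA : ball y (e / 2) `<=` A.
  move=> z; move: xy; rewrite !ballEmdist/= => xy yz; apply: eA.
  rewrite ballEmdist/= (le_lt_trans (metric_triangle x y z))//.
  by rewrite [ltRHS]splitr ltrD.
split; first by apply: yA; exact: ballxx.
by move=> z yz; apply: yA; move: yz; rewrite !ballEmdist/= => /lt_le_trans; apply.
Qed.

End exhaustion.

Lemma doubling_sigma_finite : sigma_finite setT mu.
Proof.
exists (fun n => ball (point : X) n%:R).
  apply/seteqP; split=> // x _; exists (Num.truncn (mdist (point : X) x)).+1 => //.
  by rewrite ballEmdist/= truncnS_gt.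
by move=> n; split; [exact: measurable_mball|exact: mball_lty].
Qed.

End doubling_proper.

(** * Total variation *)

Section total_variation_theory.
Context {R : realType} {d : measure_display} {X : borelMetricType R d}.
Variable mu : {measure set X -> \bar R}.
Hypothesis mu_doubling : doubling mu.
Variables (A : set X) (oA : open A) (bA : metric_bounded A).
Local Open Scope ereal_scope.
Local Notation TV := (total_var mu A).

Let mA : measurable A. Proof. exact: measurable_open. Qed.

Lemma measurable_compact (K : set X) : compact K -> measurable K.
Proof.
move=> cK; rewrite -[K]setCK; apply/measurableC/measurable_open.
by apply: closed_openC; apply: compact_closed cK; exact: metric_hausdorff.
Qed.

Lemma lip_loc_measurable (w : X -> R) : lip_loc A w -> measurable_fun A w.
Proof.
move=> lw; apply: (measurability (@RGenOInfty.G R)).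
  exact: RGenOInfty.measurableE.
move=> _ [_ [r ->] <-]; apply: measurable_open.
rewrite openE => x [Ax /=]; rewrite in_itv/= andbT => rx.
have [U Ux [L lipL]] := lw x Ax; have Lp : (0 < `|L| + 1)%R by rewrite ltr_wpDl.
have [e0 e00 eA] : exists2 e : R, (0 < e)%R & ball x e `<=` A.
  by move: oA; rewrite openE => /(_ _ Ax)/nbhs_ballP[e /= e0 eA]; exists e.
have [e1 e10 eU] : exists2 e : R, (0 < e)%R & ball x e `<=` U.
  by move: Ux => /nbhs_ballP[e /= ? ?]; exists e.
pose e := Num.min (Num.min e0 e1) ((w x - r) / (`|L| + 1))%R.
apply/nbhs_ballP; exists e.
  by rewrite /= !lt_min e00 e10 divr_gt0// subr_gt0.
move=> y; rewrite ballEmdist/= !lt_min -andbA => /and3P[y0 y1 y2].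
have Ay : A y by apply: eA; rewrite ballEmdist.
split => //=; rewrite in_itv/= andbT.
have := lipL x y (conj Ax (nbhs_singleton Ux)) (conj Ay (eU y _)).
rewrite ballEmdist/= => /(_ y1) H.
move: y2; rewrite ltr_pdivlMr// => y2.
have := ler_norm (w x - w y).
have : (L * mdist x y <= mdist x y * (`|L| + 1))%R.
  by rewrite mulrC ler_wpM2l ?mdist_ge0// (le_trans (ler_norm _))// lerDl.
lra.
Qed.

Lemma ge0_subset_integral_pointwise (D E : set X) (f : X -> \bar R) :
  D `<=` E -> (forall x, E x -> 0 <= f x) ->
  \int[mu]_(x in D) f x <= \int[mu]_(x in E) f x.
Proof.
move=> DE f0; rewrite !(integral_mkcond _ f); apply: le_integral_pointwise => x _.
rewrite {1}/patch; case: ifPn => [/set_mem Dx|_]; last exact: erestrict_ge0.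
by rewrite patchE mem_set//; exact: DE.
Qed.

(** The total variation bound with a single approximation on a single compact set
    in place of a sequence, and with any weak upper gradient. In this form
    semicontinuity and sublinearity are immediate. *)
Definition approximable (u : X -> R) (c : R) :=
  forall (e : R) K, (0 < e)%R -> compact K -> K `<=` A ->
  exists w g, [/\ lip_loc A w, weak_upper_gradient mu A w g,
    \int[mu]_(x in K) `|w x - u x|%:E <= e%:E &
    \int[mu]_(x in A) g x <= (c + e)%:E].

Lemma limn_einf_ge (z : nat -> \bar R) a N :
  (forall n, (N <= n)%N -> a <= z n) -> a <= limn_einf z.
Proof.
move=> H; rewrite limn_einf_lim (cvg_lim _ (@cvg_einfs_sup _ _))//.
apply: (@le_trans _ _ (einfs z N)); last by apply: ereal_sup_ubound; exists N.
by apply: le_ereal_inf_tmp => _ [n /= Nn <-]; exact: H.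
Qed.

Lemma limn_einf_ltP (z : nat -> \bar R) a : limn_einf z < a ->
  forall N, exists2 n, (N <= n)%N & z n < a.
Proof.
move=> + N; apply: contraPP => H; apply/negP; rewrite -leNgt.
apply: (@limn_einf_ge _ _ N) => n Nn.
by rewrite leNgt; apply/negP => zn; apply: H; exists n.
Qed.

Lemma limn_einf_le (z : nat -> \bar R) a N :
  (forall n, (N <= n)%N -> z n <= a) -> limn_einf z <= a.
Proof.
move=> H; rewrite limn_einf_lim (cvg_lim _ (@cvg_einfs_sup _ _))//.
apply: ge_ereal_sup => _ [n _ <-].
apply: (@le_trans _ _ (z (maxn n N))); last by apply: H; rewrite leq_maxr.
by apply: ereal_inf_lbound; exists (maxn n N) => //=; rewrite leq_maxl.
Qed.

Lemma total_var_ge0 u : 0 <= TV u.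
Proof.
apply: le_ereal_inf_tmp => _ [ui [gi [_ _ gm ->]]].
apply: (@limn_einf_ge _ _ 0%N) => n _; apply: integral_ge0.
by have [[_ ? _] _] := gm n.
Qed.

Lemma total_var_approximable u c : TV u <= c%:E -> approximable u c.
Proof.
move=> uc e K e0 cK KA.
have : TV u < (c + e)%:E by rewrite (le_lt_trans uc)// lte_fin ltrDl.
move=> /ereal_inf_lt[_ [ui [gi [lui cvgu gm ->]]] /limn_einf_ltP H].
have /fine_cvgP[fin /cvgrPdist_le/(_ e e0) cv] := cvgu K cK KA.
have [N _ HN] := filterI fin cv.
have [n Nn gn] := H N; have [/= fn] := HN n Nn.
rewrite sub0r normrN ger0_norm ?fine_ge0 ?integral_ge0// => dn.
exists (ui n), (gi n); split => //.
- by have [] := gm n.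
- by rewrite -(fineK fn) lee_fin.
- exact: ltW.
Qed.

(** Apply the hypothesis to the compact exhaustion of [A] with errors tending to 0,
    and replace the weak upper gradients by minimal ones. *)
Lemma approximable_total_var u c : approximable u c -> TV u <= c%:E.
Proof.
move=> uc.
have ex n : exists wg : (X -> R) * (X -> \bar R), [/\ lip_loc A wg.1,
    minimal_weak_upper_gradient mu A wg.1 wg.2,
    \int[mu]_(x in inner_part A n) `|wg.1 x - u x|%:E <= (n.+1%:R^-1)%:E &
    \int[mu]_(x in A) wg.2 x <= (c + n.+1%:R^-1)%:E].
  have [] := uc (n.+1%:R^-1)%R (inner_part A n).
  - by rewrite invr_gt0.
  - exact: (inner_part_compact mu_doubling bA).
  - exact: inner_part_sub.
  move=> w [g [lw wg Kw Ag]].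
  have [g' g'm] := exists_minimal_weak_upper_gradient mu mA w.
  exists (w, g'); split => //=; apply: le_trans Ag.
  by apply: g'm.2.
move/choice : ex => [wg wgP].
apply: (@le_trans _ _ (limn_einf (fun n => \int[mu]_(x in A) (wg n).2 x))).
  apply: ereal_inf_lbound; exists (fun n => (wg n).1), (fun n => (wg n).2).
  split => //.
  - by move=> n; have [] := wgP n.
  - move=> K cK KA; have [j Kj] := compact_inner_part oA cK KA.
    have inv_cvg : (n.+1%:R^-1 : R)%:E @[n --> \oo] --> 0.
      by apply/fine_cvgP; split; [exact: nearW|exact: cvg_harmonic].
    apply: (@squeeze_cvge _ _ _ _ (cst 0) _ (fun n => (n.+1%:R^-1 : R)%:E)).
    + exists j => // n /= jn; apply/andP; split; first exact: integral_ge0.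
      have [_ _ + _] := wgP n; apply: le_trans.
      apply: ge0_subset_integral_pointwise => // x /Kj [Ax xj].
      split => // y yn; apply: xj; move: yn; rewrite !ballEmdist/=.
      move=> /lt_le_trans; apply; rewrite lef_pV2 ?posrE//.
      by rewrite ler_nat.
    + exact: cvg_cst.
    + exact: inv_cvg.
  - by move=> n; have [] := wgP n.
apply/lee_addgt0Pr => e e0.
have [n ne] : exists n, (n.+1%:R^-1 <= e)%R.
  exists (Num.truncn e^-1); rewrite invf_ple ?posrE//.
  by rewrite ltW// truncnS_gt.
apply: (@limn_einf_le _ _ n) => k nk; have [_ _ _ /le_trans] := wgP k; apply.
rewrite -EFinD lee_fin lerD2l (le_trans _ ne)// lef_pV2 ?posrE//.
by rewrite ler_nat.
Qed.

Lemma eq_ae_total_var u v : (\forall x \ae mu, A x -> u x = v x) -> TV u = TV v.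
Proof.
move=> uv; congr ereal_inf; apply/seteqP.
have sub f g : (\forall x \ae mu, A x -> f x = g x) ->
    forall ui, cvg_L1loc mu A ui f -> cvg_L1loc mu A ui g.
  move=> fg ui H K cK KA; have := H K cK KA.
  suff -> : (fun i => \int[mu]_(x in K) `|ui i x - f x|%:E) =
      (fun i => \int[mu]_(x in K) `|ui i x - g x|%:E) by [].
  apply/funext => i; apply: ge0_ae_eq_integral_pointwise => //.
  by apply: filterS fg => x fg Kx; rewrite fg//; exact: KA.
split=> z [ui [gi [? ? ? ?]]]; exists ui, gi; split => //.
  exact: (sub u v).
apply: (sub v u) => //; apply: filterS uv => x uv Ax; by rewrite uv.
Qed.

Lemma total_var_lsc (u : X -> R) (c : R) : measurable_fun A u ->
  (forall e : R, (0 < e)%R -> exists v : X -> R, [/\ measurable_fun A v,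
    \int[mu]_(x in A) `|v x - u x|%:E <= e%:E & TV v <= (c + e)%:E]) ->
  TV u <= c%:E.
Proof.
move=> mu' H; apply: approximable_total_var => e K e0 cK KA.
have e20 : (0 < e / 2)%R by rewrite divr_gt0.
have [v [mv vu vc]] := H _ e20.
have [w [g [lw wg Kw Ag]]] := total_var_approximable vc e20 cK KA.
have mK := measurable_compact cK.
have mw := lip_loc_measurable lw.
have mS (f : X -> R) : measurable_fun A f -> measurable_fun K f.
  by move=> mf; exact: measurable_funS mf.
exists w, g; split => //; last by rewrite -addrA -splitr in Ag.
apply: (@le_trans _ _ (\int[mu]_(x in K) (`|w x - v x|%:E + `|v x - u x|%:E))).
  apply: le_integral_pointwise => x _.
  by rewrite -EFinD lee_fin; exact: ler_distD.
rewrite ge0_integralD//; last 2 first.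
- by apply/measurable_EFinP/measurableT_comp => //; apply: measurable_funB; exact: mS.
- by apply/measurable_EFinP/measurableT_comp => //; apply: measurable_funB; exact: mS.
rewrite (splitr e) EFinD; apply: leeD => //; apply: le_trans vu.
exact: ge0_subset_integral_pointwise.
Qed.

Lemma lip_loc_lincomb (a b : R) (f g : X -> R) : lip_loc A f -> lip_loc A g ->
  lip_loc A (fun x => a * f x + b * g x)%R.
Proof.
move=> lf lg x Ax; have [U Ux [L HL]] := lf x Ax; have [V Vx [M HM]] := lg x Ax.
exists (U `&` V); first exact: filterI.
exists (`|a| * L + `|b| * M)%R => y z [Ay [Uy Vy]] [Az [Uz Vz]].
rewrite opprD addrACA -!mulrBr (le_trans (ler_normD _ _))// !normrM mulrDl.
by rewrite -!mulrA lerD// ler_wpM2l//; [exact: HL|exact: HM].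
Qed.

Lemma weak_upper_gradient_lincomb (a b : R) (u v : X -> R) g h : (0 <= a)%R -> (0 <= b)%R ->
  weak_upper_gradient mu A u g -> weak_upper_gradient mu A v h ->
  weak_upper_gradient mu A (fun x => a * u x + b * v x)%R
    (fun x => a%:E * g x + b%:E * h x).
Proof.
move=> a0 b0 ug vh.
have [mg g0 _] := ug; have [mh h0 _] := vh.
have [r [mr r0 ri] rP] := weak_upper_gradient_density ug.
have [s [ms s0 si] sP] := weak_upper_gradient_density vh.
apply: (@density_weak_upper_gradient _ _ _ mu _ _ _ (fun x => r x + s x)).
- by apply: emeasurable_funD; exact: measurable_funeM.
- by move=> x Ax; rewrite adde_ge0// mule_ge0 ?g0 ?h0.
- split; [exact: emeasurable_funD|by move=> x; rewrite adde_ge0|].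
  by rewrite ge0_integralD// lte_add_pinfty.
move=> gamma gR gA rs.
have rfin : line_integral r gamma < +oo.
  by apply: le_lt_trans rs; apply: le_integral_pointwise => t _; rewrite leeDl.
have sfin : line_integral s gamma < +oo.
  by apply: le_lt_trans rs; apply: le_integral_pointwise => t _; rewrite leeDr.
have arcA t : `[0%R, fine (curve_length gamma 0 1)]%classic t ->
    A (arc_length_param gamma t).
  by rewrite /= in_itv/= => /andP[t0 t1]; exact: arc_length_param_in.
have mga := measurable_along gR mA mg gA.
have mha := measurable_along gR mA mh gA.
rewrite /upper_gradient_along /line_integral ge0_integralD//=.
- rewrite !ge0_integralZl//=.
  + apply: (@le_trans _ _ (a%:E * `|u (gamma 0%R) - u (gamma 1%R)|%:E +
      b%:E * `|v (gamma 0%R) - v (gamma 1%R)|%:E)).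
      rewrite -!EFinM -EFinD lee_fin opprD addrACA -!mulrBr.
      by rewrite (le_trans (ler_normD _ _))// !normrM (ger0_norm a0) (ger0_norm b0).
    by apply: leeD; apply: lee_wpmul2l; rewrite ?lee_fin//; [exact: rP|exact: sP].
  + by move=> t /arcA; exact: h0.
  + by move=> t /arcA; exact: g0.
- by move=> t /arcA At; rewrite mule_ge0// g0.
- exact: measurable_funeM.
- by move=> t /arcA At; rewrite mule_ge0// h0.
- exact: measurable_funeM.
Qed.

Lemma total_var_lincomb (a b c c' : R) (u v : X -> R) : (0 <= a)%R -> (0 <= b)%R ->
  measurable_fun A u -> measurable_fun A v ->
  TV u <= c%:E -> TV v <= c'%:E ->
  TV (fun x => a * u x + b * v x)%R <= (a * c + b * c')%:E.
Proof.
move=> a0 b0 mu' mv uc vc; apply: approximable_total_var => e K e0 cK KA.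
pose e' := (e / (1 + a + b))%R.
have ab0 : (0 < 1 + a + b)%R by lra.
have e'0 : (0 < e')%R by rewrite divr_gt0.
have ee : (a * e' + b * e' <= e)%R.
  by rewrite -mulrDl /e' mulrCA ler_piMr ?(ltW e0)// ler_pdivrMr// mul1r; lra.
have [w [g [lw wg Kw Ag]]] := total_var_approximable uc e'0 cK KA.
have [w' [g' [lw' wg' Kw' Ag']]] := total_var_approximable vc e'0 cK KA.
have mK := measurable_compact cK.
have mw := lip_loc_measurable lw.
have mw' := lip_loc_measurable lw'.
have mS (f : X -> R) : measurable_fun A f -> measurable_fun K f.
  by move=> mf; exact: measurable_funS mf.
exists (fun x => a * w x + b * w' x)%R, (fun x => a%:E * g x + b%:E * g' x).
split.
- exact: lip_loc_lincomb.
- exact: weak_upper_gradient_lincomb.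
- apply: (@le_trans _ _ (\int[mu]_(x in K) (a%:E * `|w x - u x|%:E +
      b%:E * `|w' x - v x|%:E))).
    apply: le_integral_pointwise => x _.
    rewrite -!EFinM -EFinD lee_fin opprD addrACA -!mulrBr.
    by rewrite (le_trans (ler_normD _ _))// !normrM (ger0_norm a0) (ger0_norm b0).
  have mwu : measurable_fun K (fun x => `|w x - u x|%:E).
    by apply/measurable_EFinP/measurableT_comp => //; apply: measurable_funB; exact: mS.
  have mwu' : measurable_fun K (fun x => `|w' x - v x|%:E).
    by apply/measurable_EFinP/measurableT_comp => //; apply: measurable_funB; exact: mS.
  rewrite ge0_integralD//=.
  + rewrite !ge0_integralZl//.
    apply: (@le_trans _ _ (a%:E * e'%:E + b%:E * e'%:E)).
      by apply: leeD; apply: lee_wpmul2l; rewrite ?lee_fin.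
    by rewrite -!EFinM -EFinD lee_fin.
  + by move=> x _; rewrite mule_ge0.
  + exact: measurable_funeM.
  + by move=> x _; rewrite mule_ge0.
  + exact: measurable_funeM.
- have [mg g0 _] := wg; have [mg' g'0 _] := wg'.
  rewrite ge0_integralD//=.
  + rewrite !ge0_integralZl//.
    apply: (@le_trans _ _ (a%:E * (c + e')%:E + b%:E * (c' + e')%:E)).
      by apply: leeD; apply: lee_wpmul2l; rewrite ?lee_fin.
    by rewrite -!EFinM -EFinD lee_fin !mulrDr addrACA lerD2l.
  + by move=> x Ax; rewrite mule_ge0// g0.
  + exact: measurable_funeM.
  + by move=> x Ax; rewrite mule_ge0// g'0.
  + exact: measurable_funeM.
Qed.

End total_variation_theory.

(** * Integrals over an interval *)

Section real_integrals.
Context {R : realType}.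
Local Notation leb := (@lebesgue_measure R).
Implicit Types (p q f : R -> R) (s t a b c : R).

Lemma integrable_subitv f a b s t : leb.-integrable `[a, b] (EFin \o f) ->
  a <= s -> t <= b -> leb.-integrable `[s, t] (EFin \o f).
Proof.
move=> i as_ tb; apply: integrableS i => // r /=; rewrite !in_itv/=.
by move=> /andP[sr rt]; rewrite (le_trans as_)// (le_trans rt).
Qed.

Lemma Rintegral_itv_split f a b c : leb.-integrable `[a, b] (EFin \o f) ->
  a <= c -> c <= b -> \int[leb]_(r in `[a, b]) f r =
  \int[leb]_(r in `[a, c]) f r + \int[leb]_(r in `[c, b]) f r.
Proof.
move=> i ac cb; apply/eqP; rewrite addrC -subr_eq; apply/eqP.
rewrite Rintegral_itvB ?bnd_simp// Rintegral_itv_obnd_cbnd//.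
apply: integrableS i => // r /=; rewrite !in_itv/= => /andP[+ ->].
by rewrite andbT => /ltW; exact: le_trans.
Qed.

Lemma bounded_mul_integrable (k : R -> R) f a b (M : R) :
  measurable_fun `[a, b] k -> (forall r, a <= r <= b -> `|k r| <= M) ->
  leb.-integrable `[a, b] (EFin \o f) ->
  leb.-integrable `[a, b] (fun r => (k r * f r)%:E).
Proof.
move=> mk kM i; apply: (@integrableMr _ _ _ leb _ (measurable_itvR _) k _ mk _ i).
exists M; split; first exact: num_real.
by move=> N MN r /=; rewrite in_itv/= => /kM /le_trans; apply; exact: ltW.
Qed.

Lemma integrable_ext (a b : R) f g : (forall r, f r = g r) ->
  leb.-integrable `[a, b] (EFin \o f) -> leb.-integrable `[a, b] (EFin \o g).
Proof. by move=> /funext ->. Qed.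

Lemma integrable_scale (a b k : R) f : leb.-integrable `[a, b] (EFin \o f) ->
  leb.-integrable `[a, b] (fun r => (k * f r)%:E).
Proof. exact: (integrableZl (measurable_itvR _) k). Qed.

Lemma integrable_scaler (a b k : R) f : leb.-integrable `[a, b] (EFin \o f) ->
  leb.-integrable `[a, b] (fun r => (f r * k)%:E).
Proof.
move=> /(integrable_scale k); apply: integrable_ext => r; exact: mulrC.
Qed.

Lemma integrable_add (a b : R) f g : leb.-integrable `[a, b] (EFin \o f) ->
  leb.-integrable `[a, b] (EFin \o g) ->
  leb.-integrable `[a, b] (fun r => (f r + g r)%:E).
Proof. exact: (integrableD (measurable_itvR _)). Qed.

Lemma integrable_sub (a b : R) f g : leb.-integrable `[a, b] (EFin \o f) ->
  leb.-integrable `[a, b] (EFin \o g) ->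
  leb.-integrable `[a, b] (fun r => (f r - g r)%:E).
Proof. exact: (integrableB (measurable_itvR _)). Qed.

Lemma continuous_integrable f a b : continuous f ->
  leb.-integrable `[a, b] (EFin \o f).
Proof.
move=> cf; apply: continuous_compact_integrable; first exact: segment_compact.
exact: continuous_subspaceT.
Qed.

Lemma continuous_measurable f (D : set R) : measurable D -> continuous f ->
  measurable_fun D f.
Proof.
by move=> mD cf; apply: measurable_funS (continuous_measurable_fun cf).
Qed.

Lemma eq_Rintegral_open f g s t : measurable_fun `]s, t[ f ->
  measurable_fun `]s, t[ g -> {in `]s, t[, f =1 g} ->
  \int[leb]_(r in `[s, t]) f r = \int[leb]_(r in `[s, t]) g r.
Proof. by move=> mf mg fg; congr fine; exact: eq_integral_itv_bounded. Qed.

Lemma Rintegral_itv11 f s : \int[leb]_(r in `[s, s]) f r = 0.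
Proof. by rewrite set_itv1 Rintegral_set1. Qed.

Lemma Rintegral_exp (gam del : R) s t : s <= t ->
  \int[leb]_(r in `[s, t]) (gam * expR (del + gam * r)) =
  expR (del + gam * t) - expR (del + gam * s).
Proof.
rewrite le_eqVlt => /predU1P[<-|st]; first by rewrite Rintegral_itv11 subrr.
have daff (x : R) : is_derive x 1 (fun r : R => del + gam * r) gam.
  rewrite (_ : (fun r => _) = cst del + gam *: id); last by apply/funext => r.
  have := is_deriveD (is_derive_cst del x 1) (is_deriveZ gam (is_derive_id x 1)).
  by rewrite add0r /GRing.scale/= mulr1.
have der (x : R) : is_derive x 1 (expR \o (fun r => del + gam * r))
    (expR (del + gam * x) * gam).
  exact: is_derive1_comp.
have cont : continuous (expR \o (fun r => del + gam * r)).
  by move=> x; apply/differentiable_continuous/derivable1_diffP; apply: ex_derive.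
rewrite /Rintegral (@continuous_FTC2 _ _ (expR \o (fun r => del + gam * r)))//.
- apply: continuous_subspaceT => x.
  by apply: cvgM; [exact: cvg_cst|exact: cont].
- split.
  + by move=> x _; apply: ex_derive.
  + exact/cvg_at_right_filter/cont.
  + exact/cvg_at_left_filter/cont.
- by move=> x _; rewrite derive1E derive_val mulrC.
Qed.

(** Additivity, for an integrand given by different formulas before [b1], between
    [b1] and [b2], and after [b2]. *)
Lemma Rintegral_glue (P p : R -> R) (b1 b2 s t : R) :
  leb.-integrable `[s, t] (EFin \o p) -> s <= t -> b1 <= b2 ->
  (forall x y, s <= x -> x <= y -> y <= t ->
    [\/ y <= b1, b1 <= x /\ y <= b2 | b2 <= x] ->
    \int[leb]_(r in `[x, y]) p r = P y - P x) ->
  \int[leb]_(r in `[s, t]) p r = P t - P s.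
Proof.
move=> ip st b12 H.
pose m1 := Num.max s (Num.min t b1); pose m2 := Num.max s (Num.min t b2).
have s1 : s <= m1 by rewrite le_max lexx.
have m12 : m1 <= m2.
  rewrite ge_max /m2 !le_max lexx/=; apply/orP; right.
  by rewrite le_min !ge_min lexx b12 orbT.
have m2t : m2 <= t by rewrite ge_max st ge_min lexx.
rewrite (Rintegral_itv_split ip s1 (le_trans m12 m2t)).
rewrite (Rintegral_itv_split (integrable_subitv ip s1 (lexx t)) m12 m2t).
have piece x y : s <= x -> x <= y -> y <= t ->
    (x < y -> [\/ y <= b1, b1 <= x /\ y <= b2 | b2 <= x]) ->
    \int[leb]_(r in `[x, y]) p r = P y - P x.
  move=> sx; rewrite le_eqVlt => /predU1P[<- _ _|xy yt /(_ xy)].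
    by rewrite Rintegral_itv11 subrr.
  by apply: H => //; exact: ltW.
rewrite !piece//; first lra.
- by rewrite (le_trans s1).
- move=> m2t'; apply: Or33; move: m2t'; rewrite /m2.
  by case: (leP t b2) => ?; case: (leP s t) => ?; case: (leP s b2) => ? ?; lra.
- move=> m12'; apply: Or32; split.
    have : Num.min t b1 <= m1 by rewrite le_max lexx orbT.
    rewrite ge_min => /orP[tm|//].
    by move: m12'; rewrite ltNge (le_trans m2t tm).
  move: m12'; rewrite {1}/m2 lt_max ltNge s1/= => m1b.
  by rewrite ge_max ge_min lexx orbT andbT (le_trans s1)// (le_trans (ltW m1b))// ge_min lexx orbT.
- exact: le_trans m2t.
- rewrite {1}/m1 lt_max ltxx/= => sb; apply: Or31.
  by rewrite ge_max ge_min lexx orbT andbT (le_trans (ltW sb))// ge_min lexx orbT.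
Qed.

End real_integrals.

(** * A step rate and its exponential *)

Section relaxation_rate.
Context {R : realType}.
Local Notation leb := (@lebesgue_measure R).
Variables (h eps t1 t2 : R).
Hypotheses (h0 : 0 < h) (eps0 : 0 < eps) (t10 : 0 <= t1) (t12 : t1 <= t2).

(** The comparison map follows the solution at rate [1 / h] before [t1], rests
    on [t1, t2[ and follows it at rate [1 / eps] afterwards. The rest is what
    produces the integral over [t1, t2] in the estimate. *)
Definition rate (s : R) : R :=
  h^-1 * \1_(`]-oo, t1[) s + eps^-1 * \1_(`[t2, +oo[) s.

(** A primitive of [rate]. *)
Definition cumulated_rate (s : R) : R :=
  Num.min s t1 / h + Num.max 0 (s - t2) / eps.
Local Notation Al := cumulated_rate.

Lemma measurable_rate (D : set R) : measurable D -> measurable_fun D rate.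
Proof.
move=> mD; apply: (@measurable_funS _ _ _ _ setT) => //.
apply: measurable_funD; apply: measurable_funM => //; exact: measurable_indic.
Qed.

Lemma rate_before s : s < t1 -> rate s = h^-1.
Proof.
move=> st; rewrite /rate !indicE mem_set/= ?in_itv//=.
by rewrite memNset ?mulr1 ?mulr0 ?addr0//= in_itv/= andbT; apply/negP; rewrite -ltNge (lt_le_trans st).
Qed.

Lemma rate_between s : t1 <= s -> s < t2 -> rate s = 0.
Proof.
move=> ts st; rewrite /rate !indicE memNset/= ?in_itv/=; last by apply/negP; rewrite -leNgt.
by rewrite memNset ?mulr0 ?addr0//= in_itv/= andbT; apply/negP; rewrite -ltNge.
Qed.

Lemma rate_after s : t2 <= s -> rate s = eps^-1.
Proof.
move=> ts; rewrite /rate !indicE memNset/= ?in_itv/=; last first.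
  by apply/negP; rewrite -leNgt (le_trans t12).
by rewrite mem_set ?mulr0 ?add0r ?mulr1//= in_itv/= andbT.
Qed.

Lemma rate_ge0 s : 0 <= rate s.
Proof.
by rewrite addr_ge0// mulr_ge0// ?invr_ge0 ?ltW// indicE ler0n.
Qed.

Definition rate_bound : R := h^-1 + eps^-1.

Lemma rate_le s : rate s <= rate_bound.
Proof.
by apply: lerD; rewrite ler_piMr ?invr_ge0 ?(ltW h0) ?(ltW eps0)// indicE lern1 leq_b1.
Qed.

Lemma normr_rate_le s : `|rate s| <= rate_bound.
Proof. by rewrite ger0_norm ?rate_le// rate_ge0. Qed.

Lemma cumulated_rate_continuous : continuous Al.
Proof.
move=> x; apply: cvgD; apply: cvgMl.
  by apply: continuous_min; [exact: cvg_id|exact: cvg_cst].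
apply: (@continuous_max _ _ (cst 0) (fun s => s - t2)); first exact: cvg_cst.
by apply: cvgB; [exact: cvg_id|exact: cvg_cst].
Qed.

Lemma exp_cumulated_rate_continuous (k : R) :
  continuous (fun s => expR (k * Al s)).
Proof.
move=> x; apply: continuous_comp; last exact: continuous_expR.
by apply: cvgMr; exact: cumulated_rate_continuous.
Qed.

Lemma cumulated_rate0 : Al 0 = 0.
Proof.
rewrite /cumulated_rate (min_idPl t10) mul0r add0r sub0r.
by rewrite (max_idPl _) ?mul0r// oppr_le0 (le_trans t10).
Qed.

Lemma cumulated_rate_nd x y : x <= y -> Al x <= Al y.
Proof.
move=> xy; apply: lerD; rewrite ler_pM2r ?invr_gt0//.
  by rewrite le_min !ge_min xy lexx !orbT.
by rewrite ge_max !le_max lexx/= lerD2r xy orbT.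
Qed.

Lemma cumulated_rate_ge0 x : 0 <= x -> 0 <= Al x.
Proof. by move=> x0; rewrite -cumulated_rate0; exact: cumulated_rate_nd. Qed.

Let Al1 s : s <= t1 -> Al s = s / h.
Proof.
move=> st; rewrite /cumulated_rate (min_idPl st) (max_idPl _) ?mul0r ?addr0//.
by rewrite subr_le0 (le_trans st).
Qed.

Let Al2 s : t1 <= s -> s <= t2 -> Al s = t1 / h.
Proof.
move=> ts st; rewrite /cumulated_rate (min_idPr ts) (max_idPl _) ?mul0r ?addr0//.
by rewrite subr_le0.
Qed.

Let Al3 s : t2 <= s -> Al s = t1 / h + (s - t2) / eps.
Proof.
move=> ts; rewrite /cumulated_rate (min_idPr (le_trans t12 ts)) (max_idPr _)//.
by rewrite subr_ge0.
Qed.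

Lemma measurable_exp_cumulated_rate (k : R) (D : set R) : measurable D ->
  measurable_fun D (fun s => expR (k * Al s)).
Proof.
by move=> mD; apply: continuous_measurable => //; exact: exp_cumulated_rate_continuous.
Qed.

Lemma integrable_rate_exp (k : R) s t :
  leb.-integrable `[s, t] (fun r => (rate r * expR (k * Al r))%:E).
Proof.
apply: (@bounded_mul_integrable _ _ _ _ _ rate_bound).
- by apply: measurable_rate; exact: measurable_itv.
- by move=> r _; exact: normr_rate_le.
- exact/continuous_integrable/exp_cumulated_rate_continuous.
Qed.

Lemma Rintegral_rate_exp (k : R) s t : s <= t ->
  \int[leb]_(r in `[s, t]) (rate r * expR (k * Al r)) * k =
  expR (k * Al t) - expR (k * Al s).
Proof.
move=> st.
have ik x y : leb.-integrable `[x, y] (fun r => (rate r * expR (k * Al r) * k)%:E).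
  have := integrableZr (measurable_itvR `[x, y]) k (integrable_rate_exp k x y).
  by [].
rewrite -RintegralZr//; last exact: integrable_rate_exp.
apply: (Rintegral_glue (P := fun r => expR (k * Al r)) (ik s t) st t12) => x y sx xy yt.
have mr : measurable_fun `]x, y[ (fun r => rate r * expR (k * Al r) * k).
  apply: measurable_funM => //; apply: measurable_funM.
    by apply: measurable_rate; exact: measurable_itv.
  by apply: measurable_exp_cumulated_rate; exact: measurable_itv.
have piece (del gam : R) : (forall r, x <= r -> r <= y -> Al r = del + gam * r) ->
    (forall r, x < r -> r < y -> rate r = gam) ->
    \int[leb]_(r in `[x, y]) (rate r * expR (k * Al r) * k) =
    expR (k * Al y) - expR (k * Al x).
  move=> H1 H2; rewrite (H1 _ xy (lexx _)) (H1 _ (lexx _) xy) !mulrDr !mulrA.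
  rewrite -Rintegral_exp//; apply: eq_Rintegral_open => //.
    apply: continuous_measurable; first exact: measurable_itv.
    move=> z; apply: cvgMr; apply: continuous_comp; last exact: continuous_expR.
    by apply: cvgD; [exact: cvg_cst|apply: cvgMr; exact: cvg_id].
  move=> r; rewrite in_itv/= => /andP[xr ry].
  by rewrite H2// H1 ?ltW// mulrDr !mulrA; ring.
case=> [yt1|[xt1 yt2]|xt2].
- apply: (piece 0 h^-1) => r xr ry; first by rewrite add0r Al1 1?mulrC// (le_trans ry).
  by rewrite rate_before// (lt_le_trans ry).
- apply: (piece (t1 / h) 0) => r xr ry.
    by rewrite mul0r addr0 Al2// ?(le_trans xt1)// (le_trans ry).
  by rewrite rate_between ?(lt_le_trans ry)// (le_trans xt1)// ltW.
- apply: (piece (t1 / h - t2 / eps) eps^-1) => r xr ry.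
    by rewrite Al3 ?(le_trans xt2)//; ring.
  by rewrite rate_after// (le_trans xt2)// ltW.
Qed.

Lemma Rintegral_rate_expN s t : s <= t ->
  \int[leb]_(r in `[s, t]) (rate r * expR (- Al r)) =
  expR (- Al s) - expR (- Al t).
Proof.
move=> st; have := Rintegral_rate_exp (-1) st; rewrite !mulN1r mulrN1.
under eq_Rintegral do rewrite mulN1r.
by move=> H; rewrite -[LHS]opprK H opprB.
Qed.

Lemma Rintegral_rate_expP s t : s <= t ->
  \int[leb]_(r in `[s, t]) (rate r * expR (Al r)) = expR (Al t) - expR (Al s).
Proof.
move=> st; have := Rintegral_rate_exp 1 st; rewrite !mul1r mulr1.
by under eq_Rintegral do rewrite mul1r.
Qed.

Lemma integrable_expN s t : leb.-integrable `[s, t] (fun r => (expR (- Al r))%:E).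
Proof.
have := continuous_integrable s t (@exp_cumulated_rate_continuous (-1)).
by apply: eq_integrable => //= r _; rewrite /= mulN1r.
Qed.

Lemma measurable_expN (D : set R) : measurable D ->
  measurable_fun D (fun r => expR (- Al r)).
Proof.
move=> mD; rewrite (_ : (fun r => _) = (fun r => expR (-1 * Al r))).
  exact: measurable_exp_cumulated_rate.
by apply/funext => r; rewrite mulN1r.
Qed.

Lemma measurable_expP (D : set R) : measurable D ->
  measurable_fun D (fun r => expR (Al r)).
Proof.
move=> mD; rewrite (_ : (fun r => _) = (fun r => expR (1 * Al r))).
  exact: measurable_exp_cumulated_rate.
by apply/funext => r; rewrite mul1r.
Qed.

Let tail b gam x y : 0 < gam -> x <= y ->
  (forall r, x < r -> r < y -> rate r = gam) -> gam = b^-1 ->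
  \int[leb]_(r in `[x, y]) expR (- Al r) = b * (expR (- Al x) - expR (- Al y)).
Proof.
move=> gam0 xy H gb; rewrite -Rintegral_rate_expN// -RintegralZl//; last first.
  have := integrable_rate_exp (-1) x y.
  by apply: eq_integrable => //= r _; rewrite /= mulN1r.
apply: eq_Rintegral_open.
- by apply: measurable_expN; exact: measurable_itv.
- have mm : measurable_fun `]x, y[ (fun r => expR (- Al r)).
    by apply: measurable_expN; exact: measurable_itv.
  by apply: measurable_funM => //; apply: measurable_funM => //; apply: measurable_rate; exact: measurable_itv.
- move=> r; rewrite in_itv/= => /andP[xr ry].
  by rewrite H// mulrA gb mulfV ?mul1r// -invr_eq0 -gb gt_eqF.
Qed.

Lemma Rintegral_expN_tail_before s S : s <= t1 -> t2 <= S -> h = t2 - t1 + eps ->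
  \int[leb]_(r in `[s, S]) expR (- Al r) <= h * expR (- Al s).
Proof.
move=> st tS hE.
have t1S := le_trans t12 tS.
rewrite (Rintegral_itv_split (integrable_expN s S) st)//.
rewrite (Rintegral_itv_split (integrable_expN t1 S) t12 tS).
rewrite (@tail h h^-1 s t1)//; last 2 first.
- by rewrite invr_gt0.
- by move=> r sr rt; exact: rate_before.
rewrite (@tail eps eps^-1 t2 S)//; last 2 first.
- by rewrite invr_gt0.
- by move=> r sr rt; apply: rate_after; exact: ltW.
rewrite (_ : \int[leb]_(r in `[t1, t2]) _ = expR (- Al t1) * (t2 - t1)); last first.
  under eq_Rintegral.
    move=> r; rewrite inE/= in_itv/= => /andP[tr rt].
    rewrite Al2// -(Al2 (lexx t1) t12); over.
  rewrite Rintegral_cst; last exact: measurable_itvR.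
  have := @lebesgue_measure_itv R `[t1, t2]; rewrite /= lte_fin => ->.
  by case: ltgtP t12 => //= ->; rewrite subrr.
have -> : Al t2 = Al t1 by rewrite !Al2.
have := expR_gt0 (- Al S); rewrite -(ltr_pM2l eps0) mulr0.
move: (expR (- Al s)) (expR (- Al t1)) (expR (- Al S)) => es e1 eS.
by rewrite hE; lra.
Qed.

Lemma Rintegral_expN_tail_after s S : t2 <= s -> s <= S ->
  \int[leb]_(r in `[s, S]) expR (- Al r) <= eps * expR (- Al s).
Proof.
move=> ts sS; rewrite (@tail eps eps^-1)//; last 2 first.
- by rewrite invr_gt0.
- by move=> r sr rt; apply: rate_after; rewrite (le_trans ts)// ltW.
by rewrite ler_pM2l// lerBlDr lerDl expR_ge0.
Qed.

(** The left-hand side is the total weight that the value at time [s] receives in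
    the time integral of a relaxation. It vanishes on [t1, t2[; after [t2] the
    integral of the decaying exponential is at most [eps]; before [t1] it is at most
    [h], as [h = t2 - t1 + eps] accounts for the rest of duration [t2 - t1] during
    which nothing decays. *)
Lemma rate_tail_le s S : s <= S -> t2 <= S -> h = t2 - t1 + eps ->
  rate s * expR (Al s) * \int[leb]_(r in `[s, S]) expR (- Al r) <=
  1 - \1_(`[t1, t2[) s.
Proof.
move=> sS tS hE; have ee : expR (Al s) * expR (- Al s) = 1.
  by rewrite -expRD subrr expR0.
have [st|ts] := ltP s t1.
  rewrite rate_before// indicE memNset ?subr0/=; last by rewrite in_itv/= leNgt st.
  apply: (@le_trans _ _ (h^-1 * expR (Al s) * (h * expR (- Al s)))).
    by rewrite ler_wpM2l ?mulr_ge0 ?expR_ge0 ?invr_ge0 ?(ltW h0)//; exact: Rintegral_expN_tail_before (ltW st) tS hE.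
  by rewrite mulrACA ee mulVf ?mulr1// gt_eqF.
have [st|ts2] := ltP s t2.
  by rewrite rate_between// !mul0r indicE mem_set ?subrr//= in_itv/= ts.
rewrite rate_after// indicE memNset ?subr0/=; last by rewrite in_itv/= => /andP[_]; rewrite ltNge ts2.
apply: (@le_trans _ _ (eps^-1 * expR (Al s) * (eps * expR (- Al s)))).
  by rewrite ler_wpM2l ?mulr_ge0 ?expR_ge0 ?invr_ge0 ?(ltW eps0)//; exact: Rintegral_expN_tail_after.
by rewrite mulrACA ee mulVf ?mulr1// gt_eqF.
Qed.

End relaxation_rate.

(** * Fubini on a triangle *)

Section triangle_fubini.
Context {R : realType}.
Local Notation leb := (@lebesgue_measure R).
Variables (p q : R -> R) (t : R).
Hypotheses (ip : leb.-integrable `[0, t] (EFin \o p))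
  (iq : leb.-integrable `[0, t] (EFin \o q)).

Let P := p \_ `[0, t].
Let Q := q \_ `[0, t].
Let F (z : R * R) := if z.2 <= z.1 then P z.1 * Q z.2 else 0.

Let mrestr f : leb.-integrable `[0, t] (EFin \o f) ->
  measurable_fun [set: R] (f \_ `[0, t]).
Proof.
move=> i; apply/(measurable_restrictT _ _).1; first exact: measurable_itv.
by apply/measurable_EFinP; exact: measurable_int i.
Qed.

Let mF : measurable_fun [set: R * R] F.
Proof.
apply: measurable_fun_ifT; first exact: measurable_fun_ler.
- apply: measurable_funM.
    by apply: measurableT_comp => //; exact: mrestr.
  by apply: measurableT_comp => //; exact: mrestr.
- exact: measurable_cst.
Qed.

Let iF : (leb \x leb)%E.-integrable setT (EFin \o F).
Proof.
apply/integrable12ltyP; first exact/measurable_EFinP.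
have fin f : leb.-integrable `[0, t] (EFin \o f) ->
    (\int[leb]_x `|(f \_ `[0, t]) x|%:E < +oo)%E.
  move=> /integrableP[_]; rewrite integral_mkcond.
  rewrite (_ : (fun x => _) = (fun x => `|(f \_ `[0, t]) x|%:E))//.
  apply/funext => x; rewrite /patch; case: ifPn => //= _.
  by rewrite normr0.
apply: (@le_lt_trans _ _ (\int[leb]_x (`|P x|%:E * \int[leb]_y `|Q y|%:E))%E).
  apply: le_integral_pointwise => x _.
  rewrite -ge0_integralZl//; last first.
    by apply/measurable_EFinP/measurableT_comp => //; exact: mrestr.
  apply: le_integral_pointwise => y _ /=; rewrite /F/= -EFinM lee_fin.
  by case: ifPn => _; rewrite ?normr0 ?mulr_ge0// normrM.
rewrite ge0_integralZr//; last 2 first.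
- by apply/measurable_EFinP/measurableT_comp => //; exact: mrestr.
- exact: integral_ge0.
by rewrite lte_mul_pinfty ?integral_ge0// ?ge0_fin_numE ?integral_ge0//; exact: fin.
Qed.

Let EFin_RintegralZl f k x y : leb.-integrable `[x, y] (EFin \o f) ->
  (\int[leb]_(r in `[x, y]) (k * f r)%:E)%E = (k * \int[leb]_(r in `[x, y]) f r)%:E.
Proof.
move=> i; rewrite -RintegralZl// /Rintegral fineK//.
apply: integrable_fin_num; first exact: measurable_itvR.
exact: (integrableZl (measurable_itvR _) k i).
Qed.

Let inner1 r : (\int[leb]_s (F (r, s))%:E)%E =
  (((fun r => p r * \int[leb]_(s in `[0, r]) q s) \_ `[0, t]) r)%:E.
Proof.
rewrite [in RHS]patchE; case: ifPn => [/set_mem/=|rt]; last first.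
  apply: integral0_eq => s _.
  by rewrite /F/= /P patchE (negbTE rt) mul0r; case: ifPn.
rewrite in_itv/= => /andP[r0 rt].
rewrite -EFin_RintegralZl; last exact: integrable_subitv iq _ _.
rewrite [RHS]integral_mkcond; apply: eq_integral => s _.
rewrite /F/= /P /Q !patchE (_ : r \in _ = true); last first.
  by apply/mem_set; rewrite /= in_itv/= r0.
have [sr|rs] := leP s r; last first.
  by rewrite memNset//= in_itv/= => /andP[_]; rewrite leNgt rs.
have [s0|s0] := leP 0 s.
  rewrite !mem_set//= in_itv/= s0//.
  exact: le_trans rt.
rewrite !memNset ?mulr0//= in_itv/= => /andP[]; by rewrite leNgt s0.
Qed.

Let inner2 s : (\int[leb]_r (F (r, s))%:E)%E =
  (((fun s => q s * \int[leb]_(r in `[s, t]) p r) \_ `[0, t]) s)%:E.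
Proof.
rewrite [in RHS]patchE; case: ifPn => [/set_mem/=|st]; last first.
  apply: integral0_eq => r _.
  by rewrite /F/= /Q patchE (negbTE st) mulr0; case: ifPn.
rewrite in_itv/= => /andP[s0 st].
rewrite -EFin_RintegralZl; last exact: integrable_subitv ip _ _.
rewrite [RHS]integral_mkcond; apply: eq_integral => r _.
rewrite /F/= /P /Q !patchE (_ : s \in _ = true); last first.
  by apply/mem_set; rewrite /= in_itv/= s0.
have [sr|rs] := leP s r; last first.
  by rewrite memNset//= in_itv/= => /andP[]; rewrite leNgt rs.
have [rt|tr] := leP r t.
  rewrite !mem_set//= ?in_itv/= ?rt ?sr ?(le_trans s0)//.
  by rewrite mulrC.
rewrite !memNset ?mul0r//= in_itv/= => /andP[_]; by rewrite leNgt tr.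
Qed.

Lemma Rintegral_triangle :
  \int[leb]_(r in `[0, t]) (p r * \int[leb]_(s in `[0, r]) q s) =
  \int[leb]_(s in `[0, t]) (q s * \int[leb]_(r in `[s, t]) p r).
Proof.
rewrite [LHS]Rintegral_mkcond [RHS]Rintegral_mkcond; congr fine.
transitivity (\int[leb]_r \int[leb]_s (F (r, s))%:E)%E.
  by apply: eq_integral => r _; rewrite inner1.
have -> := Fubini iF.
by apply: eq_integral => s _; rewrite inner2.
Qed.

End triangle_fubini.

(** * Relaxation of a function of time *)

Section running_integral.
Context {R : realType}.
Local Notation leb := (@lebesgue_measure R).
Variables (q : R -> R) (S : R) (S0 : 0 <= S).
Hypothesis iq : leb.-integrable `[0, S] (EFin \o q).

Definition running (t : R) : R := \int[leb]_(s in `[0, t]) q s.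

Lemma running_continuous : {within `[0, S], continuous running}.
Proof. exact: (@parameterized_integral_continuous R 0 S q S0 iq). Qed.

Lemma measurable_running : measurable_fun `[0, S] running.
Proof.
apply: subspace_continuous_measurable_fun; first exact: measurable_itv.
exact: running_continuous.
Qed.

Lemma running_bound t : 0 <= t -> t <= S ->
  `|running t| <= \int[leb]_(s in `[0, S]) `|q s|.
Proof.
move=> t0 tS; have it : leb.-integrable `[0, t] (EFin \o q).
  exact: integrable_subitv iq _ _.
rewrite (le_trans (le_normr_Rintegral (measurable_itvR _) it))//.
have iqn := integrable_norm iq.
rewrite (Rintegral_itv_split iqn t0 tS) lerDl.
by apply: Rintegral_ge0 => s _ /=.
Qed.

Lemma integrable_mul_running (f : R -> R) :
  leb.-integrable `[0, S] (EFin \o f) ->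
  leb.-integrable `[0, S] (fun r => (running r * f r)%:E).
Proof.
move=> i; apply: (@bounded_mul_integrable _ _ _ _ _ (\int[leb]_(s in `[0, S]) `|q s|)) => //.
  exact: measurable_running.
by move=> r /andP[r0 rS]; exact: running_bound.
Qed.

Lemma Rintegral_running_tail s : 0 <= s -> s <= S ->
  \int[leb]_(r in `[s, S]) q r = running S - running s.
Proof.
by move=> s0 sS; rewrite /running (Rintegral_itv_split iq s0 sS) addrC addKr.
Qed.

Lemma Rintegral_mul_running :
  (\int[leb]_(r in `[0, S]) (q r * running r)) *+ 2 = running S ^+ 2.
Proof.
have H := Rintegral_triangle iq iq.
have i1 : leb.-integrable `[0, S] (fun r => (q r * running r)%:E).
  by apply: integrable_ext (integrable_mul_running iq) => r; exact: mulrC.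
have E : \int[leb]_(s in `[0, S]) (q s * \int[leb]_(r in `[s, S]) q r) =
    running S * running S - \int[leb]_(s in `[0, S]) (q s * running s).
  have -> : running S * running S = \int[leb]_(s in `[0, S]) (q s * running S).
    by rewrite RintegralZr//; exact: measurable_itvR.
  rewrite -RintegralB; [|exact: measurable_itvR|exact: integrable_scaler|exact: i1].
  apply: eq_Rintegral => s; rewrite inE/= in_itv/= => /andP[s0 sS].
  by rewrite Rintegral_running_tail; [rewrite mulrBr|exact: s0|exact: sS].
have HI : \int[leb]_(s in `[0, S]) (q s * running s) =
    running S * running S - \int[leb]_(s in `[0, S]) (q s * running s).
  exact: (etrans H E).
by rewrite mulr2n expr2 {1}HI subrK.
Qed.

End running_integral.

Section relaxation.
Context {R : realType}.
Local Notation leb := (@lebesgue_measure R).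
Variables (h eps t1 t2 : R).
Hypotheses (h0 : 0 < h) (eps0 : 0 < eps) (t10 : 0 <= t1) (t12 : t1 <= t2).
Local Notation rate := (rate h eps t1 t2).
Local Notation Al := (cumulated_rate h eps t1 t2).
Local Notation M := (rate_bound h eps).

(** The solution of [y' = rate * (phi - y)], [y 0 = c], by variation of constants. At
    every time it is a combination of [c] and the past values of [phi] with nonnegative
    coefficients, which is why it behaves well under a convex functional. *)
Definition relaxation (c : R) (phi : R -> R) (t : R) : R :=
  expR (- Al t) *
  (c + \int[leb]_(s in `[0, t]) (rate s * expR (Al s) * phi s)).

Variables (S : R) (S0 : 0 <= S) (c : R) (phi : R -> R).
Hypothesis iphi : leb.-integrable `[0, S] (EFin \o phi).
Local Notation y := (relaxation c phi).

Let q s := rate s * expR (Al s) * phi s.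

Let iq : leb.-integrable `[0, S] (EFin \o q).
Proof.
apply: (@bounded_mul_integrable _ _ _ _ _ (M * expR (Al S))) => //.
  apply: measurable_funM.
    by apply: measurable_rate; exact: measurable_itv.
  by apply: measurable_expP; exact: measurable_itv.
move=> r /andP[r0 rS]; rewrite normrM ler_pM ?normr_rate_le//.
by rewrite ger0_norm ?expR_ge0// ler_expR cumulated_rate_nd.
Qed.

Lemma relaxation_continuous : {within `[0, S], continuous y}.
Proof.
have cr := running_continuous S0 iq.
have ce : {within `[0, S], continuous (fun t => expR (- Al t))}.
  apply: continuous_subspaceT => t; have := @exp_cumulated_rate_continuous _ h eps t1 t2 (-1) t.
  rewrite /continuous_at mulN1r; apply: cvg_trans; apply: near_eq_cvg.
  by near=> s; rewrite mulN1r.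
move=> t; apply: cvgM; first exact: ce.
by apply: cvgD; [exact: cvg_cst|exact: cr].
Unshelve. all: by end_near. Qed.

Lemma measurable_relaxation : measurable_fun `[0, S] y.
Proof.
apply: subspace_continuous_measurable_fun; first exact: measurable_itv.
exact: relaxation_continuous.
Qed.

Lemma integrable_relaxation : leb.-integrable `[0, S] (EFin \o y).
Proof.
apply: continuous_compact_integrable; first exact: segment_compact.
exact: relaxation_continuous.
Qed.

Lemma integrable_rate_mul (f : R -> R) s t : leb.-integrable `[s, t] (EFin \o f) ->
  leb.-integrable `[s, t] (fun r => (rate r * f r)%:E).
Proof.
move=> i; apply: (@bounded_mul_integrable _ _ _ _ _ M) => //.
- by apply: measurable_rate; exact: measurable_itv.
- by move=> r _; exact: normr_rate_le.
Qed.

(** Substitute the formula for [y] and exchange the order of integration. *)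
Lemma relaxation_ode t : 0 <= t -> t <= S ->
  y t = c + \int[leb]_(r in `[0, t]) (rate r * (phi r - y r)).
Proof.
move=> t0 tS.
have sub f : leb.-integrable `[0, S] (EFin \o f) -> leb.-integrable `[0, t] (EFin \o f).
  by move=> i; exact: integrable_subitv i _ _.
pose p r := rate r * expR (- Al r).
have ip : leb.-integrable `[0, t] (EFin \o p).
  apply: integrable_ext (@integrable_rate_exp _ h eps t1 t2 h0 eps0 (-1) 0 t) => r.
  by rewrite mulN1r.
have iqt := sub _ iq.
have Ep : \int[leb]_(r in `[0, t]) p r = 1 - expR (- Al t).
  by rewrite Rintegral_rate_expN// cumulated_rate0// oppr0 expR0.
have Epq : \int[leb]_(r in `[0, t]) (p r * \int[leb]_(s in `[0, r]) q s) =
    \int[leb]_(r in `[0, t]) (rate r * phi r) -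
    expR (- Al t) * \int[leb]_(s in `[0, t]) q s.
  rewrite Rintegral_triangle// -RintegralZl// -RintegralB//; last 2 first.
  - by apply: integrable_rate_mul; exact: sub.
  - exact: integrable_scale.
  apply: eq_Rintegral => s; rewrite inE/= in_itv/= => /andP[s0 st].
  have ee : expR (Al s) * expR (- Al s) = 1 by rewrite -expRD subrr expR0.
  rewrite Rintegral_rate_expN// /q mulrBr; congr (_ - _); last by rewrite mulrC.
  by rewrite -[RHS]mulr1 -ee; ring.
have irphi : leb.-integrable `[0, t] (fun r => (rate r * phi r)%:E).
  by apply: integrable_rate_mul; exact: sub.
have iy := sub _ integrable_relaxation.
have iry : leb.-integrable `[0, t] (fun r => (rate r * y r)%:E).
  exact: integrable_rate_mul.
have ipq : leb.-integrable `[0, t] (fun r => (p r * \int[leb]_(s in `[0, r]) q s)%:E).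
  by apply: integrable_ext (integrable_mul_running t0 iqt ip) => r; exact: mulrC.
have Ery : \int[leb]_(r in `[0, t]) (rate r * y r) =
    c * (1 - expR (- Al t)) + (\int[leb]_(r in `[0, t]) (rate r * phi r) -
    expR (- Al t) * \int[leb]_(s in `[0, t]) q s).
  rewrite -Epq -Ep -RintegralZl// -RintegralD//; last first.
    exact: integrable_scale.
  by apply: eq_Rintegral => r _; rewrite /relaxation /p -/(q _); ring.
under [in RHS]eq_Rintegral do rewrite mulrBr.
rewrite RintegralB// Ery /relaxation; ring.
Qed.

Lemma relaxation_bound t : 0 <= t -> t <= S ->
  `|y t| <= `|c| + M * \int[leb]_(s in `[0, S]) `|phi s|.
Proof.
move=> t0 tS; have iqt : leb.-integrable `[0, t] (EFin \o q) by exact: integrable_subitv iq _ _.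
have inphi : leb.-integrable `[0, S] (EFin \o (fun s => `|phi s|)).
  exact: integrable_norm iphi.
have inphit := integrable_subitv inphi (lexx 0) tS.
rewrite /relaxation mulrDr (le_trans (ler_normD _ _))// lerD//.
  rewrite normrM ger0_norm ?expR_ge0// ler_piMl// -expR0 ler_expR oppr_le0.
  exact: cumulated_rate_ge0.
rewrite -RintegralZl// (le_trans (le_normr_Rintegral (measurable_itvR _) _))//.
  exact: integrable_scale.
apply: (@le_trans _ _ (\int[leb]_(s in `[0, t]) (M * `|phi s|))).
  apply: le_Rintegral; first exact: measurable_itvR.
  - exact: (integrable_norm (integrable_scale (expR (- Al t)) iqt)).
  - exact: integrable_scale.
  move=> s /=; rewrite in_itv/= => /andP[s0 st].
  rewrite /q !normrM !(ger0_norm (expR_ge0 _)) mulrA ler_wpM2r//.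
  rewrite mulrCA -expRD -[leRHS]mulr1 ler_pM ?expR_ge0 ?normr_rate_le//.
  by rewrite -expR0 ler_expR addrC subr_le0 cumulated_rate_nd.
rewrite RintegralZl; [|exact: measurable_itvR|exact: inphit].
rewrite ler_wpM2l ?(le_trans (normr_ge0 _) (normr_rate_le _ _ _ _ 0))//.
rewrite (Rintegral_itv_split inphi t0 tS) lerDl.
by apply: Rintegral_ge0 => s _ /=.
Qed.

End relaxation.

(** * Square-integrable functions *)

Section square_integrable.
Context {R : realType} {d : measure_display} {T : measurableType d}.
Variables (mu : {measure set T -> \bar R}) (D : set T) (mD : measurable D).
Implicit Types f g : T -> R.

Definition sq_integrable f :=
  measurable_fun D f /\ mu.-integrable D (fun x => (f x ^+ 2)%:E).

Lemma sq_integrableP f : measurable_fun D f ->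
  (\int[mu]_(x in D) (f x ^+ 2)%:E < +oo)%E -> sq_integrable f.
Proof.
move=> mf fi; split => //; apply/integrableP; split.
  by apply/measurable_EFinP; exact: measurable_funX.
apply: le_lt_trans fi; apply: le_integral_pointwise => x _.
by rewrite /= ger0_norm// sqr_ge0.
Qed.

Lemma sq_integrable_mul f g : sq_integrable f -> sq_integrable g ->
  mu.-integrable D (fun x => (f x * g x)%:E).
Proof.
move=> [mf fi] [mg gi].
apply: (le_integrable mD _ _ (integrableD mD fi gi)).
  by apply/measurable_EFinP; exact: measurable_funM.
move=> x _; rewrite /= lee_fin (@ger0_norm _ (_ + _)) ?addr_ge0 ?sqr_ge0//.
rewrite normrM -(real_normK (num_real (f x))) -(real_normK (num_real (g x))).
have := sqr_ge0 (`|f x| - `|g x|).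
have := mulr_ge0 (normr_ge0 (f x)) (normr_ge0 (g x)).
rewrite sqrrB; set a := `|f x|; set b := `|g x|; move=> ? ?; nra.
Qed.

Lemma sq_integrable_lincomb (a b : R) f g : sq_integrable f -> sq_integrable g ->
  sq_integrable (fun x => a * f x + b * g x).
Proof.
move=> fs gs; have fg := sq_integrable_mul fs gs.
case: fs gs => [mf fi] [mg gi]; split.
  by apply: measurable_funD; apply: measurable_funM.
rewrite (_ : (fun x => ((a * f x + b * g x) ^+ 2)%:E) =
  (fun x => (a ^+ 2)%:E * (f x ^+ 2)%:E + (b ^+ 2)%:E * (g x ^+ 2)%:E +
    (2 * a * b)%:E * (f x * g x)%:E)%E).
  by apply: integrableD => //; [apply: integrableD => //|]; exact: integrableZl.
by apply/funext => x; rewrite -!EFinM -!EFinD; congr EFin; ring.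
Qed.

Lemma sq_integrable_sub f g : sq_integrable f -> sq_integrable g ->
  sq_integrable (fun x => f x - g x).
Proof.
move=> fs gs; have := sq_integrable_lincomb 1 (-1) fs gs.
by rewrite (_ : (fun x => 1 * f x + _) = (fun x => f x - g x))//;
  apply/funext => x; rewrite mul1r mulN1r.
Qed.

Lemma sq_integrable_scale a f : sq_integrable f -> sq_integrable (fun x => a * f x).
Proof.
move=> fs; have := sq_integrable_lincomb a 0 fs fs.
by rewrite (_ : (fun x => a * f x + _) = (fun x => a * f x))//;
  apply/funext => x; rewrite mul0r addr0.
Qed.

Hypothesis muD : (mu D < +oo)%E.

Lemma sq_integrable_cst (c : R) : sq_integrable (cst c).
Proof.
split; first exact: measurable_cst.
apply/integrableP; split; first exact: (@measurable_cst _ _ _ _ D (c ^+ 2)%:E).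
rewrite [X in (X < _)%E](integral_cst mu mD `|(c ^+ 2)%:E|%E) lte_mul_pinfty ?ltry//.
Qed.

Lemma sq_integrable_bounded f (M : R) : measurable_fun D f ->
  (forall x, D x -> `|f x| <= M) -> sq_integrable f.
Proof.
move=> mf fM; have [_ iM] := sq_integrable_cst M; split => //.
apply: (le_integrable mD _ _ iM).
  by apply/measurable_EFinP; exact: measurable_funX.
move=> x /fM fx; rewrite /= lee_fin !ger0_norm ?sqr_ge0//.
have M0 := le_trans (normr_ge0 _) fx.
by rewrite -real_normK ?num_real// lerXn2r ?nnegrE.
Qed.

Lemma sq_integrable_integrable f : sq_integrable f -> mu.-integrable D (EFin \o f).
Proof.
move=> fs; have := sq_integrable_mul fs (sq_integrable_cst 1).
by rewrite (_ : (fun x => (f x * _)%:E) = EFin \o f)//; apply/funext => x /=; rewrite mulr1.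
Qed.

End square_integrable.

(** * Relaxation at a constant rate *)

Section yosida.
Context {R : realType}.
Local Notation leb := (@lebesgue_measure R).
Variables (c : R) (phi : R -> R).

Definition yosida_state (h : R) : R -> R := relaxation h h 0 0 c phi.
(** The difference quotient [(phi - y) / h], where [y] relaxes to [phi] at the rate
    [1 / h]. It is the derivative of [y]. *)
Definition yosida (h t : R) : R := (phi t - yosida_state h t) / h.

Variables (S : R) (S0 : 0 <= S).
Hypothesis sphi : sq_integrable leb `[0, S] phi.

Let mS : @measurable _ (measurableTypeR R) `[0, S]%classic.
Proof. exact: measurable_itvR. Qed.

Let finS : (leb (`[0%R, S]%classic : set (measurableTypeR R)) < +oo)%E.
Proof. exact: lebesgue_itv_lty. Qed.

Let iphi : leb.-integrable `[0, S] (EFin \o phi).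
Proof. exact: (sq_integrable_integrable mS finS sphi). Qed.

Lemma sq_integrable_yosida_state h : 0 < h ->
  sq_integrable leb `[0, S] (yosida_state h).
Proof.
move=> h0; apply: (@sq_integrable_bounded _ _ _ leb _ mS finS _
  (`|c| + rate_bound h h * \int[leb]_(s in `[0, S]) `|phi s|)).
  exact: (measurable_relaxation 0 0 h0 h0 S0 c iphi).
move=> t; rewrite /= in_itv/= => /andP[t0 tS].
by apply: relaxation_bound.
Qed.

Lemma sq_integrable_yosida h : 0 < h -> sq_integrable leb `[0, S] (yosida h).
Proof.
move=> h0; have := sq_integrable_scale mS h^-1
  (sq_integrable_sub mS sphi (sq_integrable_yosida_state h0)).
rewrite (_ : (fun x => h^-1 * _) = yosida h)//.
by apply/funext => t; rewrite mulrC.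
Qed.

Lemma yosida_ode h t : 0 < h -> 0 <= t -> t <= S ->
  yosida_state h t = c + \int[leb]_(r in `[0, t]) yosida h r.
Proof.
move=> h0 t0 tS.
transitivity (c + \int[leb]_(r in `[0, t]) (rate h h 0 0 r * (phi r - yosida_state h r))).
  exact: (@relaxation_ode _ h h 0 0 h0 h0 (lexx 0) (lexx 0) S).
congr (_ + _); apply: eq_Rintegral => r; rewrite inE/= in_itv/= => /andP[r0 _].
by rewrite rate_after// mulrC.
Qed.

(** Write [a] and [b] for the quotients at the scales [h < k]. The function
    [del = a - b] has the primitive [k b - h a], and the integral of a function times
    its primitive is half a square, so [a - b] and [k b - h a] have nonnegative scalar
    product. With [|a - b|^2 >= 0] this gives [|b|^2 <= (a, b)], which is
    the claim. *)
Lemma yosida_monotone h k : 0 < h -> h < k ->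
  \int[leb]_(t in `[0, S]) ((yosida h t - yosida k t) ^+ 2) +
  \int[leb]_(t in `[0, S]) (yosida k t ^+ 2) <=
  \int[leb]_(t in `[0, S]) (yosida h t ^+ 2).
Proof.
move=> h0 hk; have k0 := lt_trans h0 hk.
have sa := sq_integrable_yosida h0; have sb := sq_integrable_yosida k0.
pose a := yosida h; pose b := yosida k.
have [ma ia] := sa; have [mb ib] := sb.
have iab : leb.-integrable `[0, S] (fun t => (a t * b t)%:E).
  exact: (sq_integrable_mul mS sa sb).
pose A := \int[leb]_(t in `[0, S]) (a t ^+ 2).
pose B := \int[leb]_(t in `[0, S]) (b t ^+ 2).
pose C := \int[leb]_(t in `[0, S]) (a t * b t).
pose del t := a t - b t.
have sdel : sq_integrable leb `[0, S] del by exact: (sq_integrable_sub mS sa sb).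
have idel : leb.-integrable `[0, S] (EFin \o del).
  exact: (sq_integrable_integrable mS finS sdel).
have ia1 : leb.-integrable `[0, S] (EFin \o a) by exact: (sq_integrable_integrable mS finS sa).
have ib1 : leb.-integrable `[0, S] (EFin \o b) by exact: (sq_integrable_integrable mS finS sb).
have E1 : \int[leb]_(t in `[0, S]) (del t ^+ 2) = A + B - C *+ 2.
  transitivity (\int[leb]_(t in `[0, S]) ((a t ^+ 2 + b t ^+ 2) - (a t * b t + a t * b t))).
    by apply: eq_Rintegral => t _; rewrite /del; ring.
  rewrite RintegralB; [|exact: mS|exact: integrable_add|exact: integrable_add].
  rewrite mulr2n RintegralD; [|exact: mS|exact: ia|exact: ib].
  by rewrite RintegralD; [|exact: mS|exact: iab|exact: iab].
have E2 : 0 <= \int[leb]_(t in `[0, S]) (del t * running del t).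
  have := Rintegral_mul_running S0 idel.
  have := sqr_ge0 (running del S); rewrite mulr2n; lra.
have E3 : \int[leb]_(t in `[0, S]) (del t * running del t) =
    (h + k) * C - h * A - k * B.
  have -> : \int[leb]_(t in `[0, S]) (del t * running del t) =
      \int[leb]_(t in `[0, S]) ((h + k) * (a t * b t) - h * (a t ^+ 2) - k * (b t ^+ 2)).
    apply: eq_Rintegral => t; rewrite inE/= in_itv/= => /andP[t0 tS].
    have -> : running del t = k * b t - h * a t.
      rewrite /running /del RintegralB; last 3 first.
      - exact: measurable_itvR.
      - exact: integrable_subitv ia1 _ _.
      - exact: integrable_subitv ib1 _ _.
      have ha : h * a t = phi t - yosida_state h t.
        by rewrite /a /yosida mulrCA mulfV ?mulr1// gt_eqF.
      have kb : k * b t = phi t - yosida_state k t.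
        by rewrite /b /yosida mulrCA mulfV ?mulr1// gt_eqF.
      rewrite ha kb (yosida_ode h0 t0 tS) (yosida_ode k0 t0 tS) -/a -/b; ring.
    by rewrite /del; ring.
  rewrite RintegralB; [|exact: mS|by apply: integrable_sub; exact: integrable_scale|exact: integrable_scale].
  rewrite RintegralB; [|exact: mS|exact: integrable_scale|exact: integrable_scale].
  rewrite RintegralZl; [|exact: mS|exact: iab].
  rewrite RintegralZl; [|exact: mS|exact: ia].
  by rewrite RintegralZl; [|exact: mS|exact: ib].
have E4 : 0 <= A + B - C *+ 2.
  by rewrite -E1; apply: Rintegral_ge0 => t _; rewrite sqr_ge0.
move: E2; rewrite E3 -/a -/b -/A -/B => E2.
rewrite -[X in X + _]/(\int[leb]_(t in `[0, S]) (del t ^+ 2)) E1.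
suff : B <= C by rewrite mulr2n; lra.
have : (k - h) * B <= (k - h) * C by move: E4; rewrite mulr2n => E4; nra.
by rewrite ler_pM2l// subr_gt0.
Qed.

End yosida.

(** * Convergence of sequences with orthogonal increments *)

Section L2_limit.
Context {R : realType} {d : measure_display} {T : measurableType d}.
Variables (mu : {measure set T -> \bar R}) (p : nat -> T -> R) (C : R).
Local Open Scope ereal_scope.
Hypothesis mp : forall n, measurable_fun setT (p n).
Hypothesis pC : forall n, \int[mu]_x (p n x ^+ 2)%:E <= C%:E.
Hypothesis p_orth : forall n m, (n <= m)%N ->
  \int[mu]_x ((p m x - p n x) ^+ 2)%:E + \int[mu]_x (p n x ^+ 2)%:E <=
  \int[mu]_x (p m x ^+ 2)%:E.

Let a n : R := fine (\int[mu]_x (p n x ^+ 2)%:E).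

Let int_ge0 (f : T -> R) : 0 <= \int[mu]_x (f x ^+ 2)%:E.
Proof. by apply: integral_ge0 => x _; rewrite lee_fin sqr_ge0. Qed.

Let aE n : \int[mu]_x (p n x ^+ 2)%:E = (a n)%:E.
Proof. by rewrite /a fineK// ge0_fin_numE//; exact: le_lt_trans (pC n) (ltry _). Qed.

Let p_diff n m : (n <= m)%N ->
  \int[mu]_x ((p m x - p n x) ^+ 2)%:E <= (a m - a n)%:E.
Proof. by move=> nm; have := p_orth nm; rewrite !aE EFinB leeBrDr. Qed.

Let a_nd n m : (n <= m)%N -> (a n <= a m)%R.
Proof.
move=> nm; rewrite -subr_ge0 -lee_fin.
exact: le_trans (int_ge0 _) (p_diff nm).
Qed.

Let aC n : (a n <= C)%R. Proof. by rewrite -lee_fin -aE. Qed.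

Let sa : R := sup (range a).
Let has_sup_a : has_sup (range a).
Proof. by split; [exists (a 0%N), 0%N|exists C => _ [n _ <-]]. Qed.
Let a_le n : (a n <= sa)%R.
Proof. by apply: ub_le_sup; [exact: has_sup_a.2|exists n]. Qed.

(** With this precision the series of [4 ^+ j * Del j ^+ 2] has a finite integral. *)
Let eps j : R := ((2 ^ j.+1)%:R^-1 * (4 ^+ j)^-1)%R.
Let eps_gt0 j : (0 < eps j)%R.
Proof. by rewrite mulr_gt0// invr_gt0 ?exprn_gt0// ltr0n expn_gt0. Qed.

Let ex_rank j : exists n, (sa - eps j < a n)%R.
Proof.
have [_ [n _ <-] ?] := sup_adherent (eps_gt0 j) has_sup_a.
by exists n.
Qed.

Let rank := fix rank j : nat :=
  if j is k.+1 then maxn (maxn (rank k) k.+1) (projT1 (cid (ex_rank j)))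
  else projT1 (cid (ex_rank 0)).

Let rankP j : (sa - eps j < a (rank j))%R.
Proof.
case: j => [|j] /=; case: cid => n /= H //.
by apply: lt_le_trans H _; apply: a_nd; rewrite leq_maxr.
Qed.

Let rank_nd i j : (i <= j)%N -> (rank i <= rank j)%N.
Proof.
move=> /subnK <-; elim: (j - i)%N => // k /leq_trans; apply.
by rewrite addSn /= -maxnA leq_maxl.
Qed.

Let rank_ge j : (j <= rank j)%N.
Proof. by case: j => // j /=; rewrite leq_max leq_max leqnn orbT. Qed.

Let rank_diff i j : (j <= i)%N ->
  \int[mu]_x ((p (rank i) x - p (rank j) x) ^+ 2)%:E <= (eps j)%:E.
Proof.
move=> ji; apply: le_trans (p_diff (rank_nd ji)) _.
rewrite lee_fin; have := rankP j; have := a_le (rank i); lra.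
Qed.

Let Del j x : R := (p (rank j.+1) x - p (rank j) x)%R.

Let ae_bounded : {ae mu, forall x, exists K : R, forall j,
  (4 ^+ j * Del j x ^+ 2 <= K)%R}.
Proof.
pose g x := \sum_(j <oo) (4 ^+ j * Del j x ^+ 2)%:E.
have g0 j x : 0 <= (4 ^+ j * Del j x ^+ 2)%:E.
  by rewrite lee_fin mulr_ge0 ?sqr_ge0 ?exprn_ge0.
have mg j : measurable_fun setT (fun x => (4 ^+ j * Del j x ^+ 2)%:E).
  apply/measurable_EFinP; apply: measurable_funM => //.
  by apply: measurable_funX; exact: measurable_funB.
have ig : mu.-integrable setT g.
  apply/integrableP; split; first exact: ge0_emeasurable_sum.
  rewrite (eq_integral g); last first.
    by move=> x _; rewrite gee0_abs//; exact: nneseries_ge0.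
  rewrite integral_nneseries//; apply: le_lt_trans (ltry 1).
  apply: le_trans (epsilon_trick0 xpredT ler01).
  apply: lee_nneseries => [j _ _|j _]; first exact: integral_ge0.
  under eq_integral do rewrite EFinM.
  rewrite ge0_integralZl//; last 2 first.
  - apply/measurable_EFinP; apply: measurable_funX; exact: measurable_funB.
  - by move=> x _; rewrite lee_fin sqr_ge0.
  apply: le_trans (lee_wpmul2l _ (rank_diff (leqnSn j))) _.
    by rewrite lee_fin exprn_ge0.
  by rewrite -EFinM lee_fin /eps mulrCA mulfV ?gt_eqF ?exprn_gt0// mulr1 div1r.
apply: filterS (integrable_ae measurableT ig) => x /(_ I) gx.
exists (fine (g x)) => j.
rewrite -lee_fin fineK//.
apply: le_trans (nneseries_lim_ge j.+1 _); last by move=> *; exact: g0.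
by rewrite big_mkord big_ord_recr/= leeDr// sume_ge0.
Qed.

(** The increments are bounded by a geometric series of ratio [1 / 2]. *)
Lemma cvg_geometric_increments (u : nat -> R) (K : R) :
  (forall j, 4 ^+ j * (u j.+1 - u j) ^+ 2 <= K)%R -> cvgn u.
Proof.
move=> H.
have K0 : (0 <= K)%R.
  by apply: le_trans (H 0%N); rewrite mulr_ge0 ?sqr_ge0 ?exprn_ge0.
have Hd j : (`|u j.+1 - u j| <= geometric (Num.sqrt K) 2^-1 j)%R.
  rewrite /geometric/= -ler_sqr ?nnegrE ?mulr_ge0 ?sqrtr_ge0 ?exprn_ge0//.
  rewrite real_normK ?num_real// exprMn sqr_sqrtr// -exprM mulnC exprM.
  rewrite exprVn (_ : (2 ^+ 2 = 4 :> R)%R); last by rewrite expr2; ring.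
  by rewrite exprVn ler_pdivlMr ?exprn_gt0// mulrC.
have cv : cvgn (series (fun j => u j.+1 - u j)%R).
  apply: normed_cvg; apply: (series_le_cvg _ _ Hd) => [//|j|].
    by rewrite /geometric/= mulr_ge0 ?sqrtr_ge0 ?exprn_ge0.
  by apply: is_cvg_geometric_series; rewrite ger0_norm// invf_lt1// ltr1n.
have -> : u = (fun n => series (fun j => u j.+1 - u j) n + u 0%N)%R.
  by apply/funext => n; rewrite /series/= telescope_sumr// subrK.
by apply: is_cvgD => //; exact: is_cvg_cst.
Qed.

Let lim_p x : R := fine (limn_esup (fun j => (p (rank j) x)%:E)).

Let ae_cvg : {ae mu, forall x, (p (rank j) x)%:E @[j --> \oo] --> (lim_p x)%:E}.
Proof.
apply: filterS ae_bounded => x [K H].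
have cv := cvg_geometric_increments H.
have cv' : (p (rank j) x)%:E @[j --> \oo] --> (limn (fun j => p (rank j) x))%:E.
  by apply/fine_cvgP; split; [exact: nearW|exact: cv].
rewrite /lim_p (_ : limn_esup _ = (limn (fun j => p (rank j) x))%:E)//.
exact: (cvg_limn_einf_sup cv').2.
Qed.

Let measurable_lim_p : measurable_fun setT lim_p.
Proof.
apply: measurableT_comp => //; apply: measurable_fun_limn_esup => n.
exact/measurable_EFinP.
Qed.

Let fatou_lim (q : T -> R) (c : R) N : measurable_fun setT q ->
  (forall i, (N <= i)%N -> \int[mu]_x ((p (rank i) x - q x) ^+ 2)%:E <= c%:E) ->
  \int[mu]_x ((lim_p x - q x) ^+ 2)%:E <= c%:E.
Proof.
move=> mq H.
have mf i : measurable_fun setT (fun x => ((p (rank i) x - q x) ^+ 2)%:E).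
  by apply/measurable_EFinP; apply: measurable_funX; exact: measurable_funB.
apply: le_trans (_ : \int[mu]_x limn_einf (fun i => ((p (rank i) x - q x) ^+ 2)%:E) <= _).
  apply: ae_ge0_le_integral_pointwise => //.
  - by move=> x _; rewrite lee_fin sqr_ge0.
  - by move=> x _; apply: (@limn_einf_ge _ _ _ 0%N) => n _; rewrite lee_fin sqr_ge0.
  - apply: filterS ae_cvg => x /fine_cvgP[_ cx] _.
    rewrite (_ : limn_einf _ = ((lim_p x - q x) ^+ 2)%:E)//.
    apply: (cvg_limn_einf_sup _).1; apply/fine_cvgP; split; first exact: nearW.
    have c2 : (p (rank i) x - q x)%R @[i --> \oo] --> (lim_p x - q x)%R.
      by apply: cvgB => //; exact: cvg_cst.
    exact: (cvgM c2 c2).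
apply: le_trans (fatou mu measurableT mf _) _.
  by move=> i x _; rewrite lee_fin sqr_ge0.
exact: (limn_einf_le H).
Qed.

(** The norms increase and are bounded, so the squared distances are controlled
    by their increments, and the sequence is Cauchy. Along a subsequence with
    geometrically small increments it converges almost everywhere; the rest
    is Fatou's lemma. *)
Lemma L2_limit : exists2 q : T -> R, measurable_fun setT q /\
    \int[mu]_x (q x ^+ 2)%:E <= C%:E &
  forall e : R, (0 < e)%R -> forall N, exists2 n, (N <= n)%N &
    \int[mu]_x ((q x - p n x) ^+ 2)%:E <= e%:E.
Proof.
exists lim_p.
  split; first exact: measurable_lim_p.
  have := @fatou_lim (cst 0%R) C 0%N (measurable_cst _).
  under eq_integral do rewrite subr0.
  apply => i _; under eq_integral do rewrite subr0.
  exact: pC.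
move=> e e0 N; pose j := maxn N (Num.truncn e^-1); exists (rank j).
  by apply: leq_trans (rank_ge j); rewrite leq_maxl.
apply: (@fatou_lim _ _ j) => // i ji; apply: le_trans (rank_diff ji) _.
rewrite lee_fin /eps (@le_trans _ _ (2 ^ j.+1)%:R^-1%R)//.
  by rewrite ler_piMr ?invr_ge0// invf_le1 ?exprn_gt0// exprn_ege1// ler1n.
rewrite invf_ple ?posrE ?ltr0n ?expn_gt0// (@le_trans _ _ j.+1%:R%R)//.
  rewrite ltW// (lt_le_trans (truncnS_gt _))// ler_nat ltnS leq_maxr//.
by rewrite ler_nat ltnW// ltn_expl.
Qed.

End L2_limit.

(** * Tonelli on rectangles of space-time *)

Section rectangle_tonelli.
Context {R : realType} {d : measure_display} {T : measurableType d}.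
Variable mu : {sigma_finite_measure set T -> \bar R}.
Local Notation leb := (@lebesgue_measure R).
Local Notation TR := (T * measurableTypeR R)%type.
Local Open Scope ereal_scope.

Lemma measurable_fun_section1 (D : set R) (f : TR -> \bar R) x :
  measurable_fun setT f -> measurable_fun D (fun t => f (x, t)).
Proof. by move=> mf; apply: measurable_funTS; exact: measurableT_comp. Qed.

Lemma measurable_fun_section2 (A : set T) (f : TR -> \bar R) t :
  measurable_fun setT f -> measurable_fun A (fun x => f (x, t)).
Proof. by move=> mf; apply: measurable_funTS; exact: measurableT_comp. Qed.

Variables (A : set T) (B : set (measurableTypeR R)).
Hypotheses (mA : measurable A) (mB : measurable B).

Let restrict_rect (f : TR -> \bar R) z :
  (f \_ (A `*` B)) z = ((fun x => ((fun t => f (x, t)) \_ B) z.2) \_ A) z.1.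
Proof.
case: z => x t; rewrite /= /patch.
have [/set_mem Ax|Ax] := boolP (x \in A); last first.
  by rewrite memNset// => -[/=]; move: Ax; rewrite notin_setE.
have [/set_mem Bt|Bt] := boolP (t \in B); first by rewrite mem_set.
by rewrite memNset// => -[/=] _; move: Bt; rewrite notin_setE.
Qed.

Lemma tonelli_rect1 (f : TR -> \bar R) : measurable_fun setT f ->
  (forall z, 0 <= f z) -> \int[mu \x leb]_(z in A `*` B) f z =
  \int[mu]_(x in A) \int[leb]_(t in B) f (x, t).
Proof.
move=> mf f0; rewrite integral_mkcond fubini_tonelli1; last 2 first.
- apply/(measurable_restrictT _ _).1; first exact: measurableX.
  exact: measurable_funTS.
- by move=> z; exact: erestrict_ge0.
rewrite [RHS]integral_mkcond; apply: eq_integral => x _.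
rewrite /fubini_F [RHS]patchE; case: ifPn => [xA|xA].
  rewrite [RHS]integral_mkcond; apply: eq_integral => t _.
  by rewrite restrict_rect/= patchE xA.
by apply: integral0_eq => t _; rewrite restrict_rect/= patchE (negbTE xA).
Qed.

Lemma tonelli_rect2 (f : TR -> \bar R) : measurable_fun setT f ->
  (forall z, 0 <= f z) -> \int[mu \x leb]_(z in A `*` B) f z =
  \int[leb]_(t in B) \int[mu]_(x in A) f (x, t).
Proof.
move=> mf f0; rewrite integral_mkcond fubini_tonelli2; last 2 first.
- apply/(measurable_restrictT _ _).1; first exact: measurableX.
  exact: measurable_funTS.
- by move=> z; exact: erestrict_ge0.
rewrite [RHS]integral_mkcond; apply: eq_integral => t _.
rewrite /fubini_G [RHS]patchE; case: ifPn => [tB|tB].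
  rewrite [RHS]integral_mkcond; apply: eq_integral => x _.
  by rewrite restrict_rect/= !patchE tB.
apply: integral0_eq => x _; rewrite restrict_rect/= !patchE (negbTE tB).
by case: ifPn.
Qed.

Lemma measurable_integral_time (f : TR -> \bar R) : measurable_fun setT f ->
  (forall z, 0 <= f z) ->
  measurable_fun setT (fun x => \int[leb]_(t in B) f (x, t)).
Proof.
move=> mf f0.
rewrite (_ : (fun x => _) = fubini_F leb (f \_ (setT `*` B))).
  apply: measurable_fun_fubini_tonelli_F; last by move=> z; exact: erestrict_ge0.
  apply/(measurable_restrictT _ _).1; first exact: measurableX.
  exact: measurable_funTS.
apply/funext => x; rewrite integral_mkcond; apply: eq_integral => t _.
rewrite !patchE; have [/set_mem Bt|Bt] := boolP (t \in B); first by rewrite mem_set.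
by rewrite memNset// => -[/=] _; move: Bt; rewrite notin_setE.
Qed.

Lemma measurable_integral_space (f : TR -> \bar R) : measurable_fun setT f ->
  (forall z, 0 <= f z) ->
  measurable_fun setT (fun t => \int[mu]_(x in A) f (x, t)).
Proof.
move=> mf f0.
rewrite (_ : (fun x => _) = fubini_G mu (f \_ (A `*` setT))).
  apply: measurable_fun_fubini_tonelli_G; last by move=> z; exact: erestrict_ge0.
  apply/(measurable_restrictT _ _).1; first exact: measurableX.
  exact: measurable_funTS.
apply/funext => t; rewrite integral_mkcond; apply: eq_integral => x _.
rewrite !patchE; have [/set_mem Ax|Ax] := boolP (x \in A); first by rewrite mem_set.
by rewrite memNset// => -[/=]; move: Ax; rewrite notin_setE.
Qed.

Lemma measurable_signed_integral_space (f : TR -> \bar R) :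
  measurable_fun setT f ->
  measurable_fun setT (fun t => \int[mu]_(x in A) f (x, t)).
Proof.
move=> mf.
rewrite (_ : (fun t => _) = (fun t => \int[mu]_(x in A) f^\+ (x, t) -
    \int[mu]_(x in A) f^\- (x, t))).
  apply: emeasurable_funB; apply: measurable_integral_space => //.
  - exact: measurable_funepos.
  - exact: measurable_funeneg.
apply/funext => t; rewrite [LHS]integralE; congr (_ - _);
  by apply: eq_integral => x _; rewrite ?funeposE ?funenegE.
Qed.

Lemma measurable_Rintegral_time (f : T -> R -> R) :
  measurable_fun [set: TR] (fun z => f z.1 z.2) ->
  measurable_fun setT (fun x => \int[leb]_(t in B) f x t)%R.
Proof.
move=> mf; apply: measurableT_comp => //.
rewrite (_ : (fun x => _) = (fun x =>
    \int[leb]_(t in B) (fun z : TR => (f z.1 z.2)%:E)^\+ (x, t) -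
    \int[leb]_(t in B) (fun z : TR => (f z.1 z.2)%:E)^\- (x, t))).
  apply: emeasurable_funB; apply: measurable_integral_time => //.
  - by apply: measurable_funepos; exact/measurable_EFinP.
  - by apply: measurable_funeneg; exact/measurable_EFinP.
apply/funext => x; rewrite [LHS]integralE; congr (_ - _);
  by apply: eq_integral => t _; rewrite ?funeposE ?funenegE.
Qed.

End rectangle_tonelli.

Section running_joint.
Context {R : realType} {d : measure_display} {T : measurableType d}.
Local Notation leb := (@lebesgue_measure R).
Local Notation TR := (T * measurableTypeR R)%type.

Lemma measurable_running_joint (f : T -> R -> R) :
  measurable_fun [set: TR] (fun z => f z.1 z.2) ->
  measurable_fun [set: TR] (fun z => running (f z.1) z.2).
Proof.
move=> mf.
pose g (z : TR) (s : R) := if (0 <= s) && (s <= z.2) then f z.1 s else 0.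
rewrite (_ : (fun z => _) = (fun z => \int[leb]_(s in setT) g z s)).
  apply: measurable_Rintegral_time => //.
  apply: measurable_fun_ifT.
  - apply: measurable_and; apply: measurable_fun_ler => //.
    by apply: measurableT_comp => //; exact: measurableT_comp.
  - apply: (measurableT_comp mf (g := fun z : TR * measurableTypeR R => (z.1.1, z.2))).
    by apply: measurable_fun_pair => //; exact: measurableT_comp.
  - exact: measurable_cst.
apply/funext => -[x t] /=; rewrite /running Rintegral_mkcond.
apply: eq_Rintegral => s _; rewrite patchE /g/=.
have [/set_mem|] := boolP (s \in _); first by rewrite /= in_itv/= => ->.
by rewrite notin_setE/= in_itv/= => /negP/negbTE ->.
Qed.

End running_joint.

(** * Lebesgue norms over a subset *)

Section Lfun2_restrict.
Context {R : realType} {d : measure_display} {T : measurableType d}.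
Variable mu : {measure set T -> \bar R}.
Variables (A : set T) (mA : measurable A).
Implicit Types (g : T -> R).
Local Open Scope ereal_scope.

Lemma Lnorm2_restrict g :
  'N[mu]_2%:E[EFin \o (g \_ A)] = (\int[mu]_(x in A) (g x ^+ 2)%:E) `^ 2^-1.
Proof.
have sq_restrict x : (`|(g \_ A) x| ^+ 2 = ((fun x => g x ^+ 2) \_ A) x)%R.
  rewrite !patchE; case: ifPn => _; first by rewrite real_normK ?num_real.
  by rewrite normr0 expr0n.
rewrite unlock; congr (_ `^ _); rewrite [RHS]integral_mkcond.
apply: eq_integral => x _ /=; rewrite powR_mulrn// sq_restrict.
by rewrite !patchE; case: ifPn.
Qed.

Lemma Lfun2_restrictP g : (g \_ A \in Lfun mu 2%:E) <-> sq_integrable mu A g.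
Proof.
split.
  move=> /[dup] gL /Lfun2_integrable_sqr/integrableP[_ gi].
  have mg : measurable_fun A g.
    apply/(measurable_restrictT _ mA).2.
    by move: gL; rewrite inE => /andP[+ _]; rewrite inE.
  apply: sq_integrableP => //; apply: le_lt_trans gi.
  rewrite integral_mkcond; apply: le_integral_pointwise => x _.
  rewrite /= !patchE; case: ifPn => _; first by rewrite lee_fin ger0_norm ?sqr_ge0.
  exact: (@abse_ge0 R (0 ^+ 2)%:E).
move=> [mg gi]; rewrite inE; apply/andP; rewrite !inE/=; split.
  exact/(measurable_restrictT _ mA).1.
rewrite /finite_norm Lnorm2_restrict poweR_lty//.
by apply: integrable_lty gi.
Qed.

End Lfun2_restrict.

Section Lp_on_set.
Context {R : realType} {d : measure_display} {X : borelMetricType R d}.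
Variable mu : {measure set X -> \bar R}.
Variables (A : set X) (mA : measurable A).
Implicit Types (g : X -> R).
Local Open Scope ereal_scope.

Lemma Lp_norm2_le g (e : R) : (0 <= e)%R ->
  (Lp_norm mu A 2%:E g <= e%:E) = (\int[mu]_(x in A) (g x ^+ 2)%:E <= (e ^+ 2)%:E).
Proof.
move=> e0; rewrite /Lp_norm Lnorm2_restrict.
have : 0 <= \int[mu]_(x in A) (g x ^+ 2)%:E.
  by apply: integral_ge0 => x _; rewrite lee_fin sqr_ge0.
case: (\int[mu]_(x in A) _) => [r| |]//.
  rewrite lee_fin poweR_EFin !lee_fin => r0; rewrite powR12_sqrt//.
  by rewrite -[in LHS](ger0_norm e0) -sqrtr_sqr ler_sqrt// sqr_ge0.
by rewrite poweRyr ?leye_eq// invr_eq0 pnatr_eq0.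
Qed.

Lemma Lp_norm1E g : Lp_norm mu A 1%:E g = \int[mu]_(x in A) `|g x|%:E.
Proof.
rewrite /Lp_norm Lnorm1 [RHS]integral_mkcond; apply: eq_integral => x _ /=.
by rewrite !patchE; case: ifPn => //=; rewrite normr0.
Qed.

Lemma in_L2P g : in_Lp mu A 2%:E g <-> sq_integrable mu A g.
Proof. exact: Lfun2_restrictP. Qed.

Lemma in_L1P g : in_Lp mu A 1%:E g <-> mu.-integrable A (EFin \o g).
Proof.
have E : EFin \o (g \_ A) = (EFin \o g) \_ A.
  by apply/funext => x; rewrite /= !patchE; case: ifPn.
by rewrite /in_Lp; split => [/Lfun1_integrable|H];
  [|apply/Lfun1_integrable; move: H]; rewrite E -integrable_mkcond.
Qed.

(** [|g| <= (e + g^2 / e) / 2], integrated. *)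
Lemma L1_le_L2 g (m e q : R) : measurable_fun A g -> mu A = m%:E -> (0 < e)%R ->
  \int[mu]_(x in A) (g x ^+ 2)%:E <= q%:E ->
  \int[mu]_(x in A) `|g x|%:E <= ((e * m + e^-1 * q) / 2)%:E.
Proof.
move=> mg Am e0 gq.
apply: (@le_trans _ _ (\int[mu]_(x in A) ((e / 2)%:E + ((e^-1 / 2)%:E * (g x ^+ 2)%:E)))).
  apply: le_integral_pointwise => x _; rewrite -EFinM -EFinD lee_fin.
  have ge : (`|g x| = e^-1 * (e * `|g x|))%R by rewrite mulrA mulVf ?mul1r ?gt_eqF.
  rewrite (_ : (e / 2 + e^-1 / 2 * g x ^+ 2 =
    `|g x| + e^-1 / 2 * (e - `|g x|) ^+ 2)%R).
    by rewrite lerDl mulr_ge0 ?sqr_ge0// divr_ge0// invr_ge0 ltW.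
  rewrite -(real_normK (num_real (g x))); field; exact: lt0r_neq0.
have e2 : (0 <= e / 2)%R by rewrite divr_ge0// ltW.
have e2' : (0 <= e^-1 / 2)%R by rewrite divr_ge0// invr_ge0 ltW.
have mg2 : measurable_fun A (fun x => (g x ^+ 2)%:E).
  by apply/measurable_EFinP; exact: measurable_funX.
have g20 x : A x -> 0 <= (g x ^+ 2)%:E by rewrite lee_fin sqr_ge0.
rewrite ge0_integralD; [|exact: mA|by move=> x _; rewrite lee_fin|exact: measurable_cst
  |by move=> x Ax; rewrite mule_ge0 ?g20|exact: measurable_funeM].
rewrite ge0_integralZl; [|exact: mA|exact: mg2|exact: g20|by rewrite lee_fin].
rewrite integral_cst// Am mulrDl EFinD; apply: leeD.
  by rewrite -EFinM lee_fin mulrAC.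
by rewrite mulrAC [leRHS]EFinM; apply: lee_wpmul2l.
Qed.

End Lp_on_set.

Section C0_modulus.
Context {R : realType} {d : measure_display} {X : borelMetricType R d}.
Variable mu : {measure set X -> \bar R}.
Variables (A : set X) (mA : measurable A) (S : R).
Local Open Scope ereal_scope.

Lemma in_C0_Lp_modulus (p : \bar R) (V : R -> X -> R) :
  (forall t : R, (0 <= t <= S)%R -> in_Lp mu A p (V t)) ->
  (forall t : R, (0 <= t <= S)%R -> forall e : R, (0 < e)%R -> exists2 del : R, (0 < del)%R &
    forall s : R, (0 <= s <= S)%R -> (`|s - t| <= del)%R ->
      Lp_norm mu A p (V s \- V t)%R <= e%:E) ->
  in_C0_Lp mu A p S V.
Proof.
move=> VL Vm t tS; split; first exact: VL.
have close (e : R) : (0 < e)%R -> \forall s \near within `[0%R, S]%classic (nbhs t),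
    Lp_norm mu A p (V s \- V t)%R <= e%:E.
  move=> e0; have [del del0 H] := Vm t tS e e0.
  exists del => //= s; rewrite /ball/= distrC => st sS.
  by apply: H; [move: sS; rewrite in_itv|exact: ltW].
apply/fine_cvgP; split.
  apply: filterS (close 1%R ltr01) => s s1.
  by rewrite ge0_fin_numE ?Lnorm_ge0//; apply: le_lt_trans s1 _; rewrite ltry.
apply/cvgrPdist_le => e e0; apply: filterS (close e e0) => s se /=.
rewrite sub0r normrN ger0_norm ?fine_ge0 ?Lnorm_ge0//.
rewrite -lee_fin fineK// ge0_fin_numE ?Lnorm_ge0//; apply: le_lt_trans se _; rewrite ltry//.
Qed.

Lemma in_C0_Lp_close (p : \bar R) (V : R -> X -> R) t e : in_C0_Lp mu A p S V ->
  (0 <= t <= S)%R -> (0 < e)%R -> exists2 del : R, (0 < del)%R &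
    forall s : R, (0 <= s <= S)%R -> (`|s - t| <= del)%R ->
      Lp_norm mu A p (V s \- V t)%R <= e%:E.
Proof.
move=> VC tS e0; have [_ /fine_cvgP[fV /cvgrPdist_le/(_ _ e0) cV]] := VC t tS.
have [del /= del0 H] := filterI fV cV.
exists (del / 2)%R => [|s sS st]; first by rewrite divr_gt0.
have st' : ball t del s.
  by rewrite /ball/= distrC (le_lt_trans st)// ltr_pdivrMr//; lra.
have sS' : `[0%R, S]%classic s by rewrite /= in_itv.
have [fs] := H s st' sS'.
move=> /=; rewrite sub0r normrN ger0_norm ?fine_ge0 ?Lnorm_ge0//.
by rewrite -lee_fin fineK.
Qed.

Hypothesis muA : mu A < +oo.

Lemma in_C0_L2_L1_close (V : R -> X -> R) t (e : R) : in_C0_Lp mu A 2%:E S V ->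
  (0 <= t <= S)%R -> (0 < e)%R -> exists2 del : R, (0 < del)%R &
    forall s : R, (0 <= s <= S)%R -> (`|s - t| <= del)%R ->
      \int[mu]_(x in A) `|V s x - V t x|%:E <= e%:E.
Proof.
move=> VC tS e0; have mE : mu A = (fine (mu A))%:E.
  by rewrite fineK// ge0_fin_numE.
set m := fine (mu A) in mE; have m0 : (0 <= m)%R by exact: fine_ge0.
pose e' := (e / (m + 1))%R; have e'0 : (0 < e')%R by rewrite divr_gt0// ltr_wpDl.
have [del del0 H] := in_C0_Lp_close VC tS e'0; exists del => // s sS st.
have mV r : (0 <= r <= S)%R -> measurable_fun A (V r).
  by move=> rS; have [/(in_L2P mu mA)[]] := VC r rS.
have := H s sS st; rewrite Lp_norm2_le//; last exact: ltW.
move=> q; apply: le_trans (L1_le_L2 mA _ mE e'0 q) _.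
  by apply: measurable_funB; exact: mV.
rewrite lee_fin expr2 mulKf ?gt_eqF//.
rewrite (_ : (e' * m + e' = e)%R) /e'; first lra.
have m1 : (m + 1 != 0)%R by rewrite gt_eqF// ltr_wpDl.
by rewrite -[X in (_ + X)%R]mulr1 -mulrDr divfK.
Qed.

Lemma in_C0_L2_L1 (V : R -> X -> R) : in_C0_Lp mu A 2%:E S V ->
  in_C0_Lp mu A 1%:E S V.
Proof.
move=> VC; apply: in_C0_Lp_modulus => t tS.
  by have [/(in_L2P mu mA)/(sq_integrable_integrable mA muA) ? _] := VC t tS; exact: (in_L1P mu mA _).2.
move=> e e0; have [del del0 H] := in_C0_L2_L1_close VC tS e0.
by exists del => // s sS st; rewrite Lp_norm1E; exact: H.
Qed.

End C0_modulus.

(** * Total variation along a curve of functions *)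

Section total_variation_time.
Context {R : realType} {d : measure_display} {X : borelMetricType R d}.
Variable mu : {measure set X -> \bar R}.
Hypothesis mu_doubling : doubling mu.
Variables (A : set X) (oA : open A) (bA : metric_bounded A).
Local Notation TV := (total_var mu A).
Local Open Scope ereal_scope.

Let mA : measurable A. Proof. exact: measurable_open. Qed.

Lemma L1_dist_triangle (u v w : X -> R) : measurable_fun A u ->
  measurable_fun A v -> measurable_fun A w ->
  \int[mu]_(x in A) `|u x - w x|%:E <=
  \int[mu]_(x in A) `|u x - v x|%:E + \int[mu]_(x in A) `|v x - w x|%:E.
Proof.
move=> mu' mv mw.
have md (f g : X -> R) : measurable_fun A f -> measurable_fun A g ->
    measurable_fun A (fun x => `|f x - g x|%:E).
  move=> mf mg; apply/measurable_EFinP; apply: measurableT_comp => //.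
  exact: measurable_funB.
rewrite -ge0_integralD; [|exact: mA|by []|exact: md|by []|exact: md].
apply: le_integral_pointwise => x _; rewrite -EFinD lee_fin.
by rewrite (le_trans _ (ler_normD _ _))// addrA subrK.
Qed.

Lemma L1_distC (u v : X -> R) : \int[mu]_(x in A) `|u x - v x|%:E =
  \int[mu]_(x in A) `|v x - u x|%:E.
Proof. by apply: eq_integral => x _; rewrite distrC. Qed.

Variables (U : R -> X -> R).
Hypothesis mU : forall t, measurable_fun setT (U t).
Hypothesis cU : forall t e, (0 < e)%R -> exists2 del : R, (0 < del)%R &
  forall s, (`|s - t| <= del)%R -> \int[mu]_(x in A) `|U s x - U t x|%:E <= e%:E.

Let mUA t : measurable_fun A (U t). Proof. exact: measurable_funTS. Qed.

(** Lower semicontinuity in [L^1] makes the function lower semicontinuous in time. *)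
Lemma measurable_total_var_time : measurable_fun setT (fun t => TV (U t)).
Proof.
apply: lower_semicontinuous_measurable => t c ct.
have [e e0 et] : exists2 e : R, (0 < e)%R & ~ (TV (U t) <= (c + e)%:E).
  case E : (TV (U t)) => [r| |].
  - move: ct; rewrite E lte_fin => cr; exists ((r - c) / 2)%R.
      by rewrite divr_gt0// subr_gt0.
    by apply/negP; rewrite -ltNge lte_fin; lra.
  - by exists 1%R.
  - by move: ct; rewrite E.
apply: contrapT => H; apply: et.
apply: total_var_lsc => // e' e'0.
have [del del0 Hdel] := cU t e'0.
apply: contrapT => H'; apply: H; exists (ball t del); first exact: nbhsx_ballx.
move=> s; rewrite /ball/= distrC => st; rewrite ltNge; apply/negP => sc; apply: H'.
exists (U s); split => //; first by apply: Hdel; exact: ltW.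
by rewrite (le_trans sc)// lee_fin; lra.
Qed.

Lemma L1_uniformly_continuous (S e : R) : (0 < e)%R ->
  exists2 del : R, (0 < del)%R & forall s t : R, (0 <= s <= S)%R ->
    (`|s - t| <= del)%R -> \int[mu]_(x in A) `|U s x - U t x|%:E <= e%:E.
Proof.
move=> e0.
have := @segment_compact R 0%R S; move=> /compact_near_coveringP/(_ R (0^'+)%R
  (fun del s => forall t, (`|s - t| <= del)%R ->
     \int[mu]_(x in A) `|U s x - U t x|%:E <= e%:E) _) [].
  move=> s0 _; have e20 : (0 < e / 2)%R by rewrite divr_gt0.
  have [del del0 H] := cU s0 e20; have del20 : (0 < del / 2)%R by rewrite divr_gt0.
  exists (ball s0 (del / 2), [set x : R | (0 < x < del / 2)%R]).
    split; first exact: nbhsx_ballx.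
    by near=> x => /=; apply/andP; split; near: x;
      [exact: nbhs_right_gt|exact: nbhs_right_lt].
  move=> [s r] [/= + /andP[r0 rd]] t st; rewrite /ball/= distrC => s0s.
  rewrite (splitr e) EFinD; apply: le_trans (L1_dist_triangle _ (mUA s0) _) _ => //.
  apply: leeD; first by apply: H; rewrite (le_trans (ltW s0s))//; lra.
  rewrite L1_distC; apply: H; rewrite -(subrK s t) -addrA (le_trans (ler_normD _ _))//.
  by rewrite distrC; lra.
move=> del /= del0 H; exists (del / 2)%R; first by rewrite divr_gt0.
move=> s t sS st; apply: (H (del / 2)%R _ _ s _ t st).
- by rewrite /= sub0r normrN gtr0_norm ?divr_gt0// ltr_pdivrMr//; lra.
- by rewrite divr_gt0.
- by rewrite /= in_itv.
Unshelve. all: by end_near. Qed.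

End total_variation_time.

(** * Convexity of the total variation under time integrals *)

Section jensen.
Context {R : realType} {d : measure_display} {X : borelMetricType R d}.
Variable mu : {sigma_finite_measure set X -> \bar R}.
Hypothesis mu_doubling : doubling mu.
Variables (A : set X) (oA : open A) (bA : metric_bounded A).
Local Notation TV := (total_var mu A).
Local Notation leb := (@lebesgue_measure R).
Local Notation XR := (X * measurableTypeR R)%type.
Local Open Scope ereal_scope.

Variables (U : R -> X -> R).
Hypothesis mU : forall t, measurable_fun setT (U t).
Hypothesis cU : forall t e, (0 < e)%R -> exists2 del : R, (0 < del)%R &
  forall s, (`|s - t| <= del)%R -> \int[mu]_(x in A) `|U s x - U t x|%:E <= e%:E.

Variables (S : R) (k : R -> R) (M : R).
Hypothesis mk : measurable_fun setT k.
Hypothesis k0 : forall s, (0 <= k s)%R.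
Hypothesis kM : forall s, (0 <= s <= S)%R -> (k s <= M)%R.
Hypothesis TVU : \int[leb]_(s in `[0%R, S]) TV (U s) < +oo.

Let mA : measurable A. Proof. exact: measurable_open. Qed.
Let mUA t : measurable_fun A (U t). Proof. exact: measurable_funTS. Qed.

(** Total variation at time [s], finite for almost every [s]. *)
Definition tv_time (s : R) : R := fine (TV (U s)).

Lemma tv_time_ge0 s : (0 <= tv_time s)%R.
Proof. exact/fine_ge0/total_var_ge0. Qed.

Let mTV (D : set R) : measurable_fun D (fun s => TV (U s)).
Proof. by apply: measurable_funTS; exact: measurable_total_var_time. Qed.

Lemma measurable_tv_time (D : set R) : measurable_fun D tv_time.
Proof. by apply: measurable_funTS; apply: measurableT_comp => //; exact: measurable_total_var_time. Qed.

Let iTV : leb.-integrable `[0%R, S] (fun s => TV (U s)).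
Proof.
apply/integrableP; split; first exact: mTV.
apply: le_lt_trans TVU; apply: le_integral_pointwise => s _.
by rewrite gee0_abs// total_var_ge0.
Qed.

Lemma ae_tv_time : \forall s \ae leb, `[0%R, S]%classic s -> TV (U s) = (tv_time s)%:E.
Proof.
have := integrable_ae (measurable_itvR _) iTV.
by apply: filterS => s H /H ?; rewrite /tv_time fineK.
Qed.

Lemma integrable_tv_time : leb.-integrable `[0%R, S] (EFin \o tv_time).
Proof.
apply/integrableP; split; first by apply/measurable_EFinP; exact: measurable_tv_time.
apply: le_lt_trans TVU; apply: ae_ge0_le_integral_pointwise.
- by move=> s _; exact: abse_ge0.
- by move=> s _; exact: total_var_ge0.
- have := ae_tv_time; apply: ae_lebesgue_mono => s H /H -> /=.
  by rewrite ger0_norm// tv_time_ge0.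
Qed.

Let ik a b : (0 <= a)%R -> (b <= S)%R -> leb.-integrable `[a, b] (EFin \o k).
Proof.
move=> a0 bS; apply: (@integrable_subitv R k 0 S) => //.
have iM : leb.-integrable `[0%R, S] (EFin \o cst M).
  by apply: continuous_integrable => x; exact: cvg_cst.
apply: (le_integrable (measurable_itvR _) _ _ iM).
  by apply/measurable_EFinP; exact: measurable_funTS.
move=> s /=; rewrite in_itv/= => /kM ks; rewrite lee_fin (ger0_norm (k0 s)).
by rewrite (le_trans ks)// ler_norm.
Qed.

Let ikf a b f : (0 <= a)%R -> (b <= S)%R -> leb.-integrable `[a, b] (EFin \o f) ->
  leb.-integrable `[a, b] (fun s => (k s * f s)%:E).
Proof.
move=> a0 bS; apply: (@bounded_mul_integrable _ _ _ _ _ M); first exact: measurable_funTS.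
move=> r /andP[ar rb]; rewrite (ger0_norm (k0 r)); apply: kM.
by rewrite (le_trans a0 ar) (le_trans rb bS).
Qed.

Let ikF a b : (0 <= a)%R -> (b <= S)%R ->
  leb.-integrable `[a, b] (fun s => (k s * tv_time s)%:E).
Proof.
move=> a0 bS; apply: ikf => //; exact: integrable_subitv integrable_tv_time _ _.
Qed.

(** Otherwise [k] times the opposite inequality would integrate to the
    contradiction [kap * Phi >= kap * (Phi + e)]. *)
Lemma exists_sample (a b e : R) : (0 <= a)%R -> (a < b)%R -> (b <= S)%R -> (0 < e)%R ->
  exists s, [/\ (a <= s <= b)%R, TV (U s) = (tv_time s)%:E &
    ((\int[leb]_(r in `[a, b]) k r) * tv_time s <=
     (\int[leb]_(r in `[a, b]) (k r * tv_time r)) + e)%R].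
Proof.
move=> a0 ab bS e0; set kap := (\int[leb]_(r in `[a, b]) k r)%R.
set Phi := (\int[leb]_(r in `[a, b]) (k r * tv_time r))%R.
have kap0 : (0 <= kap)%R by apply: Rintegral_ge0.
have Phi0 : (0 <= Phi)%R by apply: Rintegral_ge0 => r _; rewrite mulr_ge0// tv_time_ge0.
apply: contrapT => H.
have {}H s : (a <= s <= b)%R -> TV (U s) = +oo \/ (Phi + e < kap * tv_time s)%R.
  move=> sab; have [E|E] := eqVneq (TV (U s)) +oo; first by left.
  right; rewrite ltNge; apply/negP => kF; apply: H; exists s; split => //.
  by rewrite /tv_time fineK// ge0_fin_numE ?total_var_ge0// ltey.
have fin : \int[leb]_(s in `[a, b]) TV (U s) < +oo.
  apply: le_lt_trans TVU; apply: ge0_subset_integral => [|||s _|s /=].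
  - exact: measurable_itvR.
  - exact: measurable_itvR.
  - exact: mTV.
  - exact: total_var_ge0.
  by rewrite !in_itv/= => /andP[as_ sb]; rewrite (le_trans a0 as_) (le_trans sb bS).
have [kap_eq0|kap_neq0] := eqVneq kap 0%R.
  have : \int[leb]_(s in `[a, b]) +oo <= \int[leb]_(s in `[a, b]) TV (U s).
    apply: le_integral_pointwise => s /=; rewrite in_itv/= => /H[->//|].
    by rewrite kap_eq0 mul0r ltNge addr_ge0// ltW.
  rewrite leNgt (integral_cst leb (measurable_itvR _)) => /negP; apply.
  have := @lebesgue_measure_itv R `[a, b]; rewrite /= lte_fin ab -EFinB => ->.
  by rewrite gt0_mulye// lte_fin subr_gt0.
have kap_gt0 : (0 < kap)%R by rewrite lt_neqAle eq_sym kap_neq0.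
have : \int[leb]_(s in `[a, b]) ((Phi + e) * k s)%:E <=
       \int[leb]_(s in `[a, b]) (kap%:E * ((k s)%:E * TV (U s))).
  apply: le_integral_pointwise => s /=; rewrite in_itv/= => sab.
  have [->|ks] := eqVneq (k s) 0%R; first by rewrite mulr0 mul0e mule0.
  have {ks} ks : (0 < k s)%R by rewrite lt_neqAle eq_sym ks k0.
  have [->|E] := H s sab; first by rewrite gt0_muley ?lte_fin// gt0_muley ?lte_fin// leey.
  have [->|F] := eqVneq (TV (U s)) +oo.
    by rewrite gt0_muley ?lte_fin// gt0_muley ?lte_fin// leey.
  have -> : TV (U s) = (tv_time s)%:E.
    by rewrite /tv_time fineK// ge0_fin_numE ?total_var_ge0// ltey.
  by rewrite -!EFinM lee_fin mulrCA mulrC ler_wpM2l// ltW.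
have -> : \int[leb]_(s in `[a, b]) (kap%:E * ((k s)%:E * TV (U s))) =
    \int[leb]_(s in `[a, b]) (kap * (k s * tv_time s))%:E.
  apply: ge0_ae_eq_integral_pointwise.
  - move=> s _; rewrite mule_ge0 ?lee_fin// mule_ge0 ?lee_fin//.
    exact: total_var_ge0.
  - by move=> s _; rewrite lee_fin mulr_ge0// mulr_ge0// tv_time_ge0.
  - have := ae_tv_time; apply: ae_lebesgue_mono => s Hs /=; rewrite in_itv/= => /andP[as_ sb].
    by rewrite Hs//= in_itv/= (le_trans a0 as_) (le_trans sb bS).
have i1 : leb.-integrable `[a, b] (fun s => ((Phi + e) * k s)%:E).
  exact/integrable_scale/ik.
have i2 : leb.-integrable `[a, b] (fun s => (kap * (k s * tv_time s))%:E).
  exact/(@integrable_scale _ _ _ _ (fun s => k s * tv_time s)%R)/ikF.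
rewrite -(fineK (integrable_fin_num (measurable_itvR _) i1)).
rewrite -(fineK (integrable_fin_num (measurable_itvR _) i2)) lee_fin.
rewrite -!/(Rintegral _ _ _).
rewrite (RintegralZl _ (measurable_itvR _) (ik a0 bS)).
rewrite (RintegralZl _ (measurable_itvR _) (ikF a0 bS)) -/kap -/Phi.
by rewrite mulrC ler_pM2l//; lra.
Qed.

Variable f : X -> R -> R.
Hypothesis mf : measurable_fun [set: XR] (fun z => f z.1 z.2).
Hypothesis fi : forall x, leb.-integrable `[0%R, S] (EFin \o f x).
Hypothesis fU : \forall s \ae leb, `[0%R, S]%classic s ->
  \forall x \ae mu, A x -> f x s = U s x.

Lemma measurable_weighted_integral (a b : R) :
  measurable_fun setT (fun x => \int[leb]_(r in `[a, b]) (k r * f x r))%R.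
Proof.
apply: (@measurable_Rintegral_time _ _ _ _ (measurable_itvR _) (fun x r => k r * f x r)%R).
by apply: measurable_funM => //; exact: measurableT_comp.
Qed.

(** On a short interval, the integral of [k f] is close in [L^1] to
    [kap * U s] for every [s], and [s] can be chosen so that its total variation is
    at most the average. *)
Lemma jensen_step (a b e1 e2 : R) : (0 <= a)%R -> (a < b)%R -> (b <= S)%R -> (0 < e2)%R ->
  (forall s t, (a <= s <= b)%R -> (a <= t <= b)%R ->
    \int[mu]_(x in A) `|U s x - U t x|%:E <= e1%:E) ->
  exists v : X -> R, [/\ measurable_fun A v,
    \int[mu]_(x in A) `|v x - \int[leb]_(r in `[a, b]) (k r * f x r)|%:E <=
      ((\int[leb]_(r in `[a, b]) k r) * e1)%:E &
    TV v <= ((\int[leb]_(r in `[a, b]) (k r * tv_time r)) + e2)%:E].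
Proof.
move=> a0 ab bS e20 e1P; have [s [sab Us sP]] := exists_sample a0 ab bS e20.
set kap := (\int[leb]_(r in `[a, b]) k r)%R in sP *.
have kap0 : (0 <= kap)%R by apply: Rintegral_ge0.
(* a combination of two functions, as total_var_lincomb has it *)
exists (fun x => kap * U s x + 0 * U s x)%R; split.
- by apply: measurable_funD; apply: measurable_funM.
- pose g (z : XR) := (k z.2 * `|U s z.1 - f z.1 z.2|)%:E.
  have mg : measurable_fun [set: XR] g.
    apply/measurable_EFinP; apply: measurable_funM; first exact: measurableT_comp.
    apply: measurableT_comp => //; apply: measurable_funB => //; exact: measurableT_comp.
  have g0 z : 0 <= g z by rewrite lee_fin mulr_ge0.
  apply: (@le_trans _ _ (\int[mu]_(x in A) \int[leb]_(r in `[a, b]) g (x, r))).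
    apply: le_integral_pointwise => x _; rewrite mul0r addr0.
    have ifx : leb.-integrable `[a, b] (EFin \o f x) by exact: integrable_subitv (fi x) _ _.
    have icU : leb.-integrable `[a, b] (EFin \o cst (U s x)).
      by apply: continuous_integrable => y; exact: cvg_cst.
    have iD := integrable_sub icU ifx.
    have -> : (kap * U s x - \int[leb]_(r in `[a, b]) (k r * f x r) =
        \int[leb]_(r in `[a, b]) (k r * (U s x - f x r)))%R.
      rewrite -(RintegralZr _ (measurable_itvR _) (ik a0 bS)).
      rewrite -RintegralB; last 3 first.
      + exact: measurable_itvR.
      + exact/integrable_scaler/ik.
      + exact: ikf.
      by apply: eq_Rintegral => r _; rewrite mulrBr.
    rewrite EFin_normr_Rintegral; last 2 first.
    + exact: measurable_itvR.
    + exact: (ikf a0 bS iD).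
    apply: le_trans (le_abse_integral _ _ _) _.
    + exact: measurable_itvR.
    + by have /integrableP[] := ikf a0 bS iD.
    apply: le_integral_pointwise => r _.
    by rewrite /g/= normrM (ger0_norm (k0 r)).
  rewrite -(tonelli_rect1 mu mA (measurable_itvR _) mg g0).
  rewrite (tonelli_rect2 mu mA (measurable_itvR _) mg g0).
  apply: (@le_trans _ _ (\int[leb]_(r in `[a, b]) (k r * e1)%:E)).
    apply: ae_ge0_le_integral_pointwise.
    + by move=> r _; apply: integral_ge0 => x _.
    + move=> r rab; rewrite lee_fin mulr_ge0// -lee_fin.
      by apply: le_trans (e1P s s sab sab); exact: integral_ge0.
    + have := fU; apply: ae_lebesgue_mono => r H /=; rewrite in_itv/= => /[dup] rab /andP[ar rb].
      have {H} fr : \forall x \ae mu, A x -> f x r = U r x.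
        by apply: H; rewrite /= in_itv/= (le_trans a0 ar) (le_trans rb bS).
      have -> : (fun x => g (x, r)) = (fun x => (k r)%:E * `|U s x - f x r|%:E).
        by apply/funext => x; rewrite /g EFinM.
      have mUf : measurable_fun A (fun x => `|U s x - f x r|%:E).
        apply/measurable_EFinP; apply: measurableT_comp => //; apply: measurable_funB => //.
        apply/measurable_EFinP.
        apply: (@measurable_fun_section2 _ _ _ A (fun z : XR => (f z.1 z.2)%:E) r).
        exact/measurable_EFinP.
      rewrite ge0_integralZl; [|exact: mA|exact: mUf|by []|by rewrite lee_fin].
      rewrite EFinM; apply: lee_wpmul2l; first by rewrite lee_fin.
      apply: le_trans (e1P s r sab rab).
      rewrite le_eqVlt; apply/orP; left; apply/eqP.
      apply: ge0_ae_eq_integral_pointwise => //.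
      by apply: filterS fr => x fx Ax; rewrite fx.
  have i1 := integrable_scaler e1 (ik a0 bS).
  rewrite -(fineK (integrable_fin_num (measurable_itvR _) i1)) lee_fin.
  rewrite -!/(Rintegral _ _ _).
  by rewrite (RintegralZr _ (measurable_itvR _) (ik a0 bS)).
- have Us' : TV (U s) <= (tv_time s)%:E by rewrite Us.
  apply: le_trans (total_var_lincomb mu_doubling oA bA kap0 (lexx 0%R) _ _ Us' Us') _ => //.
  by rewrite mul0r addr0 lee_fin.
Qed.

Variables (g0 : X -> R) (F0 : R).
Hypothesis mg0 : measurable_fun setT g0.
Hypothesis g0F0 : TV g0 <= F0%:E.

Let state t x := (g0 x + \int[leb]_(r in `[0, t]) (k r * f x r))%R.

Lemma jensen_riemann (e1 e2 del : R) n : (0 < e2)%R -> (0 < del)%R ->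
  (forall s t, (0 <= s <= S)%R -> (`|s - t| <= del)%R ->
    \int[mu]_(x in A) `|U s x - U t x|%:E <= e1%:E) ->
  forall t, (0 <= t)%R -> (t <= S)%R -> (t <= n%:R * del)%R ->
  exists v : X -> R, [/\ measurable_fun A v,
    \int[mu]_(x in A) `|v x - state t x|%:E <= ((\int[leb]_(r in `[0%R, t]) k r) * e1)%:E &
    TV v <= (F0 + (\int[leb]_(r in `[0%R, t]) (k r * tv_time r)) + n%:R * e2)%:E].
Proof.
move=> e20 del0 e1P; elim: n => [|n IH] t t0 tS tn.
  have -> : t = 0%R by apply/eqP; rewrite eq_le t0 andbT (le_trans tn)// mul0r.
  exists g0; split; first exact: measurable_funTS.
    rewrite [X in X <= _]integral0_eq ?Rintegral_itv11 ?mul0r// => x _.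
    by rewrite /state Rintegral_itv11 addr0 subrr normr0.
  by rewrite Rintegral_itv11 mul0r !addr0.
have [tn'|tn'] := leP t (n%:R * del)%R.
  have [v [mv v1 v2]] := IH t t0 tS tn'; exists v; split => //.
  apply: le_trans v2 _; rewrite lee_fin lerD2l ler_wpM2r ?(ltW e20)//.
  by rewrite ler_nat.
set a := (n%:R * del)%R in tn'; have a0 : (0 <= a)%R by rewrite mulr_ge0// ltW.
have aS : (a <= S)%R by rewrite (le_trans (ltW tn')).
have ta : (t - a <= del)%R by move: tn; rewrite -natr1 mulrDl mul1r -/a; lra.
have [v [mv v1 v2]] := IH a a0 aS (lexx _).
have [|w [mw w1 w2]] := @jensen_step a t e1 e2 a0 tn' tS e20.
  move=> s r /andP[as_ st] /andP[ar rt]; apply: e1P.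
    by rewrite (le_trans a0 as_) (le_trans st tS).
  by rewrite ler_norml; apply/andP; split; lra.
exists (fun x => 1 * v x + 1 * w x)%R; split.
- by apply: measurable_funD; apply: measurable_funM.
- rewrite (Rintegral_itv_split (ik (lexx 0%R) tS) a0 (ltW tn')) mulrDl EFinD.
  apply: le_trans (leeD v1 w1); rewrite -ge0_integralD//; last 2 first.
  + apply/measurable_EFinP; apply: measurableT_comp => //; apply: measurable_funB => //.
    apply: measurable_funTS; apply: measurable_funD => //.
    exact: measurable_weighted_integral.
  + apply/measurable_EFinP; apply: measurableT_comp => //; apply: measurable_funB => //.
    by apply: measurable_funTS; exact: measurable_weighted_integral.
  apply: le_integral_pointwise => x _; rewrite -EFinD lee_fin /state.
  have ifx : leb.-integrable `[0%R, t] (EFin \o f x).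
    exact: (integrable_subitv (fi x) (lexx _) tS).
  rewrite (Rintegral_itv_split (ikf (lexx 0%R) tS ifx) a0 (ltW tn')) !mul1r.
  by apply: le_trans (ler_normD _ _); rewrite le_eqVlt; apply/orP; left; apply/eqP; congr (`|_|)%R; ring.
- apply: le_trans (total_var_lincomb mu_doubling oA bA ler01 ler01 mv mw v2 w2) _.
  rewrite (Rintegral_itv_split (ikF (lexx 0%R) tS) a0 (ltW tn')) lee_fin !mul1r.
  by rewrite -natr1 mulrDl mul1r; lra.
Qed.

(** Jensen's inequality for the total variation; since the total variation is
    sublinear, the weight may have any mass. The integral is approximated by
    Riemann sums at the points of [exists_sample], and semicontinuity takes care
    of the limit. *)
Lemma total_var_time_integral t : (0 <= t)%R -> (t <= S)%R ->
  TV (state t) <= (F0 + \int[leb]_(r in `[0%R, t]) (k r * tv_time r))%:E.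
Proof.
move=> t0 tS; apply: total_var_lsc => //.
  apply: measurable_funTS; apply: measurable_funD => //.
  exact: measurable_weighted_integral.
move=> e e0; set K := (\int[leb]_(r in `[0%R, t]) k r)%R.
have K0 : (0 <= K)%R by apply: Rintegral_ge0.
pose e1 := (e / (K + 1))%R; have e10 : (0 < e1)%R by rewrite divr_gt0// ltr_wpDl.
have [del del0 delP] := L1_uniformly_continuous oA mU cU S e10.
pose n := (Num.truncn (t / del)).+1.
have tn : (t <= n%:R * del)%R by rewrite -ler_pdivrMr// ltW// truncnS_gt.
pose e2 := (e / n%:R)%R; have e20 : (0 < e2)%R by rewrite divr_gt0// ltr0n.
have [v [mv v1 v2]] := @jensen_riemann e1 e2 del n e20 del0 delP t t0 tS tn.
exists v; split => //.
  apply: le_trans v1 _; rewrite lee_fin /e1 mulrCA ler_piMr ?(ltW e0)//.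
  by rewrite ler_pdivrMr ?mul1r ?lerDl// ltr_wpDl.
by apply: le_trans v2 _; rewrite /e2 mulrCA mulfV ?mulr1// pnatr_eq0.
Qed.

End jensen.

(** * Weak derivative and Holder bound of a primitive *)

Section weak_derivative_of_integral.
Context {R : realType}.
Local Notation leb := (@lebesgue_measure R).

Lemma integrable_continuous_mul (k f : R -> R) (a b : R) : continuous k ->
  leb.-integrable `[a, b] (EFin \o f) ->
  leb.-integrable `[a, b] (fun t => (k t * f t)%:E).
Proof.
move=> ck fi; have [M /= [_ MP]] : bounded_set (k @` `[a, b]).
  apply: compact_bounded; apply: continuous_compact; last exact: segment_compact.
  exact: continuous_subspaceT.
apply: (@bounded_mul_integrable _ _ _ _ _ (M + 1)) => //.
  by apply: continuous_measurable => //; exact: measurable_itv.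
by move=> r rS; apply: (MP (M + 1)); [rewrite ltrDl|exists r => //=; rewrite in_itv].
Qed.

Lemma Rintegral_derive1 (eta : R -> R) (s t : R) :
  (forall n r, derivable (eta^`(n))%classic r 1) -> s <= t ->
  \int[leb]_(r in `[s, t]) (eta^`())%classic r = eta t - eta s.
Proof.
move=> deta; rewrite le_eqVlt => /predU1P[<-|st]; first by rewrite Rintegral_itv11 subrr.
have ceta r : {for r, continuous eta}.
  by apply/differentiable_continuous/derivable1_diffP; exact: (deta 0%N).
have cdeta : continuous (eta^`())%classic.
  by move=> r; apply/differentiable_continuous/derivable1_diffP; exact: (deta 1%N).
rewrite /Rintegral (@continuous_FTC2 _ _ eta)//.
- exact: continuous_subspaceT.
- split.
  + by move=> x _; exact: (deta 0%N).
  + exact/cvg_at_right_filter/ceta.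
  + exact/cvg_at_left_filter/ceta.
Qed.

Lemma derive1_eq0_outside (eta : R -> R) (a b t : R) :
  (forall t, ~~ (a <= t <= b) -> eta t = 0) -> ~~ (a <= t <= b) ->
  (eta^`())%classic t = 0.
Proof.
move=> eta0 tab; rewrite derive1E.
have -> : 'D_1 eta t = 'D_1 (cst (0 : R)) t; last by rewrite derive_cst.
apply: near_eq_derive => //.
move: tab; rewrite negb_and -!ltNge => /orP[ta|bt].
- near=> s; apply: eta0; rewrite negb_and -!ltNge; apply/orP; left.
  by near: s; exact: lt_nbhsl.
- near=> s; apply: eta0; rewrite negb_and -!ltNge; apply/orP; right.
  by near: s; exact: lt_nbhsr.
Unshelve. all: by end_near. Qed.

(** Fubini on the triangle and the fundamental theorem of calculus for [eta]. *)
Lemma Rintegral_by_parts (S c : R) (w eta : R -> R) (a b : R) : 0 <= S ->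
  leb.-integrable `[0, S] (EFin \o w) ->
  (forall n r, derivable (eta^`(n))%classic r 1) ->
  0 < a -> b < S -> (forall t, ~~ (a <= t <= b) -> eta t = 0) ->
  \int[leb]_(t in `[0, S]) ((c + running w t) * (eta^`())%classic t) =
  - \int[leb]_(t in `[0, S]) (w t * eta t).
Proof.
move=> S0 iw deta a0 bS eta0.
have etaS : eta S = 0 by apply: eta0; rewrite negb_and -!ltNge bS orbT.
have eta_0 : eta 0 = 0 by apply: eta0; rewrite negb_and -!ltNge a0.
have mS : @measurable _ (measurableTypeR R) `[0, S]%classic by exact: measurable_itvR.
have cdeta : continuous (eta^`())%classic.
  by move=> r; apply/differentiable_continuous/derivable1_diffP; exact: (deta 1%N).
have ieta : leb.-integrable `[0, S] (EFin \o (eta^`())%classic).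
  exact: continuous_integrable.
have ir := integrable_mul_running S0 iw ieta.
transitivity (\int[leb]_(t in `[0, S]) (c * (eta^`())%classic t +
    running w t * (eta^`())%classic t)).
  by apply: eq_Rintegral => t _; rewrite mulrDl.
rewrite RintegralD; [|exact: mS|exact: integrable_scale|exact: ir].
rewrite RintegralZl; [|exact: mS|exact: ieta].
rewrite Rintegral_derive1// etaS eta_0 subrr mulr0 add0r.
transitivity (\int[leb]_(r in `[0, S]) ((eta^`())%classic r *
    \int[leb]_(s in `[0, r]) w s)).
  by apply: eq_Rintegral => t _; rewrite mulrC.
rewrite Rintegral_triangle//.
transitivity (\int[leb]_(t in `[0, S]) (-1 * (w t * eta t))).
  apply: eq_Rintegral => t; rewrite inE/= in_itv/= => /andP[t0 tS].
  by rewrite Rintegral_derive1// etaS; ring.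
have iwe : leb.-integrable `[0, S] (fun t => (w t * eta t)%:E).
  apply: (@integrable_ext _ 0 S (fun t => eta t * w t)) => [t|]; first exact: mulrC.
  apply: integrable_continuous_mul => // r.
  by apply/differentiable_continuous/derivable1_diffP; exact: (deta 0%N).
by rewrite RintegralZl; [rewrite mulN1r|exact: mS|exact: iwe].
Qed.

(** Cauchy-Schwarz, from the integral of [(w - lam)^2] at its minimum in [lam]. *)
Lemma running_increment_sq (S : R) (w : R -> R) (s t : R) :
  sq_integrable leb `[0, S] w -> 0 <= s -> s <= t -> t <= S ->
  (running w t - running w s) ^+ 2 <=
  (t - s) * \int[leb]_(r in `[0, S]) (w r ^+ 2).
Proof.
move=> sw s0; rewrite le_eqVlt => /predU1P[<-|st] tS.
  by rewrite !subrr expr0n mul0r.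
have S0 : 0 <= S by rewrite (le_trans s0)// (le_trans (ltW st)).
have mS : @measurable _ (measurableTypeR R) `[0, S]%classic by exact: measurable_itvR.
have mst : @measurable _ (measurableTypeR R) `[s, t]%classic by exact: measurable_itvR.
have lebst : leb (`[s, t]%classic : set (measurableTypeR R)) = (t - s)%:E.
  by have := @lebesgue_measure_itv R `[s, t]; rewrite /= lte_fin st -EFinB.
have finS : (leb (`[0%R, S]%classic : set (measurableTypeR R)) < +oo)%E.
  exact: lebesgue_itv_lty.
have iw : leb.-integrable `[0, S] (EFin \o w) by exact: (sq_integrable_integrable mS finS sw).
have iw2 := sw.2.
have it0 := integrable_subitv iw (lexx 0) tS.
have -> : running w t - running w s = \int[leb]_(r in `[s, t]) w r.
  by rewrite /running (Rintegral_itv_split it0 s0 (ltW st)) addrC addKr.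
set I := \int[leb]_(r in `[s, t]) w r.
have i1 := integrable_subitv iw s0 tS.
have i2 : leb.-integrable `[s, t] (fun r => (w r ^+ 2)%:E).
  exact: (@integrable_subitv _ (fun r => w r ^+ 2) 0 S).
have le2 : \int[leb]_(r in `[s, t]) (w r ^+ 2) <= \int[leb]_(r in `[0, S]) (w r ^+ 2).
  have i20 : leb.-integrable `[0, t] (fun r => (w r ^+ 2)%:E).
    exact: (@integrable_subitv _ (fun r => w r ^+ 2) 0 S).
  rewrite (@Rintegral_itv_split _ (fun r => w r ^+ 2) 0 S t)//; last by rewrite (le_trans s0)// ltW.
  rewrite (@Rintegral_itv_split _ (fun r => w r ^+ 2) 0 t s)//; last by rewrite ltW.
  rewrite -[leLHS]addr0 -[leLHS]add0r addrA; apply: lerD; first apply: lerD => //;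
    by apply: Rintegral_ge0 => r _; rewrite sqr_ge0.
have ts : 0 < t - s by rewrite subr_gt0.
apply: le_trans (_ : (t - s) * \int[leb]_(r in `[s, t]) (w r ^+ 2) <= _); last first.
  by rewrite ler_pM2l.
pose lam := I / (t - s).
have : 0 <= \int[leb]_(r in `[s, t]) ((w r - lam) ^+ 2).
  by apply: Rintegral_ge0 => r _; rewrite sqr_ge0.
have -> : \int[leb]_(r in `[s, t]) ((w r - lam) ^+ 2) =
    \int[leb]_(r in `[s, t]) ((w r ^+ 2 - (2 * lam) * w r) + lam ^+ 2).
  by apply: eq_Rintegral => r _; ring.
have ic : leb.-integrable `[s, t] (EFin \o cst (lam ^+ 2)).
  by apply: continuous_integrable => y; exact: cvg_cst.
rewrite RintegralD; [|exact: mst|by apply: integrable_sub => //; exact: integrable_scale|exact: ic].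
rewrite RintegralB; [|exact: mst|exact: i2|exact: integrable_scale].
rewrite RintegralZl; [|exact: mst|exact: i1].
rewrite Rintegral_cst// -/I.
have -> : fine (leb (`[s, t]%classic : set (measurableTypeR R))) = t - s by rewrite lebst.
set J := (X in X - _ * _ + _).
have Elam : lam * (t - s) = I by rewrite /lam divfK// gt_eqF.
rewrite -(pmulr_lge0 _ ts) => H.
have : (t - s) * (J - 2 * lam * I + lam ^+ 2 * (t - s)) = (t - s) * J - I ^+ 2.
  by rewrite -Elam; ring.
by move=> E; move: H; rewrite [X in _ <= X]mulrC E subr_ge0.
Qed.

End weak_derivative_of_integral.

(** * Primitives in time of functions on space-time *)

Section time_interval.
Context {R : realType}.
Local Notation leb := (@lebesgue_measure R).
Local Open Scope ereal_scope.

Lemma time_itvE (S : R) : time_itv S%:E = `]0%R, S[%classic.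
Proof. by apply/seteqP; split => t /=; rewrite in_itv/=; [move=> -[t0]|move=> /andP[t0]]; rewrite ?lte_fin => tS; [apply/andP|]. Qed.

Lemma time_itvy : time_itv +oo = `]0%R, +oo[%classic :> set R.
Proof.
apply/seteqP; split => t /=; rewrite in_itv/= andbT; first by case.
by move=> t0; split => //; rewrite ltry.
Qed.

Lemma measurable_time_itv (T : \bar R) :
  @measurable _ (measurableTypeR R) (time_itv T).
Proof.
case: T => [S| |]; rewrite ?time_itvE ?time_itvy; try exact: measurable_itv.
rewrite (_ : time_itv _ = set0); first exact: measurable0.
by apply/seteqP; split => // t [_]; rewrite ltNge leNye.
Qed.

End time_interval.

Section space_time_primitive.
Context {R : realType} {d : measure_display} {X : borelMetricType R d}.
Variable mu : {sigma_finite_measure set X -> \bar R}.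
Variables (A : set X) (mA : measurable A).
Local Notation leb := (@lebesgue_measure R).
Local Notation XR := (X * measurableTypeR R)%type.
Local Open Scope ereal_scope.

Variables (g0 : X -> R) (w : X -> R -> R).
Hypothesis mw : measurable_fun [set: XR] (fun z => w z.1 z.2).

(** Almost every fibre is absolutely continuous with derivative [w x]; the
    test function vanishes outside a compact interval, which is contained in some
    [0, S] with [S < T]. *)
Lemma weak_dt_L2_primitive (T : \bar R) (v : X -> R -> R) : 0 < T ->
  \int[mu]_(x in A) \int[leb]_(t in time_itv T) (w x t ^+ 2)%:E < +oo ->
  (forall x S, A x -> (0 <= S)%R -> S%:E < T -> leb.-integrable `[0%R, S] (EFin \o w x)) ->
  (\forall x \ae mu, A x -> \forall t \ae leb, time_itv T t ->
     v x t = (g0 x + running (w x) t)%R) ->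
  weak_dt_L2 mu A T v w.
Proof.
move=> T0 finw iw vE.
have mw2 : measurable_fun [set: XR] (fun z => (w z.1 z.2 ^+ 2)%:E).
  by apply/measurable_EFinP; exact: measurable_funX.
split.
  have mAT : measurable (A `*` (time_itv T : set (measurableTypeR R))).
    by apply: measurableX => //; exact: measurable_time_itv.
  apply/(Lfun2_restrictP _ mAT).
  apply: sq_integrableP; first exact: measurable_funTS.
  rewrite (tonelli_rect1 mu mA (measurable_time_itv T) mw2)// => z.
  by rewrite lee_fin sqr_ge0.
move=> eta [deta [a [b [a0 bT etab]]]].
have [S [S0 bS ST]] : exists S : R, [/\ (0 <= S)%R, (b < S)%R & S%:E < T].
  case: T T0 bT {finw iw vE} => [T| |]//; rewrite ?lte_fin => T0 bT.
    have mT : (Num.max b 0 < T)%R by rewrite gt_max bT.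
    have mb : (b <= Num.max b 0)%R by rewrite le_max lexx.
    have m0 : (0 <= Num.max b 0)%R by rewrite le_max lexx orbT.
    exists ((Num.max b 0 + T) / 2)%R; rewrite lte_fin; split; lra.
  exists (`|b| + 1)%R; split; [by rewrite addr_ge0| |by rewrite ltry].
  by rewrite (le_lt_trans (ler_norm b))// ltrDl.
have cut (F : R -> \bar R) : (forall t, ~~ (a <= t <= b)%R -> F t = 0) ->
    \int[leb]_(t in time_itv T) F t = \int[leb]_(t in `[0%R, S]) F t.
  move=> F0; rewrite integral_mkcond [RHS]integral_mkcond.
  apply: eq_integral => t _; rewrite !patchE.
  have [/andP[at_ tb]|/F0 ->] := boolP (a <= t <= b)%R; last by rewrite !if_same.
  rewrite mem_set; last first.
    by split; [exact: lt_le_trans at_|rewrite (le_lt_trans _ bT)// lee_fin].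
  rewrite mem_set//= in_itv/= (le_trans (ltW a0) at_)/=.
  by rewrite (le_trans tb)// ltW.
move: vE; apply: filterS => x H Ax.
have iwx := iw x S Ax S0 ST.
transitivity (\int[leb]_(t in time_itv T)
    ((g0 x + running (w x) t) * (eta^`())%classic t)%:E).
  apply: ae_eq_integral_pointwise; move: (H Ax); apply: ae_lebesgue_mono.
  by move=> t + Dt => ->.
rewrite !cut; last 2 first.
- by move=> t /etab ->; rewrite mulr0.
- by move=> t /(derive1_eq0_outside etab) ->; rewrite mulr0.
have cdeta : continuous (eta^`())%classic.
  by move=> r; apply/differentiable_continuous/derivable1_diffP; exact: (deta 1%N).
have ceta : continuous eta.
  by move=> r; apply/differentiable_continuous/derivable1_diffP; exact: (deta 0%N).
have ieta : leb.-integrable `[0%R, S] (EFin \o (eta^`())%classic).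
  exact: continuous_integrable.
have i1 : leb.-integrable `[0%R, S]
    (fun t => ((g0 x + running (w x) t) * (eta^`())%classic t)%:E).
  apply: (@integrable_ext _ _ _ (fun t => g0 x * (eta^`())%classic t +
    running (w x) t * (eta^`())%classic t)%R) => [t|]; first by rewrite mulrDl.
  by apply: integrable_add; [exact: integrable_scale|exact: integrable_mul_running].
have i2 : leb.-integrable `[0%R, S] (fun t => (w x t * eta t)%:E).
  apply: (@integrable_ext _ _ _ (fun t => eta t * w x t)%R) => [t|]; first exact: mulrC.
  exact: integrable_continuous_mul.
rewrite -(fineK (integrable_fin_num (measurable_itvR _) i1)).
rewrite -(fineK (integrable_fin_num (measurable_itvR _) i2)) -EFinN.
congr EFin; exact: (Rintegral_by_parts (g0 x) S0 iwx deta a0 bS etab).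
Qed.

Hypothesis muA : mu A < +oo.
Hypotheses (mg0 : measurable_fun setT g0) (sg0 : sq_integrable mu A g0).
Variables (S C : R).
Hypothesis S0 : (0 <= S)%R.
Hypothesis sw : forall x, sq_integrable leb `[0%R, S] (w x).
Hypothesis wC : \int[mu]_(x in A) \int[leb]_(t in `[0%R, S]) (w x t ^+ 2)%:E <= C%:E.

Let Y t x := (g0 x + running (w x) t)%R.

Lemma measurable_primitive_joint : measurable_fun [set: XR] (fun z => Y z.2 z.1).
Proof.
apply: measurable_funD; last exact: measurable_running_joint.
by apply: (measurableT_comp mg0); exact: measurable_fst.
Qed.

Lemma measurable_primitive t : measurable_fun setT (Y t).
Proof.
apply/measurable_EFinP.
apply: (@measurable_fun_section2 _ _ _ setT (fun z : XR => (Y z.2 z.1)%:E) t).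
apply/measurable_EFinP; exact: measurable_primitive_joint.
Qed.

Lemma primitive_increment s t : (0 <= s)%R -> (s <= t)%R -> (t <= S)%R ->
  \int[mu]_(x in A) ((Y t x - Y s x) ^+ 2)%:E <= ((t - s) * C)%:E.
Proof.
move=> s0 st tS; have ts : (0 <= t - s)%R by rewrite subr_ge0.
have mw2 : measurable_fun [set: XR] (fun z => (w z.1 z.2 ^+ 2)%:E).
  by apply/measurable_EFinP; exact: measurable_funX.
have w20 (z : XR) : 0 <= (w z.1 z.2 ^+ 2)%:E by rewrite lee_fin sqr_ge0.
apply: (@le_trans _ _ (\int[mu]_(x in A) ((t - s)%:E *
    \int[leb]_(r in `[0%R, S]) (w x r ^+ 2)%:E))).
  apply: le_integral_pointwise => x _.
  rewrite -(fineK (integrable_fin_num (measurable_itvR _) (sw x).2)) -EFinM lee_fin.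
  have -> : (Y t x - Y s x = running (w x) t - running (w x) s)%R by rewrite /Y; ring.
  exact: running_increment_sq.
rewrite ge0_integralZl; [|exact: mA| | |by rewrite lee_fin].
- by rewrite EFinM; apply: lee_wpmul2l => //; rewrite lee_fin.
- apply: measurable_funTS; exact: (measurable_integral_time (measurable_itvR _) mw2 w20).
- by move=> x _; apply: integral_ge0 => r _; exact: (w20 (x, r)).
Qed.

Lemma primitive_increment_abs s t : (0 <= s <= S)%R -> (0 <= t <= S)%R ->
  \int[mu]_(x in A) ((Y s x - Y t x) ^+ 2)%:E <= (`|s - t| * C)%:E.
Proof.
move=> /andP[s0 sS] /andP[t0 tS]; have [st|/ltW ts] := leP s t.
  rewrite distrC (ger0_norm (_ : 0 <= t - s)%R) ?subr_ge0//.
  apply: le_trans (primitive_increment s0 st tS).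
  by apply: le_integral_pointwise => x _; rewrite -sqrrN opprB.
by rewrite (ger0_norm (_ : 0 <= s - t)%R) ?subr_ge0//; exact: primitive_increment.
Qed.

Let C_ge0 : (0 <= C)%R.
Proof.
rewrite -lee_fin; apply: le_trans wC; apply: integral_ge0 => x _.
by apply: integral_ge0 => t _; rewrite lee_fin sqr_ge0.
Qed.

Lemma sq_integrable_primitive t : (0 <= t <= S)%R -> sq_integrable mu A (Y t).
Proof.
move=> tS.
have sd : sq_integrable mu A (fun x => Y t x - Y 0 x)%R.
  apply: sq_integrableP.
    by apply: measurable_funTS; apply: measurable_funB; exact: measurable_primitive.
  apply: le_lt_trans (primitive_increment_abs tS _) _; last by rewrite ltry.
  by rewrite lexx.
have := sq_integrable_lincomb mA 1 1 sg0 sd.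
rewrite (_ : (fun x => _) = Y t)//; apply/funext => x.
by rewrite /Y /running Rintegral_itv11; ring.
Qed.

Lemma primitive_holder s t : (0 <= s <= S)%R -> (0 <= t <= S)%R ->
  Lp_norm mu A 2%:E (Y s \- Y t)%R <= (Num.sqrt C * `|s - t| `^ 2^-1)%:E.
Proof.
move=> sS tS; rewrite Lp_norm2_le//.
rewrite exprMn sqr_sqrtr ?C_ge0// powR12_sqrt// sqr_sqrtr// mulrC.
exact: primitive_increment_abs.
Qed.

Lemma primitive_in_C0_L2 : in_C0_Lp mu A 2%:E S Y.
Proof.
apply: in_C0_Lp_modulus => t tS; first exact/in_L2P/sq_integrable_primitive.
move=> e e0; exists (e ^+ 2 / (C + 1))%R.
  by rewrite divr_gt0 ?exprn_gt0// ltr_wpDl ?C_ge0.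
move=> s sS st; rewrite Lp_norm2_le//; last exact: ltW.
apply: le_trans (primitive_increment_abs sS tS) _; rewrite lee_fin.
apply: le_trans (ler_wpM2r C_ge0 st) _.
rewrite -mulrA ler_piMr ?sqr_ge0// mulrC ler_pdivrMr ?mul1r ?lerDl// ltr_wpDl ?C_ge0//.
Qed.

End space_time_primitive.

(** * Integral of a relaxed function *)

Section relaxation_comparison.
Context {R : realType}.
Local Notation leb := (@lebesgue_measure R).
Variables (h eps t1 t2 : R).
Hypotheses (h0 : 0 < h) (eps0 : 0 < eps) (t10 : 0 <= t1) (t12 : t1 <= t2).
Local Notation rate := (rate h eps t1 t2).
Local Notation Al := (cumulated_rate h eps t1 t2).
Local Notation relaxation := (relaxation h eps t1 t2).
Variables (S : R) (t2S : t2 <= S) (hE : h = t2 - t1 + eps).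

Let S0 : 0 <= S. Proof. by rewrite (le_trans t10)// (le_trans t12). Qed.
Let mS : @measurable _ (measurableTypeR R) `[0, S]%classic.
Proof. exact: measurable_itvR. Qed.

Lemma relaxation_weight_bound s : 0 <= s <= S ->
  rate s * expR (Al s) <= rate_bound h eps * expR (Al S).
Proof.
move=> /andP[s0 sS]; apply: ler_pM; rewrite ?rate_ge0 ?expR_ge0 ?rate_le//.
by rewrite ler_expR; exact: cumulated_rate_nd.
Qed.

Let integrable_weight f : leb.-integrable `[0, S] (EFin \o f) ->
  leb.-integrable `[0, S] (fun s => (rate s * expR (Al s) * f s)%:E).
Proof.
apply: (@bounded_mul_integrable _ _ _ _ _ (rate_bound h eps * expR (Al S))).
  apply: measurable_funM; first by apply: measurable_rate; exact: measurable_itv.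
  by apply: measurable_expP; exact: measurable_itv.
move=> s sS; rewrite ger0_norm; first exact: relaxation_weight_bound.
by rewrite mulr_ge0 ?rate_ge0 ?expR_ge0.
Qed.

(** Exchange the order of integration: the weight that [phi s] then receives is the one
    of [rate_tail_le], the weight of [c] that of [Rintegral_expN_tail_before]. *)
Lemma relaxation_integral_le (c : R) (phi : R -> R) : 0 <= c ->
  (forall s, 0 <= phi s) -> leb.-integrable `[0, S] (EFin \o phi) ->
  \int[leb]_(t in `[0, S]) relaxation c phi t +
    \int[leb]_(s in `[0, S]) (\1_(`[t1, t2[) s * phi s) <=
  h * c + \int[leb]_(s in `[0, S]) phi s.
Proof.
move=> c0 phi0 iphi; pose q s := rate s * expR (Al s) * phi s.
have iq : leb.-integrable `[0, S] (EFin \o q) by exact: integrable_weight.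
have ie := integrable_expN h eps t1 t2 0 S.
have i1 : leb.-integrable `[0, S] (fun s => (\1_(`[t1, t2[) s * phi s)%:E).
  apply: (@bounded_mul_integrable _ _ _ _ _ 1) => //.
  by move=> r _; rewrite indicE ger0_norm ?lern1 ?leq_b1// ler0n.
have ier : leb.-integrable `[0, S] (fun t => (expR (- Al t) * running q t)%:E).
  apply: (@integrable_ext _ _ _ (fun t => running q t * expR (- Al t))) => [t|].
    exact: mulrC.
  exact: integrable_mul_running.
have -> : \int[leb]_(t in `[0, S]) relaxation c phi t =
    c * \int[leb]_(t in `[0, S]) expR (- Al t) +
    \int[leb]_(s in `[0, S]) (q s * \int[leb]_(t in `[s, S]) expR (- Al t)).
  transitivity (\int[leb]_(t in `[0, S])
      (c * expR (- Al t) + expR (- Al t) * running q t)).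
    apply: eq_Rintegral => t _; rewrite /relaxation -/(q) mulrDr mulrC.
    by [].
  rewrite RintegralD; [|exact: mS|exact: integrable_scale|exact: ier].
  rewrite RintegralZl; [|exact: mS|exact: ie].
  by congr (_ + _); exact: (Rintegral_triangle ie iq).
have H1 : c * \int[leb]_(t in `[0, S]) expR (- Al t) <= h * c.
  have := @Rintegral_expN_tail_before R h eps t1 t2 h0 eps0 t12 0 S t10 t2S hE.
  by rewrite cumulated_rate0// oppr0 expR0 mulr1 [h * c]mulrC => H; exact: ler_wpM2l.
have iqt : leb.-integrable `[0, S]
    (fun s => (q s * \int[leb]_(t in `[s, S]) expR (- Al t))%:E).
  apply: (@integrable_ext _ _ _
    (fun s => \int[leb]_(t in `[s, S]) expR (- Al t) * q s)) => [s|]; first exact: mulrC.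
  have E s : 0 <= s <= S -> \int[leb]_(t in `[s, S]) expR (- Al t) =
      running (fun t => expR (- Al t)) S - running (fun t => expR (- Al t)) s.
    by move=> /andP[s0 sS]; exact: Rintegral_running_tail.
  apply: (@eq_integrable _ _ _ leb _ _ (fun s => ((running (fun t => expR (- Al t)) S
    - running (fun t => expR (- Al t)) s) * q s)%:E)).
  - exact: mS.
  - by move=> s; rewrite inE/= in_itv/= => /E ->.
  - apply: (@integrable_ext _ _ _ (fun s => running (fun t => expR (- Al t)) S * q s
      - running (fun t => expR (- Al t)) s * q s)) => [s|]; first by rewrite mulrBl.
    by apply: integrable_sub; [exact: integrable_scale|exact: integrable_mul_running].
have H2 : \int[leb]_(s in `[0, S]) (q s * \int[leb]_(t in `[s, S]) expR (- Al t)) +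
    \int[leb]_(s in `[0, S]) (\1_(`[t1, t2[) s * phi s) <=
    \int[leb]_(s in `[0, S]) phi s.
  rewrite -RintegralD; [|exact: mS|exact: iqt|exact: i1].
  apply: le_Rintegral; [exact: mS|exact: integrable_add|exact: iphi|].
  move=> s /=; rewrite in_itv/= => /andP[s0 sS].
  have := @rate_tail_le R h eps t1 t2 h0 eps0 t12 s S sS t2S hE.
  move=> /(ler_wpM2r (phi0 s)); rewrite mulrBl mul1r -lerBrDr.
  by rewrite /q mulrAC.
by rewrite -addrA; exact: lerD.
Qed.

Lemma relaxation_cst (c : R) (phi : R -> R) t : 0 <= t ->
  (\forall s \ae leb, `[0, t]%classic s -> phi s = c) -> relaxation c phi t = c.
Proof.
move=> t0 phic; rewrite /relaxation.
have -> : \int[leb]_(s in `[0, t]) (rate s * expR (Al s) * phi s) =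
    \int[leb]_(s in `[0, t]) (rate s * expR (Al s) * c).
  congr fine; apply: ae_eq_integral_pointwise.
  by move: phic; apply: ae_lebesgue_mono => s H Ds /=; rewrite H.
rewrite RintegralZr; [|exact: measurable_itvR|].
  rewrite Rintegral_rate_expP// cumulated_rate0// expR0.
  rewrite mulrBl mul1r addrC subrK mulrA -expRD addNr expR0 mul1r//.
apply: (@integrable_ext _ _ _ (fun r => rate r * expR (1 * Al r))) => [r|].
  by rewrite mul1r.
exact: integrable_rate_exp.
Qed.

Lemma measurable_relaxation_joint {d} {T : measurableType d} (c : T -> R) (f : T -> R -> R) :
  measurable_fun setT c ->
  measurable_fun [set: T * measurableTypeR R] (fun z => f z.1 z.2) ->
  measurable_fun [set: T * measurableTypeR R] (fun z => relaxation (c z.1) (f z.1) z.2).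
Proof.
move=> mc mf; rewrite /relaxation; apply: measurable_funM.
  apply: (measurableT_comp (f := fun r => expR (- Al r))); last exact: measurable_snd.
  by apply: measurable_expN; exact: measurableT.
apply: measurable_funD.
  by apply: (measurableT_comp mc); exact: measurable_fst.
apply: (@measurable_running_joint _ _ _ (fun x s => rate s * expR (Al s) * f x s)).
apply: measurable_funM => //.
apply: (measurableT_comp (f := fun r => rate r * expR (Al r))); last exact: measurable_snd.
apply: measurable_funM; first by apply: measurable_rate; exact: measurableT.
by apply: measurable_expP; exact: measurableT.
Qed.

End relaxation_comparison.

(** * Null sets in space-time *)

Section null_sections.
Context {R : realType} {d : measure_display} {T : measurableType d}.
Variable mu : {sigma_finite_measure set T -> \bar R}.
Local Notation leb := (@lebesgue_measure R).
Local Notation TR := (T * measurableTypeR R)%type.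
Variables (A : set T) (B : set (measurableTypeR R)).
Hypotheses (mA : measurable A) (mB : measurable B).
Local Open Scope ereal_scope.

Lemma integral_eq0_ae d' (T' : measurableType d') (nu : {measure set T' -> \bar R})
    (D : set T') (f : T' -> \bar R) : measurable D -> measurable_fun D f ->
  (forall x, 0 <= f x) ->
  \int[nu]_(x in D) f x = 0 <-> (\forall x \ae nu, D x -> f x = 0).
Proof.
move=> mD mf f0; have := ae_eq_integral_abs nu mD mf.
suff -> : \int[nu]_(x in D) `|f x| = \int[nu]_(x in D) f x by [].
by apply: eq_integral => x _; rewrite gee0_abs.
Qed.

(** Both sides say that the integral of [f] over the product vanishes. *)
Lemma ae_section_swap (f : TR -> \bar R) : measurable_fun setT f ->
  (forall z, 0 <= f z) ->
  (\forall x \ae mu, A x -> \forall t \ae leb, B t -> f (x, t) = 0) <->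
  (\forall t \ae leb, B t -> \forall x \ae mu, A x -> f (x, t) = 0).
Proof.
move=> mf f0.
have E1 : (\forall x \ae mu, A x -> \forall t \ae leb, B t -> f (x, t) = 0) <->
    \int[mu]_(x in A) \int[leb]_(t in B) f (x, t) = 0.
  apply: iff_trans (_ : (\forall x \ae mu, A x -> \int[leb]_(t in B) f (x, t) = 0) <-> _).
    have E x : \int[leb]_(t in B) f (x, t) = 0 <-> (\forall t \ae leb, B t -> f (x, t) = 0).
      by apply: integral_eq0_ae => //; exact: measurable_fun_section1.
    by split; apply: filterS => x H Ax; apply/E; exact: H.
  apply: iff_sym; apply: integral_eq0_ae => //.
    by apply: measurable_funTS; exact: measurable_integral_time.
  by move=> x; apply: integral_ge0.
have E2 : (\forall t \ae leb, B t -> \forall x \ae mu, A x -> f (x, t) = 0) <->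
    \int[leb]_(t in B) \int[mu]_(x in A) f (x, t) = 0.
  apply: iff_trans (_ : (\forall t \ae leb, B t -> \int[mu]_(x in A) f (x, t) = 0) <-> _).
    have E t : \int[mu]_(x in A) f (x, t) = 0 <-> (\forall x \ae mu, A x -> f (x, t) = 0).
      by apply: integral_eq0_ae => //; exact: measurable_fun_section2.
    by split; apply: ae_lebesgue_mono => t H Bt; apply/E; exact: H.
  apply: iff_sym; apply: integral_eq0_ae => //.
    by apply: measurable_funTS; exact: (measurable_integral_space mu mA mf f0).
  by move=> x; apply: integral_ge0.
apply: iff_trans E1 _; apply: iff_trans (iff_sym E2).
by rewrite -(tonelli_rect1 mu mA mB mf f0) -(tonelli_rect2 mu mA mB mf f0).
Qed.

Lemma ae_section_swap_eq (f g : TR -> R) : measurable_fun setT f ->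
  measurable_fun setT g ->
  (\forall x \ae mu, A x -> \forall t \ae leb, B t -> f (x, t) = g (x, t)) <->
  (\forall t \ae leb, B t -> \forall x \ae mu, A x -> f (x, t) = g (x, t)).
Proof.
move=> mf mg; pose h (z : TR) : \bar R := `|f z - g z|%:E.
have mh : measurable_fun setT h.
  by apply/measurable_EFinP; apply: measurableT_comp => //; exact: measurable_funB.
have h0 z : 0 <= h z by rewrite /h lee_fin.
have hE z : f z = g z <-> h z = 0.
  split; first by rewrite /h => ->; rewrite subrr normr0.
  by move=> [] /eqP; rewrite normr_eq0 subr_eq0 => /eqP.
have [swap1 swap2] := ae_section_swap mh h0; split.
- move=> H; have {H} : \forall x \ae mu, A x -> \forall t \ae leb, B t -> h (x, t) = 0.
    move: H; apply: filterS => x + Ax => /(_ Ax); apply: ae_lebesgue_mono => t H Bt.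
    exact/hE/H.
  move/swap1; apply: ae_lebesgue_mono => t + Bt => /(_ Bt).
  by apply: filterS => x H Ax; exact/hE/H.
- move=> H; have {H} : \forall t \ae leb, B t -> \forall x \ae mu, A x -> h (x, t) = 0.
    move: H; apply: ae_lebesgue_mono => t + Bt => /(_ Bt).
    by apply: filterS => x H Ax; exact/hE/H.
  move/swap2; apply: filterS => x + Ax => /(_ Ax); apply: ae_lebesgue_mono => t H Bt.
  exact/hE/H.
Qed.

End null_sections.

Section C0_bounded.
Context {R : realType} {d : measure_display} {X : borelMetricType R d}.
Variable mu : {measure set X -> \bar R}.
Variables (A : set X) (mA : measurable A) (S : R).
Local Open Scope ereal_scope.

(** Near each time the norm exceeds that at this time by at most 1;
    compactness of the time interval does the rest. *)
Lemma in_C0_L2_bounded (V : R -> X -> R) : in_C0_Lp mu A 2%:E S V ->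
  exists M : R, forall t : R, (0 <= t <= S)%R ->
    \int[mu]_(x in A) (V t x ^+ 2)%:E <= M%:E.
Proof.
move=> VC; have VL t : (0 <= t <= S)%R -> sq_integrable mu A (V t).
  by move=> tS; have [/(in_L2P mu mA)] := VC t tS.
have := @segment_compact R 0%R S; move=> /compact_near_coveringP/(_ nat \oo
  (fun n t => (0 <= t <= S)%R -> \int[mu]_(x in A) (V t x ^+ 2)%:E <= n%:R%:E) _) [].
  move=> t0 /=; rewrite in_itv/= => t0S.
  have [del del0 H] := in_C0_Lp_close VC t0S ltr01.
  set q := \int[mu]_(x in A) (V t0 x ^+ 2)%:E.
  have qfin : q = (fine q)%:E.
    by rewrite fineK//; exact: (integrable_fin_num mA (VL t0 t0S).2).
  exists (ball t0 del, [set n | 2 * 1 + 2 * fine q <= n%:R :> R]%R).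
    split; first exact: nbhsx_ballx.
    exact: nbhs_infty_ger.
  move=> [t n] [/= + Hn] tS; rewrite /ball/= distrC => tt0.
  have := H t tS (ltW tt0); rewrite Lp_norm2_le// expr1n => Ht.
  have sd := sq_integrable_sub mA (VL t tS) (VL t0 t0S).
  apply: (@le_trans _ _ (\int[mu]_(x in A) (2%:E * ((V t \- V t0)%R x ^+ 2)%:E +
      2%:E * (V t0 x ^+ 2)%:E))).
    apply: le_integral_pointwise => x _; rewrite -!EFinM -EFinD lee_fin /=.
    have E (a b : R) : (2 * (a - b) ^+ 2 + 2 * b ^+ 2 - a ^+ 2 = (a - 2 * b) ^+ 2)%R by ring.
    by rewrite -subr_ge0 [leRHS]E sqr_ge0.
  have md : measurable_fun A (fun x => ((V t \- V t0)%R x ^+ 2)%:E).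
    by apply/measurable_EFinP/measurable_funX; exact: sd.1.
  have m0 : measurable_fun A (fun x => (V t0 x ^+ 2)%:E).
    by apply/measurable_EFinP/measurable_funX; exact: (VL t0 t0S).1.
  rewrite ge0_integralD; [|exact: mA|by move=> x _; rewrite -EFinM lee_fin mulr_ge0 ?sqr_ge0
    |exact: measurable_funeM|by move=> x _; rewrite -EFinM lee_fin mulr_ge0 ?sqr_ge0
    |exact: measurable_funeM].
  rewrite !ge0_integralZl//; try by move=> x _; rewrite lee_fin sqr_ge0.
  apply: (@le_trans _ _ (2%:E * 1%:E + 2%:E * (fine q)%:E)); last by rewrite -!EFinM -EFinD lee_fin.
  by rewrite -/q {1}qfin; apply: leeD => //; apply: lee_wpmul2l.
move=> N _ /(_ N (leqnn N)) H; by exists N%:R => t tS; apply: H.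
Qed.

End C0_bounded.

(** * The comparison map *)

Section comparison_map.
Context {R : realType} {d : measure_display} {X : borelMetricType R d}.
Variable mu : {sigma_finite_measure set X -> \bar R}.
Variables (A : set X) (mA : measurable A) (muA : (mu A < +oo)%E).
Local Notation leb := (@lebesgue_measure R).
Local Notation XR := (X * measurableTypeR R)%type.
Local Open Scope ereal_scope.

Variables (S : R) (S_gt0 : (0 < S)%R) (f : X -> R -> R) (g0 : X -> R).
Hypothesis mf : measurable_fun [set: XR] (fun z => f z.1 z.2).
Hypothesis sf : forall x, sq_integrable leb `[0%R, S] (f x).
Hypothesis ff : \int[mu]_(x in A) \int[leb]_(t in `[0%R, S]) (f x t ^+ 2)%:E < +oo.
Hypotheses (mg0 : measurable_fun setT g0) (sg0 : sq_integrable mu A g0).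

Variables (h eps t1 t2 : R).
Hypotheses (h0 : (0 < h)%R) (eps0 : (0 < eps)%R) (t10 : (0 <= t1)%R) (t12 : (t1 <= t2)%R).
Local Notation rate := (rate h eps t1 t2).

(** Every fibre [f x] is relaxed separately, starting from the initial value
    [g0 x]. *)
Definition comparison (x : X) (t : R) : R := relaxation h eps t1 t2 (g0 x) (f x) t.
Definition comparison_dt (x : X) (t : R) : R := (rate t * (f x t - comparison x t))%R.

Let S0 : (0 <= S)%R. Proof. exact: ltW. Qed.
Let mS : @measurable _ (measurableTypeR R) `[0%R, S]%classic.
Proof. exact: measurable_itvR. Qed.
Let finS : leb (`[0%R, S]%classic : set (measurableTypeR R)) < +oo.
Proof. exact: lebesgue_itv_lty. Qed.
Let lebS : leb (`[0%R, S]%classic : set (measurableTypeR R)) = S%:E.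
Proof. by have := @lebesgue_measure_itv R `[0%R, S]; rewrite /= lte_fin S_gt0 -EFinB subr0. Qed.
Let fi x : leb.-integrable `[0%R, S] (EFin \o f x).
Proof. exact: (sq_integrable_integrable mS finS (sf x)). Qed.

Lemma measurable_comparison : measurable_fun [set: XR] (fun z => comparison z.1 z.2).
Proof. exact: measurable_relaxation_joint. Qed.

Lemma measurable_comparison_dt : measurable_fun [set: XR] (fun z => comparison_dt z.1 z.2).
Proof.
apply: measurable_funM; last by apply: measurable_funB => //; exact: measurable_comparison.
by apply: (measurableT_comp (f := rate)); [apply: measurable_rate|exact: measurable_snd].
Qed.

Lemma comparison_ode x t : (0 <= t)%R -> (t <= S)%R ->
  comparison x t = (g0 x + running (comparison_dt x) t)%R.
Proof. by move=> t0 tS; exact: (relaxation_ode h0 eps0 t10 t12 S0 (g0 x) (fi x)). Qed.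

Lemma sq_integrable_comparison x : sq_integrable leb `[0%R, S] (comparison x).
Proof.
apply: (@sq_integrable_bounded _ _ _ leb _ mS finS _
  (`|g0 x| + rate_bound h eps * \int[leb]_(s in `[0%R, S]) `|f x s|)%R).
  exact: (measurable_relaxation t1 t2 h0 eps0 S0 (g0 x) (fi x)).
by move=> t; rewrite /= in_itv/= => /andP[t0 tS]; apply: relaxation_bound.
Qed.

Lemma sq_integrable_comparison_dt x : sq_integrable leb `[0%R, S] (comparison_dt x).
Proof.
have sd := sq_integrable_sub mS (sf x) (sq_integrable_comparison x).
have mr : measurable_fun `[0%R, S] rate by apply: measurable_rate; exact: measurable_itv.
split; first by apply: measurable_funM => //; exact: sd.1.
apply: (@integrable_ext _ _ _ (fun t => rate t ^+ 2 * (f x t - comparison x t) ^+ 2)%R) => [t|].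
  by rewrite -exprMn.
apply: (@bounded_mul_integrable _ _ _ _ _ (rate_bound h eps ^+ 2)).
- exact: measurable_funX.
- move=> r _; rewrite ger0_norm ?sqr_ge0// lerXn2r ?nnegrE ?rate_ge0 ?rate_le//.
  by rewrite addr_ge0// invr_ge0 ltW.
- exact: sd.2.
Qed.

Definition energy x : R := (\int[leb]_(t in `[0%R, S]) (f x t ^+ 2))%R.

Lemma energyE x : (energy x)%:E = \int[leb]_(t in `[0%R, S]) (f x t ^+ 2)%:E.
Proof. by rewrite fineK//; exact: (integrable_fin_num mS (sf x).2). Qed.

Lemma energy_ge0 x : (0 <= energy x)%R.
Proof. by apply: Rintegral_ge0 => t _; exact: sqr_ge0. Qed.

(** [relaxation_bound] and the Cauchy-Schwarz inequality. *)
Lemma comparison_sq_bound : exists2 K : R, (0 <= K)%R & forall x t, (0 <= t <= S)%R ->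
  (comparison x t ^+ 2 <= K * (g0 x ^+ 2 + energy x))%R.
Proof.
set rb := rate_bound h eps.
have rb0 : (0 <= rb)%R by rewrite addr_ge0// invr_ge0 ltW.
exists (2 + 2 * (rb ^+ 2 * S))%R.
  by rewrite addr_ge0// mulr_ge0// mulr_ge0// sqr_ge0.
move=> x t /andP[t0 tS]; set J := (\int[leb]_(s in `[0%R, S]) `|f x s|)%R.
have vJ : (`|comparison x t| <= `|g0 x| + rb * J)%R by apply: relaxation_bound.
have J2 : (J ^+ 2 <= S * energy x)%R.
  have sn : sq_integrable leb `[0%R, S] (fun s => `|f x s|)%R.
    split; first by apply: measurableT_comp => //; exact: (sf x).1.
    by apply: integrable_ext (sf x).2 => s; rewrite real_normK ?num_real.
  have := running_increment_sq sn (lexx 0%R) S0 (lexx S).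
  rewrite {2}/running Rintegral_itv11 !subr0 -/J => H; apply: le_trans H _.
  rewrite le_eqVlt; apply/orP; left; apply/eqP; congr (_ * _)%R.
  by apply: eq_Rintegral => s _; rewrite real_normK ?num_real.
have J0 : (0 <= J)%R by exact: Rintegral_ge0.
have v2 : (comparison x t ^+ 2 <= (`|g0 x| + rb * J) ^+ 2)%R.
  rewrite -real_normK ?num_real// lerXn2r ?nnegrE//.
  by rewrite addr_ge0// mulr_ge0.
apply: le_trans v2 _; have e0 := energy_ge0 x.
have g2 : (`|g0 x| ^+ 2 = g0 x ^+ 2)%R by rewrite real_normK ?num_real.
have rJ : ((rb * J) ^+ 2 <= rb ^+ 2 * (S * energy x))%R.
  by rewrite exprMn ler_wpM2l ?sqr_ge0.
have rS : (0 <= rb ^+ 2 * S)%R by rewrite mulr_ge0// sqr_ge0.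
have rSg : (0 <= rb ^+ 2 * S * g0 x ^+ 2)%R by rewrite mulr_ge0// sqr_ge0.
have sq : ((`|g0 x| + rb * J) ^+ 2 <= 2 * `|g0 x| ^+ 2 + 2 * (rb * J) ^+ 2)%R.
  rewrite -subr_ge0 (_ : (_ - _)%R = ((`|g0 x| - rb * J) ^+ 2)%R) ?sqr_ge0//; by ring.
apply: le_trans sq _; rewrite g2 -subr_ge0.
rewrite (_ : (_ - _)%R = (2 * (rb ^+ 2 * (S * energy x) - (rb * J) ^+ 2) +
  2 * energy x + 2 * (rb ^+ 2 * S * g0 x ^+ 2))%R); last by ring.
by rewrite !addr_ge0// mulr_ge0// subr_ge0.
Qed.

Let Sg : exists2 K : R, (0 <= K)%R & forall x,
  \int[leb]_(t in `[0%R, S]) (comparison x t ^+ 2)%:E <= (K * (g0 x ^+ 2 + energy x))%:E.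
Proof.
have [K K0 HK] := comparison_sq_bound; exists (K * S)%R; first by rewrite mulr_ge0.
move=> x; apply: (@le_trans _ _ (\int[leb]_(t in `[0%R, S]) (K * (g0 x ^+ 2 + energy x))%:E)).
  by apply: le_integral_pointwise => t; rewrite /= in_itv/= => tS; rewrite lee_fin; exact: HK.
by rewrite (integral_cst leb mS) [X in _ * X]lebS -EFinM lee_fin mulrAC.
Qed.

Let datum_energy (K : R) : (0 <= K)%R ->
  \int[mu]_(x in A) (K * (g0 x ^+ 2 + energy x))%:E < +oo.
Proof.
move=> K0.
have mg2 : measurable_fun A (fun x => (g0 x ^+ 2)%:E).
  by apply/measurable_EFinP/measurable_funX; exact: sg0.1.
have me : measurable_fun A (fun x => (energy x)%:E).
  apply/measurable_EFinP; apply: measurable_funTS.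
  by apply: (measurable_Rintegral_time mS (f := fun x t => f x t ^+ 2)%R); exact: measurable_funX.
have -> : (fun x => (K * (g0 x ^+ 2 + energy x))%:E) =
    (fun x => K%:E * ((g0 x ^+ 2)%:E + (energy x)%:E)).
  by apply/funext => x; rewrite EFinM EFinD.
rewrite ge0_integralZl; [|exact: mA|exact: emeasurable_funD
  |by move=> x _; rewrite -EFinD lee_fin addr_ge0 ?sqr_ge0 ?energy_ge0|by rewrite lee_fin].
rewrite ge0_integralD; [|exact: mA|by move=> x _; rewrite lee_fin sqr_ge0|exact: mg2
  |by move=> x _; rewrite lee_fin energy_ge0|exact: me].
apply: lte_mul_pinfty => //; apply: lte_add_pinfty; first exact: (integrable_lty mA sg0.2).
by under eq_integral do rewrite energyE.
Qed.

Lemma comparison_energy_finite :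
  \int[mu]_(x in A) \int[leb]_(t in `[0%R, S]) (comparison x t ^+ 2)%:E < +oo.
Proof.
have [K K0 HK] := Sg; apply: le_lt_trans (datum_energy K0).
by apply: le_integral_pointwise => x _; exact: HK.
Qed.

Lemma comparison_dt_energy_finite :
  \int[mu]_(x in A) \int[leb]_(t in `[0%R, S]) (comparison_dt x t ^+ 2)%:E < +oo.
Proof.
have [K K0 HK] := Sg; set rb := rate_bound h eps.
have rb0 : (0 <= rb)%R by rewrite addr_ge0// invr_ge0 ltW.
have c0 : (0 <= rb ^+ 2 * 2)%R by rewrite mulr_ge0// sqr_ge0.
apply: le_lt_trans (datum_energy (_ : 0 <= rb ^+ 2 * 2 * (1 + K))%R); last first.
  by rewrite mulr_ge0// addr_ge0.
apply: le_integral_pointwise => x _.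
have i1 := (sf x).2; have i2 := (sq_integrable_comparison x).2.
have m1 : measurable_fun `[0%R, S] (fun t => (f x t ^+ 2)%:E) by have /integrableP[] := i1.
have m2 : measurable_fun `[0%R, S] (fun t => (comparison x t ^+ 2)%:E) by have /integrableP[] := i2.
apply: (@le_trans _ _ (\int[leb]_(t in `[0%R, S]) ((rb ^+ 2 * 2)%:E *
    ((f x t ^+ 2)%:E + (comparison x t ^+ 2)%:E)))).
  apply: le_integral_pointwise => t _; rewrite -EFinD -EFinM lee_fin /comparison_dt exprMn -[leRHS]mulrA.
  apply: ler_pM; [exact: sqr_ge0|exact: sqr_ge0| |].
    by rewrite lerXn2r ?nnegrE ?rate_ge0 ?rate_le.
  rewrite -subr_ge0 (_ : (_ - _)%R = ((f x t + comparison x t) ^+ 2)%R) ?sqr_ge0//; by ring.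
rewrite ge0_integralZl; [|exact: mS|exact: emeasurable_funD
  |by move=> t _; rewrite -EFinD lee_fin addr_ge0 ?sqr_ge0|by rewrite lee_fin].
rewrite ge0_integralD; [|exact: mS|by move=> t _; rewrite lee_fin sqr_ge0|exact: m1
  |by move=> t _; rewrite lee_fin sqr_ge0|exact: m2].
rewrite -energyE -mulrA [leRHS]EFinM; apply: lee_wpmul2l; first by rewrite lee_fin.
rewrite mulrDl mul1r EFinD; apply: leeD; last exact: HK.
by rewrite lee_fin lerDr sqr_ge0.
Qed.

Lemma comparison_integrable :
  (mu \x leb).-integrable (A `*` time_itv S%:E) (fun p => (comparison p.1 p.2)%:E).
Proof.
have mT : @measurable _ (measurableTypeR R) (time_itv S%:E) by exact: measurable_time_itv.
have muT : leb (time_itv S%:E) < +oo.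
  apply: le_lt_trans finS; apply: le_measure; rewrite ?inE//.
  by rewrite time_itvE => t /=; rewrite !in_itv/= => /andP[/ltW -> /ltW ->].
have mAT : measurable (A `*` (time_itv S%:E : set (measurableTypeR R))) by exact: measurableX.
apply: (@sq_integrable_integrable _ _ _ (mu \x leb) _ mAT _ (fun p : XR => comparison p.1 p.2)).
  by rewrite [X in X < _](product_measure1E mu leb mA mT) lte_mul_pinfty// ge0_fin_numE.
apply: sq_integrableP; first by apply: measurable_funTS; exact: measurable_comparison.
have mv2 : measurable_fun [set: XR] (fun z => (comparison z.1 z.2 ^+ 2)%:E).
  by apply/measurable_EFinP/measurable_funX; exact: measurable_comparison.
rewrite (tonelli_rect1 mu mA mT mv2); last by move=> z; rewrite lee_fin sqr_ge0.
apply: le_lt_trans comparison_energy_finite; apply: le_integral_pointwise => x _.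
apply: ge0_subset_integral => //.
- have := (sq_integrable_comparison x).2 => /integrableP[+ _]; exact.
- by move=> t _; rewrite lee_fin sqr_ge0.
- by rewrite time_itvE => t /=; rewrite !in_itv/= => /andP[/ltW -> /ltW ->].
Qed.

End comparison_map.

(** * The variational inequality tested with the comparison map *)

Section lebesgue_endpoints.
Context {R : realType}.
Local Notation leb := (@lebesgue_measure R).
Local Open Scope ereal_scope.

Lemma ae_lebesgue_and (P Q : R -> Prop) : (\forall t \ae leb, P t) ->
  (\forall t \ae leb, Q t) -> \forall t \ae leb, P t /\ Q t.
Proof.
move=> HP HQ; have := negligibleU HP HQ; apply: negligibleS => t /=.
by move=> /not_andP.
Qed.

Lemma ae_lebesgueT (P : R -> Prop) : (forall t, P t) -> \forall t \ae leb, P t.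
Proof. by move=> HP; exists set0; split => // t /=; exact. Qed.

Lemma ae_neq (a : R) : \forall t \ae leb, t != a.
Proof.
exists [set a]; split; [exact: measurable_set1|exact: lebesgue_measure_set1|].
by move=> t /= /negP/negPn/eqP.
Qed.

Lemma ae_time_itv_closed (S : R) (P : R -> Prop) :
  (\forall t \ae leb, time_itv S%:E t -> P t) ->
  \forall t \ae leb, `[0%R, S]%classic t -> P t.
Proof.
move=> HP; have := ae_lebesgue_and HP (ae_lebesgue_and (ae_neq 0%R) (ae_neq S)).
apply: ae_lebesgue_mono => t [Pt [tN0 tNS]]; rewrite /= in_itv/= => /andP[t0 tS].
by apply: Pt; rewrite time_itvE/= in_itv/= !lt_neqAle eq_sym tN0 t0 tNS tS.
Qed.

Lemma integral_time_itv (S : R) (F : R -> \bar R) :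
  \int[leb]_(t in time_itv S%:E) F t = \int[leb]_(t in `[0%R, S]) F t.
Proof.
rewrite [LHS]integral_mkcond [RHS]integral_mkcond; apply: ae_eq_integral_pointwise.
have : \forall t \ae leb, `[0%R, S]%classic t -> time_itv S%:E t.
  by apply: ae_time_itv_closed; exact: ae_lebesgueT.
apply: ae_lebesgue_mono => t H _; rewrite !patchE.
have [/set_mem tS|tS] := boolP (t \in time_itv S%:E).
  rewrite mem_set//; move: tS; rewrite time_itvE /= !in_itv/= => /andP[t0 tS].
  by rewrite !ltW.
rewrite memNset// => /H tS'; by move: tS; rewrite mem_set.
Qed.

End lebesgue_endpoints.

Section core.
Context {R : realType} {d : measure_display} {X : borelMetricType R d}.
Variable mu : {sigma_finite_measure set X -> \bar R}.
Hypothesis mu_doubling : doubling mu.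
Variables (Omega A : set X) (mOmega : measurable Omega) (oA : open A) (bA : metric_bounded A).
Local Notation leb := (@lebesgue_measure R).
Local Notation XR := (X * measurableTypeR R)%type.
Local Notation TV := (total_var mu A).
Local Open Scope ereal_scope.

Variables (S : R) (S_gt0 : (0 < S)%R) (u f : X -> R -> R) (u0 g0 : X -> R).
Hypothesis mf : measurable_fun [set: XR] (fun z => f z.1 z.2).
Hypothesis sf : forall x, sq_integrable leb `[0%R, S] (f x).
Hypothesis ff : \int[mu]_(x in A) \int[leb]_(t in `[0%R, S]) (f x t ^+ 2)%:E < +oo.
Hypotheses (mg0 : measurable_fun setT g0) (sg0 : sq_integrable mu A g0).
Hypothesis fu : forall t, time_itv S%:E t -> \forall x \ae mu, A x -> f x t = u x t.
Hypothesis gu : forall x, A x -> g0 x = u0 x.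
Hypothesis u0_BV : BV mu A u0.

Let mA : measurable A. Proof. exact: measurable_open. Qed.
Let muA : mu A < +oo. Proof. exact: metric_bounded_lty. Qed.
Let S0 : (0 <= S)%R. Proof. exact: ltW. Qed.
Let mS : @measurable _ (measurableTypeR R) `[0%R, S]%classic.
Proof. exact: measurable_itvR. Qed.
Let finS : leb (`[0%R, S]%classic : set (measurableTypeR R)) < +oo.
Proof. exact: lebesgue_itv_lty. Qed.
Let fi x : leb.-integrable `[0%R, S] (EFin \o f x).
Proof. exact: (sq_integrable_integrable mS finS (sf x)). Qed.

Variable U : R -> X -> R.
Hypothesis hu : L1w_BV_datum mu Omega A u0 S u.
Hypothesis hU : C0_representative mu A 2%:E S u U.

Let clamp (t : R) : R := Num.min (Num.max t 0%R) S.

Let clamp_itv t : (0 <= clamp t <= S)%R.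
Proof. by rewrite le_min ge_min lexx orbT andbT le_max lexx orbT. Qed.

Let clampE t : (0 <= t <= S)%R -> clamp t = t.
Proof. by move=> /andP[t0 tS]; rewrite /clamp (max_idPl t0) (min_idPl tS). Qed.

Let clamp_lip s t : (`|clamp s - clamp t| <= `|s - t|)%R.
Proof.
have := ler_norm (s - t); have := ler_norm (t - s); rewrite distrC ler_norml /clamp => ? ?.
by apply/andP; split; rewrite !minElt !maxElt; do ! case: ifPn; rewrite -?leNgt; lra.
Qed.

(** The continuous representative of the solution, made constant outside of
    [0, S] and zero outside of [A], so that it is continuous on the whole line and
    measurable on the whole space. *)
Definition clamped_rep t : X -> R := U (clamp t) \_ A.
Local Notation U' := clamped_rep.

Lemma measurable_clamped_rep t : measurable_fun setT (U' t).
Proof.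
apply/(measurable_restrictT _ mA).1.
by have [/(in_L2P mu mA)[]] := hU.1 _ (clamp_itv t).
Qed.

Lemma clamped_rep_L1_continuous (t e : R) : (0 < e)%R ->
  exists2 del : R, (0 < del)%R &
  forall s, (`|s - t| <= del)%R -> \int[mu]_(x in A) `|U' s x - U' t x|%:E <= e%:E.
Proof.
move=> e0; have [del del0 H] := in_C0_L2_L1_close mA muA hU.1 (clamp_itv t) e0.
exists del => // s st.
have := H _ (clamp_itv s) (le_trans (clamp_lip s t) st); apply: le_trans.
by apply: le_integral_pointwise => x Ax; rewrite /clamped_rep !patchE mem_set.
Qed.

Lemma clamped_rep_ae : \forall t \ae leb, `[0%R, S]%classic t ->
  \forall x \ae mu, A x -> f x t = U' t x.
Proof.
apply: ae_time_itv_closed; move: hU.2; apply: ae_lebesgue_mono => t H tS.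
have := fu tS; move: (H tS); apply: filterS2 => x uU fu' Ax.
rewrite fu'// uU// /clamped_rep patchE mem_set// clampE//.
by move: tS; rewrite time_itvE/= in_itv/= => /andP[/ltW -> /ltW ->].
Qed.

Lemma clamped_rep_tv : \forall t \ae leb, `[0%R, S]%classic t -> TV (u^~ t) = TV (U' t).
Proof.
apply: ae_time_itv_closed; move: hU.2; apply: ae_lebesgue_mono => t H tS.
apply: eq_ae_total_var; move: (H tS); apply: filterS => x uU Ax.
rewrite uU// /clamped_rep patchE mem_set// clampE//.
by move: tS; rewrite time_itvE/= in_itv/= => /andP[/ltW -> /ltW ->].
Qed.

Lemma integral_clamped_tv (D : set R) : D `<=` `[0%R, S]%classic ->
  \int[leb]_(t in D) TV (u^~ t) = \int[leb]_(t in D) TV (U' t).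
Proof.
move=> DS; apply: ae_eq_integral_pointwise; have := clamped_rep_tv.
by apply: ae_lebesgue_mono => t H /DS/H.
Qed.

Lemma clamped_tv_finite : \int[leb]_(s in `[0%R, S]) TV (U' s) < +oo.
Proof.
have [[_ _ _ fin] _] := hu.
by rewrite -integral_clamped_tv// -integral_time_itv.
Qed.

Let mU' := measurable_clamped_rep.
Let cU' := clamped_rep_L1_continuous.
Let Fr := tv_time mu A U'.
Let iFr : leb.-integrable `[0%R, S] (EFin \o Fr).
Proof. exact: (integrable_tv_time mu_doubling oA bA mU' cU' clamped_tv_finite). Qed.

Variables (h eps t1 t2 : R).
Hypotheses (h0 : (0 < h)%R) (eps0 : (0 < eps)%R) (t10 : (0 <= t1)%R) (t12 : (t1 <= t2)%R).
Hypotheses (t2S : (t2 <= S)%R) (hE : h = (t2 - t1 + eps)%R).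
Local Notation rate := (rate h eps t1 t2).
Local Notation Al := (cumulated_rate h eps t1 t2).
Local Notation v := (comparison f g0 h eps t1 t2).
Local Notation dv := (comparison_dt f g0 h eps t1 t2).

Let F0 := fine (TV u0).
Let F0E : TV g0 = F0%:E.
Proof.
rewrite /F0 fineK; last by rewrite ge0_fin_numE ?total_var_ge0//; exact: u0_BV.2.
by apply: eq_ae_total_var; near=> x => /gu.
Unshelve. all: by end_near. Qed.

(** The total variation of the solution, relaxed in the same way as the
    solution itself. *)
Definition tv_majorant : R -> R := relaxation h eps t1 t2 F0 Fr.

(** Jensen's inequality, as the comparison map is an integral average of the past
    of the solution. *)
Lemma total_var_comparison t : (0 <= t <= S)%R -> TV (v^~ t) <= (tv_majorant t)%:E.
Proof.
move=> /andP[t0 tS]; pose k s := (rate s * expR (Al s))%R.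
have mk : measurable_fun setT k.
  apply: measurable_funM; first by apply: measurable_rate; exact: measurableT.
  by apply: measurable_expP; exact: measurableT.
have k0 s : (0 <= k s)%R by rewrite mulr_ge0 ?rate_ge0 ?expR_ge0.
have kM s : (0 <= s <= S)%R -> (k s <= rate_bound h eps * expR (Al S))%R.
  exact: relaxation_weight_bound.
have gF : TV g0 <= F0%:E by rewrite F0E.
have H := total_var_time_integral mu_doubling oA bA mU' cU' mk k0 kM clamped_tv_finite
  mf fi clamped_rep_ae mg0 gF t0 tS.
have ms : measurable_fun A (fun x => g0 x + \int[leb]_(r in `[0%R, t]) (k r * f x r))%R.
  apply: measurable_funTS; apply: measurable_funD => //.
  exact: measurable_weighted_integral.
have := total_var_lincomb mu_doubling oA bA (expR_ge0 (- Al t)) (lexx 0%R) ms ms H H.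
rewrite (_ : (fun x => _) = v^~ t); last first.
  by apply/funext => x; rewrite mul0r addr0.
by rewrite mul0r addr0.
Qed.

Lemma integrable_tv_majorant : leb.-integrable `[0%R, S] (EFin \o tv_majorant).
Proof. exact: integrable_relaxation. Qed.

Let C := fine (\int[mu]_(x in A) \int[leb]_(t in `[0%R, S]) (dv x t ^+ 2)%:E).

Let dvC : \int[mu]_(x in A) \int[leb]_(t in `[0%R, S]) (dv x t ^+ 2)%:E <= C%:E.
Proof.
rewrite /C fineK// ge0_fin_numE.
  exact: comparison_dt_energy_finite.
by apply: integral_ge0 => x _; apply: integral_ge0 => t _; rewrite lee_fin sqr_ge0.
Qed.

Let mdv : measurable_fun [set: XR] (fun z => dv z.1 z.2).
Proof. exact: measurable_comparison_dt. Qed.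

Let sdv x : sq_integrable leb `[0%R, S] (dv x).
Proof. exact: sq_integrable_comparison_dt. Qed.

Let V t x := (g0 x + running (dv x) t)%R.

Let vV x t : (0 <= t <= S)%R -> v x t = V t x.
Proof. by move=> /andP[t0 tS]; exact: (comparison_ode S_gt0). Qed.

Let sub_itv t : time_itv S%:E t -> (0 <= t <= S)%R.
Proof. by rewrite time_itvE/= in_itv/= => /andP[/ltW -> /ltW ->]. Qed.

Let sq_v t : (0 <= t <= S)%R -> sq_integrable mu A (v^~ t).
Proof.
move=> tS; have := sq_integrable_primitive mA mdv mg0 sg0 S0 sdv dvC tS.
rewrite (_ : (fun x => _) = v^~ t)//; apply/funext => x.
by rewrite (vV x tS).
Qed.

(** Where almost all values of [f x] equal [g0 x], relaxation changes nothing.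
    Almost every boundary point is such a point by [ae_section_swap_eq]. *)
Lemma comparison_boundary : \forall x \ae mu, (A `\` Omega) x ->
  forall t, (0 <= t <= S)%R -> v x t = u0 x.
Proof.
have mAO : measurable (A `\` Omega) by exact: measurableD.
have mf' : measurable_fun setT (fun z : XR => f z.1 z.2) by [].
have mg' : measurable_fun setT (fun z : XR => g0 z.1).
  by apply: (measurableT_comp mg0); exact: measurable_fst.
have [_ swap] := ae_section_swap_eq mu mAO (measurable_time_itv S%:E) mf' mg'.
have : \forall t \ae leb, time_itv S%:E t -> \forall x \ae mu, (A `\` Omega) x ->
    f x t = g0 x.
  move: hu.2; apply: ae_lebesgue_mono => t H tS; have [_ ub] := H tS.
  move: (fu tS) ub; apply: filterS2 => x fx ux xAO.
  by rewrite fx ?ux ?gu//; case: xAO.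
move/swap; apply: filterS => x H xAO t /andP[t0 tS].
rewrite -gu; last by case: xAO.
apply: relaxation_cst => //.
have := ae_time_itv_closed (H xAO); apply: ae_lebesgue_mono => s Hs /=.
rewrite in_itv/= => /andP[s0 st]; apply: Hs; rewrite /= in_itv/= s0.
exact: le_trans st tS.
Qed.

Lemma comparison_admissible : L1w_BV_datum mu Omega A u0 S v.
Proof.
have BVv t : time_itv S%:E t -> BV mu A (v^~ t).
  move=> /sub_itv tS; split; last first.
    by apply: le_lt_trans (total_var_comparison tS) _; rewrite ltry.
  exact: sq_integrable_integrable (sq_v tS).
split; last first.
  apply: ae_lebesgueT => t tS; split; first exact: BVv.
  apply: filterS comparison_boundary => x H xAO; apply: H => //; exact: sub_itv.
split.
- exact: comparison_integrable.
- by apply: ae_lebesgueT => t; exact: BVv.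
- move=> D b w [_ _ _ [wL _]] _; apply: measurable_funTS.
  apply: (measurable_signed_integral_space mu mA (f := fun z => (v z.1 z.2 * w z.1)%:E)).
  have mw : measurable_fun setT w by move: wL; rewrite inE => /andP[+ _]; rewrite inE.
  apply/measurable_EFinP; apply: measurable_funM; first exact: measurable_comparison.
  by apply: (measurableT_comp mw); exact: measurable_fst.
- rewrite integral_time_itv.
  apply: (@le_lt_trans _ _ (\int[leb]_(t in `[0%R, S]) (tv_majorant t)%:E)).
    by apply: le_integral_pointwise => t; rewrite /= in_itv/=; exact: total_var_comparison.
  apply: integrable_lty; [exact: mS|exact: integrable_tv_majorant].
Qed.

Lemma comparison_weak_dt : weak_dt_L2 mu A S%:E v dv.
Proof.
apply: (@weak_dt_L2_primitive _ _ _ mu A mA g0 dv mdv S%:E).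
- by rewrite lte_fin.
- by under eq_integral do rewrite integral_time_itv; exact: comparison_dt_energy_finite.
- move=> x r Ax r0; rewrite lte_fin => /ltW rS.
  exact: (integrable_subitv (sq_integrable_integrable mS finS (sdv x)) (lexx _) rS).
- by near=> x => Ax; apply: ae_lebesgueT => t /sub_itv tS; rewrite vV.
Unshelve. all: by end_near. Qed.

Let VC2 : in_C0_Lp mu A 2%:E S V.
Proof. exact: primitive_in_C0_L2 dvC. Qed.

Lemma comparison_C0 : C0_representative mu A 1%:E S v V.
Proof.
split; first exact: in_C0_L2_L1.
by apply: ae_lebesgueT => t /sub_itv tS; near=> x => Ax; rewrite vV.
Unshelve. all: by end_near. Qed.

Let defect t := \int[mu]_(x in A) (rate t * (f x t - v x t) ^+ 2)%:E.

Hypothesis minimal :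
  \int[leb]_(t in time_itv S%:E) TV (u^~ t)
     <= \int[leb]_(t in time_itv S%:E)
          (\int[mu]_(x in A) (dv x t * (v x t - u x t))%:E + TV (v^~ t))
        - (2^-1)%:E * Lp_norm mu A 2%:E (V S \- U S)%R ^+ 2
        + (2^-1)%:E * Lp_norm mu A 2%:E (V 0%R \- u0)%R ^+ 2.

Let mdef : measurable_fun [set: XR] (fun z => (rate z.2 * (f z.1 z.2 - v z.1 z.2) ^+ 2)%:E).
Proof.
apply/measurable_EFinP; apply: measurable_funM.
  by apply: (measurableT_comp (f := rate)); [apply: measurable_rate|exact: measurable_snd].
by apply: measurable_funX; apply: measurable_funB => //; exact: measurable_comparison.
Qed.

Let def_ge0 (z : XR) : 0 <= (rate z.2 * (f z.1 z.2 - v z.1 z.2) ^+ 2)%:E.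
Proof. by rewrite lee_fin mulr_ge0 ?rate_ge0 ?sqr_ge0. Qed.

Let defect_ge0 t : 0 <= defect t.
Proof. by apply: integral_ge0 => x _; exact: (def_ge0 (x, t)). Qed.

Let defect_finite : \int[leb]_(t in `[0%R, S]) defect t < +oo.
Proof.
rewrite -(tonelli_rect2 mu mA mS mdef def_ge0) (tonelli_rect1 mu mA mS mdef def_ge0).
set rb := rate_bound h eps.
have rb0 : (0 <= rb)%R by rewrite addr_ge0// invr_ge0 ltW.
have mv2 : measurable_fun [set: XR] (fun z => (v z.1 z.2 ^+ 2)%:E).
  by apply/measurable_EFinP/measurable_funX; exact: measurable_comparison.
have mf2 : measurable_fun [set: XR] (fun z => (f z.1 z.2 ^+ 2)%:E).
  by apply/measurable_EFinP/measurable_funX.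
pose If x := \int[leb]_(t in `[0%R, S]) (f x t ^+ 2)%:E.
pose Iv x := \int[leb]_(t in `[0%R, S]) (v x t ^+ 2)%:E.
have mIf : measurable_fun A If.
  apply: measurable_funTS; apply: (measurable_integral_time mS mf2) => z.
  by rewrite lee_fin sqr_ge0.
have mIv : measurable_fun A Iv.
  apply: measurable_funTS; apply: (measurable_integral_time mS mv2) => z.
  by rewrite lee_fin sqr_ge0.
have If0 x : 0 <= If x by apply: integral_ge0 => t _; rewrite lee_fin sqr_ge0.
have Iv0 x : 0 <= Iv x by apply: integral_ge0 => t _; rewrite lee_fin sqr_ge0.
have c0 : (0 <= rb * 2)%R by rewrite mulr_ge0.
apply: (@le_lt_trans _ _ (\int[mu]_(x in A) ((rb * 2)%:E * (If x + Iv x)))).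
  apply: le_integral_pointwise => x _.
  have i1 := (sf x).2.
  have i2 : leb.-integrable `[0%R, S] (fun t => (v x t ^+ 2)%:E).
    by have [] : sq_integrable leb `[0%R, S] (v x) by exact: sq_integrable_comparison.
  have m1 : measurable_fun `[0%R, S] (fun t => (f x t ^+ 2)%:E) by have /integrableP[] := i1.
  have m2 : measurable_fun `[0%R, S] (fun t => (v x t ^+ 2)%:E) by have /integrableP[] := i2.
  apply: (@le_trans _ _ (\int[leb]_(t in `[0%R, S]) ((rb * 2)%:E *
      ((f x t ^+ 2)%:E + (v x t ^+ 2)%:E)))).
    apply: le_integral_pointwise => t _; rewrite -EFinD -EFinM lee_fin -[leRHS]mulrA.
    apply: ler_pM; [exact: rate_ge0|exact: sqr_ge0|exact: rate_le|].
    rewrite -subr_ge0 (_ : (_ - _)%R = ((f x t + v x t) ^+ 2)%R) ?sqr_ge0//; by ring.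
  rewrite ge0_integralZl; [|exact: mS|exact: emeasurable_funD
    |by move=> t _; rewrite -EFinD lee_fin addr_ge0 ?sqr_ge0|by rewrite lee_fin].
  by rewrite ge0_integralD; [|exact: mS|by move=> t _; rewrite lee_fin sqr_ge0|exact: m1
    |by move=> t _; rewrite lee_fin sqr_ge0|exact: m2].
rewrite ge0_integralZl; [|exact: mA|exact: emeasurable_funD
  |by move=> x _; rewrite adde_ge0|by rewrite lee_fin].
rewrite ge0_integralD; [|exact: mA|by move=> x _|exact: mIf|by move=> x _|exact: mIv].
rewrite lte_mul_pinfty// lte_add_pinfty//; exact: comparison_energy_finite.
Qed.

Let idefect : leb.-integrable `[0%R, S] defect.
Proof.
apply/integrableP; split.
  apply: measurable_funTS; exact: (measurable_integral_space mu mA mdef def_ge0).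
apply: le_lt_trans defect_finite; apply: le_integral_pointwise => t _.
by rewrite gee0_abs.
Qed.

Let integral_tv (D : set R) : @measurable _ (measurableTypeR R) D -> D `<=` `[0%R, S]%classic ->
  \int[leb]_(t in D) TV (u^~ t) = (\int[leb]_(t in `[0%R, S]) (\1_D t * Fr t))%:E.
Proof.
move=> mD DS; have i1 : leb.-integrable `[0%R, S] (fun t => (\1_D t * Fr t)%:E).
  apply: (@bounded_mul_integrable _ _ _ _ _ 1) => //.
  by move=> r _; rewrite indicE ger0_norm ?lern1 ?leq_b1// ler0n.
rewrite /Rintegral fineK; last exact: (integrable_fin_num mS i1).
rewrite integral_clamped_tv// [LHS]integral_mkcond [RHS]integral_mkcond.
apply: ae_eq_integral_pointwise.
have := ae_tv_time mu_doubling oA bA mU' cU' clamped_tv_finite.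
apply: ae_lebesgue_mono => t H _; rewrite !patchE indicE.
have [/set_mem Dt|Dt] := boolP (t \in D).
  by rewrite mem_set ?mul1r; [apply: H|]; exact: DS.
by rewrite mul0r if_same.
Qed.

Let defectE t : time_itv S%:E t ->
  \int[mu]_(x in A) (dv x t * (v x t - u x t))%:E = - defect t.
Proof.
move=> tS; rewrite /defect -integral_ge0N; last by move=> x _; exact: (def_ge0 (x, t)).
apply: ae_eq_integral_pointwise; apply: filterS (fu tS) => x fx Ax.
by rewrite -fx// -EFinN /comparison_dt; congr EFin; ring.
Qed.

(** For the comparison map [v] one has [dv * (v - u) = - rate * (u - v)^2], and the total
    variation of [v] is at most [tv_majorant], whose integral is bounded
    by [relaxation_integral_le]. The total variation of [u] cancels except
    on [t1, t2[. *)
Lemma comparison_inequality :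
  \int[leb]_(t in `[t1, t2[) TV (u^~ t) + \int[leb]_(t in `[0%R, S]) defect t
    <= (h * F0)%:E.
Proof.
have VS0 : Lp_norm mu A 2%:E (V 0%R \- u0)%R = 0.
  apply/eqP; rewrite eq_le Lnorm_ge0 andbT Lp_norm2_le// expr0n /=.
  rewrite integral0_eq// => x Ax /=.
  by rewrite /V /running Rintegral_itv11 addr0 gu// subrr expr0n.
(* the term at time 0 vanishes by VS0, that at time S has the right sign *)
have tested : \int[leb]_(t in time_itv S%:E) TV (u^~ t) <=
    \int[leb]_(t in time_itv S%:E)
      (\int[mu]_(x in A) (dv x t * (v x t - u x t))%:E + TV (v^~ t)).
  apply: le_trans minimal _; rewrite VS0.
  have -> : (0 : \bar R) ^+ 2 = 0 by rewrite expe2 mule0.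
  rewrite mule0 adde0.
  by rewrite geeDl// oppe_le0 mule_ge0// ?expe_ge0 ?Lnorm_ge0// lee_fin.
have majorised : \int[leb]_(t in time_itv S%:E)
      (\int[mu]_(x in A) (dv x t * (v x t - u x t))%:E + TV (v^~ t)) <=
    \int[leb]_(t in `[0%R, S]) ((tv_majorant t)%:E - defect t).
  rewrite -integral_time_itv; apply: le_integral_pointwise => t tS.
  rewrite defectE// addeC; apply: leeD => //; exact/total_var_comparison/sub_itv.
have {tested majorised} := le_trans tested majorised.
rewrite integral_time_itv integralB; [|exact: mS|exact: integrable_tv_majorant|exact: idefect].
rewrite integral_tv//.
have -> : \int[leb]_(t in `[0%R, S]) (tv_majorant t)%:E =
    (\int[leb]_(t in `[0%R, S]) tv_majorant t)%:E.
  by rewrite /Rintegral fineK//; exact: (integrable_fin_num mS integrable_tv_majorant).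
have Qfin := integrable_fin_num mS idefect.
rewrite -(fineK Qfin) integral_tv; last 2 first.
- exact: measurable_itv.
- move=> t /=; rewrite !in_itv/= => /andP[tt1 tt2].
  by rewrite (le_trans t10)//= (le_trans (ltW tt2)).
rewrite -EFinB -EFinD !lee_fin.
have -> : (\int[leb]_(t in `[0%R, S]) (\1_`[0%R, S]%classic t * Fr t))%R =
    (\int[leb]_(t in `[0%R, S]) Fr t)%R.
  by apply: eq_Rintegral => t tS; rewrite indicE tS mul1r.
have F00 : (0 <= F0)%R by apply: fine_ge0; exact: total_var_ge0.
have := relaxation_integral_le h0 eps0 t10 t12 t2S hE F00 (fun s => tv_time_ge0 mu A U' s) iFr.
rewrite -/tv_majorant -/Fr; lra.
Qed.

End core.

(** * Estimates for variational solutions *)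

Section solution_estimates.
Context {R : realType} {d : measure_display} {X : borelMetricType R d}.
Variable mu : {sigma_finite_measure set X -> \bar R}.
Hypothesis mu_doubling : doubling mu.
Variables (Omega A : set X) (oOmega : open Omega) (oA : open A) (bA : metric_bounded A).
Local Notation leb := (@lebesgue_measure R).
Local Notation XR := (X * measurableTypeR R)%type.
Local Notation TV := (total_var mu A).
Local Open Scope ereal_scope.

Variables (S : R) (S_gt0 : (0 < S)%R) (u f : X -> R -> R) (u0 g0 : X -> R).
Hypothesis mf : measurable_fun [set: XR] (fun z => f z.1 z.2).
Hypothesis sf : forall x, sq_integrable leb `[0%R, S] (f x).
Hypothesis ff : \int[mu]_(x in A) \int[leb]_(t in `[0%R, S]) (f x t ^+ 2)%:E < +oo.
Hypotheses (mg0 : measurable_fun setT g0) (sg0 : sq_integrable mu A g0).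
Hypothesis fu : forall t, time_itv S%:E t -> \forall x \ae mu, A x -> f x t = u x t.
Hypothesis gu : forall x, A x -> g0 x = u0 x.
Hypothesis u0_BV : BV mu A u0.
Hypothesis usol : variational_solution_on mu Omega A u0 S u.

Let mA : measurable A. Proof. exact: measurable_open. Qed.
Let muA : mu A < +oo. Proof. exact: metric_bounded_lty. Qed.

Lemma solution_inequality (t1 t2 eps : R) : (0 < eps)%R -> (0 <= t1)%R ->
  (t1 <= t2)%R -> (t2 <= S)%R ->
  \int[leb]_(t in `[t1, t2[) TV (u^~ t) +
  \int[leb]_(t in `[0%R, S]) \int[mu]_(x in A)
    (rate (t2 - t1 + eps) eps t1 t2 t *
     (f x t - comparison f g0 (t2 - t1 + eps) eps t1 t2 x t) ^+ 2)%:E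
  <= ((t2 - t1 + eps) * fine (TV u0))%:E.
Proof.
move=> eps0 t10 t12 t2S; have h0 : (0 < t2 - t1 + eps)%R by rewrite ltr_wpDl// subr_ge0.
have [hu [U hU H]] := usol; have mO : measurable Omega by exact: measurable_open.
apply: (comparison_inequality mu_doubling oA bA S_gt0 mf sf ff mg0 sg0 fu gu u0_BV hu hU
  h0 eps0 t10 t12 t2S erefl).
pose V t x := (g0 x +
  running (comparison_dt f g0 (t2 - t1 + eps) eps t1 t2 x) t)%R.
apply: (H (comparison f g0 (t2 - t1 + eps) eps t1 t2)
  (comparison_dt f g0 (t2 - t1 + eps) eps t1 t2) V).
- exact: (comparison_admissible mu_doubling mO oA bA S_gt0 mf sf ff mg0 sg0 fu gu u0_BV hu hU
    h0 eps0 t10 t12).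
- exact: comparison_weak_dt.
- exact: comparison_C0.
- apply/(in_L2P mu mA); rewrite (_ : V 0%R = g0)//.
  by apply/funext => x; rewrite /V /running Rintegral_itv11 addr0.
Qed.

(** [solution_inequality] with [t1 = t2 = 0], where the rate is constantly [1 / eps]. *)
Lemma yosida_energy (eps : R) : (0 < eps)%R ->
  \int[mu]_(x in A) \int[leb]_(t in `[0%R, S]) (yosida (g0 x) (f x) eps t ^+ 2)%:E
  <= (fine (TV u0))%:E.
Proof.
move=> eps0; have S0 := ltW S_gt0.
have := @solution_inequality 0%R 0%R eps eps0 (lexx _) (lexx _) S0.
rewrite subrr add0r set_itvco0 integral_set0 add0e => H.
have mS : @measurable _ (measurableTypeR R) `[0%R, S]%classic by exact: measurable_itvR.
pose F (z : XR) := (yosida (g0 z.1) (f z.1) eps z.2 ^+ 2)%:E.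
have mF : measurable_fun setT F.
  apply/measurable_EFinP; apply: measurable_funX; apply: measurable_funM => //.
  by apply: measurable_funB => //; exact: measurable_relaxation_joint.
have F0 z : 0 <= F z by rewrite lee_fin sqr_ge0.
rewrite -(tonelli_rect1 mu mA mS mF F0) (tonelli_rect2 mu mA mS mF F0).
rewrite -(@lee_pmul2l _ eps%:E)//.
rewrite -EFinM; apply: le_trans H.
rewrite -ge0_integralZl; [|exact: mS| | |by rewrite lee_fin ltW].
- apply: le_integral_pointwise => t; rewrite /= in_itv/= => /andP[t0 _].
  rewrite -ge0_integralZl; [|exact: mA|exact: (measurable_fun_section2 t mF)|by []|by rewrite lee_fin ltW].
  apply: le_integral_pointwise => x _; rewrite -EFinM lee_fin rate_after//.
  rewrite /yosida -/(comparison f g0 eps eps 0 0 x t) expr_div_n expr2.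
  rewrite le_eqVlt; apply/orP; left; apply/eqP.
  by rewrite /yosida_state /comparison; field; exact: lt0r_neq0.
- by apply: measurable_funTS; exact: (measurable_integral_space mu mA mF F0).
- by move=> t _; exact: integral_ge0.
Qed.

(** [solution_inequality] without its second term, as [eps] tends to 0. *)
Lemma solution_total_var_le (t1 t2 : R) : (0 <= t1)%R -> (t1 <= t2)%R -> (t2 <= S)%R ->
  \int[leb]_(t in `[t1, t2]) TV (u^~ t) <= ((t2 - t1) * fine (TV u0))%:E.
Proof.
move=> t10 t12 t2S.
have -> : \int[leb]_(t in `[t1, t2]) TV (u^~ t) = \int[leb]_(t in `[t1, t2[) TV (u^~ t).
  rewrite [LHS]integral_mkcond [RHS]integral_mkcond; apply: ae_eq_integral_pointwise.
  have := ae_neq t2; apply: ae_lebesgue_mono => t tt2 _; rewrite !patchE.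
  suff -> : (t \in `[t1, t2]%classic) = (t \in `[t1, t2[%classic) by [].
  by rewrite !mem_setE !in_itv/= lt_neqAle tt2.
have F00 : (0 <= fine (TV u0))%R by apply: fine_ge0; exact: total_var_ge0.
apply/lee_addgt0Pr => e e0.
have e'0 : (0 < e / (fine (TV u0) + 1))%R by rewrite divr_gt0// ltr_wpDl.
have := @solution_inequality t1 t2 _ e'0 t10 t12 t2S.
have Q0 : 0 <= \int[leb]_(t in `[0%R, S]) \int[mu]_(x in A)
    (rate (t2 - t1 + e / (fine (TV u0) + 1)) (e / (fine (TV u0) + 1)) t1 t2 t *
     (f x t - comparison f g0 (t2 - t1 + e / (fine (TV u0) + 1))
        (e / (fine (TV u0) + 1)) t1 t2 x t) ^+ 2)%:E.
  apply: integral_ge0 => t _; apply: integral_ge0 => x _; rewrite lee_fin.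
  rewrite mulr_ge0 ?sqr_ge0// rate_ge0// ltr_wpDl// subr_ge0//.
move=> H; apply: le_trans (le_trans (leeDl _ Q0) H) _.
rewrite -EFinD lee_fin mulrDl lerD2l mulrAC ler_pdivrMr ?ltr_wpDl//.
by rewrite ler_pM2l// lerDl.
Qed.

End solution_estimates.

(** * Square-integrability on every fibre *)

Section normal_form.
Context {R : realType} {d : measure_display} {T : measurableType d}.
Variable mu : {sigma_finite_measure set T -> \bar R}.
Local Notation leb := (@lebesgue_measure R).
Local Notation TR := (T * measurableTypeR R)%type.
Variables (A : set T) (mA : measurable A).
Local Open Scope ereal_scope.

(** Set [F] to zero on the null set of fibres with infinite energy. The
    one-dimensional lemmas then apply on every fibre. *)
Lemma everywhere_sq_integrable (B : nat -> set (measurableTypeR R)) (F : T -> R -> R) :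
  (forall n, measurable (B n)) ->
  measurable_fun [set: TR] (fun z => F z.1 z.2) ->
  (forall n, \int[mu]_(x in A) \int[leb]_(t in B n) (F x t ^+ 2)%:E < +oo) ->
  exists F' : T -> R -> R,
    [/\ measurable_fun [set: TR] (fun z => F' z.1 z.2),
        forall x n, sq_integrable leb (B n) (F' x),
        \forall x \ae mu, A x -> forall t, F' x t = F x t &
        forall x t, (F' x t ^+ 2 <= F x t ^+ 2)%R].
Proof.
move=> mB mF finF; pose I n x := \int[leb]_(t in B n) (F x t ^+ 2)%:E.
have mF2 : measurable_fun [set: TR] (fun z => (F z.1 z.2 ^+ 2)%:E).
  by apply/measurable_EFinP/measurable_funX.
have F20 (z : TR) : 0 <= (F z.1 z.2 ^+ 2)%:E by rewrite lee_fin sqr_ge0.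
have mI n : measurable_fun setT (I n) by exact: (measurable_integral_time (mB n) mF2).
have I0 n x : 0 <= I n x by apply: integral_ge0 => t _; exact: (F20 (x, t)).
pose G := \bigcap_n [set x | I n x < +oo].
have mG : measurable G.
  apply: bigcapT_measurable => n; rewrite -[X in measurable X]setTI.
  exact: emeasurable_fun_infty_o.
exists (fun x t => F x t * \1_G x)%R; split.
- apply: measurable_funM => //.
  apply: (measurableT_comp (f := \1_G : T -> R)); last exact: measurable_fst.
  exact: measurable_indic.
- move=> x n; have [Gx|Gx] := pselect (G x); rewrite indicE.
    rewrite mem_set//; apply: sq_integrableP.
      apply: measurable_funM; last exact: measurable_cst.
      apply/measurable_EFinP.
      apply: (@measurable_fun_section1 _ _ _ (B n) (fun z : TR => (F z.1 z.2)%:E) x).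
      exact/measurable_EFinP.
    by apply: le_lt_trans (Gx n Logic.I); apply: le_integral_pointwise => t _; rewrite mulr1.
  rewrite memNset//; apply: sq_integrableP.
    by apply: measurable_funM => //; apply/measurable_EFinP;
      apply: (@measurable_fun_section1 _ _ _ (B n) (fun z : TR => (F z.1 z.2)%:E) x);
      exact/measurable_EFinP.
  by rewrite integral0_eq// => t _; rewrite mulr0 expr0n.
- have aefin n : \forall x \ae mu, A x -> I n x < +oo.
    have iI : mu.-integrable A (I n).
      apply/integrableP; split; first exact: measurable_funTS.
      by under eq_integral do rewrite gee0_abs//; exact: finF.
    apply: filterS (integrable_ae mA iI) => x H Ax.
    by rewrite -ge0_fin_numE//; exact: H.
  have := ae_foralln aefin; apply: filterS => x H Ax t.
  by rewrite indicE mem_set ?mulr1// => n _; exact: H.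
- move=> x t; rewrite exprMn ler_piMr ?sqr_ge0// indicE.
Qed.

Lemma ge0_integral_bigcup_le d' (T' : measurableType d') (nu : {measure set T' -> \bar R})
    (D : nat -> set T') (F : T' -> \bar R) (c : \bar R) : nondecreasing_seq D ->
  (forall n, measurable (D n)) -> measurable_fun setT F -> (forall x, 0 <= F x) ->
  (forall n, \int[nu]_(x in D n) F x <= c) ->
  \int[nu]_(x in \bigcup_n D n) F x <= c.
Proof.
move=> ndD mD mF F0 Fc.
have cv := @ge0_nondecreasing_set_cvg_integral _ _ _ D F nu ndD mD
  (fun i => measurable_funTS mF) (fun i x _ => F0 x).
rewrite -(cvg_lim _ cv)//; apply: lime_le; first by apply: cvgP cv.
by near=> n; exact: Fc.
Unshelve. all: by end_near. Qed.

End normal_form.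

(** * A normal form of the solution *)

Section time_exhaustion.
Context {R : realType} {d : measure_display} {X : measurableType d}.
Variable mu : {sigma_finite_measure set X -> \bar R}.
Local Notation leb := (@lebesgue_measure R).
Local Notation XR := (X * measurableTypeR R)%type.
Variables (A : set X) (mA : measurable A).
Local Open Scope ereal_scope.

Variables (T : \bar R) (Sn : nat -> R).
Hypothesis Sn_nd : nondecreasing_seq Sn.
Hypothesis SnT : time_itv T = \bigcup_n time_itv (Sn n)%:E.

Let D : set XR := A `*` time_itv T.
Let Dn n : set XR := A `*` time_itv (Sn n)%:E.

Let mDn n : measurable (Dn n).
Proof. by apply: measurableX => //; exact: measurable_time_itv. Qed.

Lemma cylinder_bigcup : D = \bigcup_n Dn n.
Proof.
rewrite /D SnT; apply/seteqP; split => [[x t] /= [Ax [n _ tn]]|[x t] [n _ /= [Ax tn]]].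
  by exists n.
by split => //; exists n.
Qed.

Let Dn_nd : nondecreasing_seq Dn.
Proof.
move=> n m nm; apply/subsetPset => -[x t] /= [Ax [t0 tn]]; split => //; split => //.
by apply: lt_le_trans tn _; rewrite lee_fin; exact: Sn_nd.
Qed.

Lemma cylinder_integralE n (G : XR -> \bar R) : measurable_fun setT G -> (forall z, 0 <= G z) ->
  \int[mu \x leb]_(z in Dn n) G z =
  \int[mu]_(x in A) \int[leb]_(t in `[0%R, Sn n]) G (x, t).
Proof.
move=> mG G0; rewrite (tonelli_rect1 mu mA (measurable_time_itv _) mG G0).
by apply: eq_integral => x _; rewrite integral_time_itv.
Qed.

Lemma cylinder_integral_le (G : XR -> \bar R) c : measurable_fun setT G -> (forall z, 0 <= G z) ->
  (forall n, \int[mu]_(x in A) \int[leb]_(t in `[0%R, Sn n]) G (x, t) <= c) ->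
  \int[mu \x leb]_(z in D) G z <= c.
Proof.
move=> mG G0 Gc; rewrite cylinder_bigcup; apply: ge0_integral_bigcup_le => // n.
by rewrite -/(Dn n) cylinder_integralE.
Qed.

Lemma cylinder_sub n : Dn n `<=` D.
Proof. by rewrite cylinder_bigcup; exact: bigcup_sup. Qed.

End time_exhaustion.

Section normal_form_of_solution.
Context {R : realType} {d : measure_display} {X : borelMetricType R d}.
Variable mu : {sigma_finite_measure set X -> \bar R}.
Hypothesis mu_doubling : doubling mu.
Variables (Omega A : set X) (oOmega : open Omega) (oA : open A) (bA : metric_bounded A).
Local Notation leb := (@lebesgue_measure R).
Local Notation XR := (X * measurableTypeR R)%type.
Local Notation TV := (total_var mu A).
Local Open Scope ereal_scope.

Let mA : measurable A. Proof. exact: measurable_open. Qed.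
Let muA : mu A < +oo. Proof. exact: metric_bounded_lty. Qed.

(** The solution has a representative that is continuous in time with
    values in [L^2], hence bounded. *)
Lemma solution_energy_finite (S : R) (u uhat : X -> R -> R) (u0 : X -> R) :
  (0 < S)%R -> variational_solution_on mu Omega A u0 S u ->
  measurable_fun [set: XR] (fun z => uhat z.1 z.2) ->
  (forall x t, A x -> time_itv S%:E t -> uhat x t = u x t) ->
  \int[mu]_(x in A) \int[leb]_(t in `[0%R, S]) (uhat x t ^+ 2)%:E < +oo.
Proof.
move=> S0 [_ [U [UC uU] _]] muh uhu.
have [M HM] := in_C0_L2_bounded mA UC.
have mS : @measurable _ (measurableTypeR R) `[0%R, S]%classic by exact: measurable_itvR.
have mu2 : measurable_fun [set: XR] (fun z => (uhat z.1 z.2 ^+ 2)%:E).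
  by apply/measurable_EFinP/measurable_funX.
have u20 (z : XR) : 0 <= (uhat z.1 z.2 ^+ 2)%:E by rewrite lee_fin sqr_ge0.
rewrite -(tonelli_rect1 mu mA mS mu2 u20) (tonelli_rect2 mu mA mS mu2 u20).
rewrite -integral_time_itv.
have M0 : 0 <= M%:E.
  apply: le_trans (HM 0%R _); last by rewrite lexx ltW.
  by apply: integral_ge0 => x _; rewrite lee_fin sqr_ge0.
apply: (@le_lt_trans _ _ (\int[leb]_(t in time_itv S%:E) M%:E)).
  apply: ae_ge0_le_integral_pointwise => [t _|t _|].
  - by apply: integral_ge0 => x _; exact: (u20 (x, t)).
  - exact: M0.
  - move: uU; apply: ae_lebesgue_mono => t H tS.
    have tS' : (0 <= t <= S)%R.
      by move: tS; rewrite time_itvE/= in_itv/= => /andP[/ltW -> /ltW ->].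
    apply: le_trans (HM t tS'); rewrite le_eqVlt; apply/orP; left; apply/eqP.
    apply: ge0_ae_eq_integral_pointwise => [x _|x _|].
    + by rewrite lee_fin sqr_ge0.
    + by rewrite lee_fin sqr_ge0.
    + by apply: filterS (H tS) => x uUx Ax; rewrite uhu// uUx.
rewrite integral_time_itv (integral_cst leb mS).
have := @lebesgue_measure_itv R `[0%R, S]; rewrite /= lte_fin S0 -EFinB => ->.
by rewrite -EFinM ltry.
Qed.

Variables (T : \bar R) (Sn : nat -> R).
Hypothesis Sn0 : forall n, (0 < Sn n)%R.
Hypothesis SnT : time_itv T = \bigcup_n time_itv (Sn n)%:E.
Variables (u : X -> R -> R) (u0 : X -> R).
Hypothesis usol : forall n, variational_solution_on mu Omega A u0 (Sn n) u.

Let mD : measurable (A `*` (time_itv T : set (measurableTypeR R))).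
Proof. by apply: measurableX => //; exact: measurable_time_itv. Qed.

Let uhat x t := ((fun z : XR => u z.1 z.2) \_ (A `*` time_itv T)) (x, t).

Let measurable_uhat : measurable_fun [set: XR] (fun z => uhat z.1 z.2).
Proof.
rewrite (_ : (fun z => _) = (fun z : XR => u z.1 z.2) \_ (A `*` time_itv T)); last by apply/funext => -[].
have muD : measurable_fun (A `*` time_itv T) (fun z : XR => u z.1 z.2).
  rewrite (cylinder_bigcup A SnT); apply/measurable_fun_bigcup => n.
    by apply: measurableX => //; exact: measurable_time_itv.
  by have [[[/integrableP[/measurable_EFinP]]]] := usol n.
exact: (measurable_restrictT _ mD).1 muD.
Qed.

Lemma exists_normal_form : exists f : X -> R -> R,
  [/\ measurable_fun [set: XR] (fun z => f z.1 z.2),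
      forall x n, sq_integrable leb `[0%R, Sn n] (f x),
      forall n, \int[mu]_(x in A) \int[leb]_(t in `[0%R, Sn n]) (f x t ^+ 2)%:E < +oo &
      \forall x \ae mu, A x -> forall t, time_itv T t -> f x t = u x t].
Proof.
have uhatE x t : A x -> time_itv T t -> uhat x t = u x t.
  by move=> Ax tT; rewrite /uhat patchE mem_set.
have fin n : \int[mu]_(x in A) \int[leb]_(t in `[0%R, Sn n]) (uhat x t ^+ 2)%:E < +oo.
  apply: (solution_energy_finite (Sn0 n) (usol n) measurable_uhat) => x t Ax tS.
  by apply: uhatE => //; rewrite SnT; exists n.
have [f [mf sf fE fle]] := everywhere_sq_integrable mA
  (fun n => measurable_itvR _) measurable_uhat fin.
exists f; split => //.
- move=> n; apply: le_lt_trans (fin n); apply: le_integral_pointwise => x _.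
  by apply: le_integral_pointwise => t _; rewrite lee_fin.
- by apply: filterS fE => x H Ax t tT; rewrite H// uhatE.
Qed.

End normal_form_of_solution.

(** * The time derivative *)

Section velocity.
Context {R : realType} {d : measure_display} {X : measurableType d}.
Variable mu : {sigma_finite_measure set X -> \bar R}.
Local Notation leb := (@lebesgue_measure R).
Local Notation XR := (X * measurableTypeR R)%type.
Variables (A : set X) (mA : measurable A).
Local Open Scope ereal_scope.

Variables (T : \bar R) (Sn : nat -> R).
Hypothesis Sn0 : forall n, (0 < Sn n)%R.
Hypothesis Sn_nd : nondecreasing_seq Sn.
Hypothesis SnT : time_itv T = \bigcup_n time_itv (Sn n)%:E.
Variables (f : X -> R -> R) (g0 : X -> R) (F0 : R).
Hypothesis mf : measurable_fun [set: XR] (fun z => f z.1 z.2).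
Hypothesis sf : forall x n, sq_integrable leb `[0%R, Sn n] (f x).
Hypothesis mg0 : measurable_fun setT g0.
Hypothesis yF0 : forall n (h : R), (0 < h)%R ->
  \int[mu]_(x in A) \int[leb]_(t in `[0%R, Sn n]) (yosida (g0 x) (f x) h t ^+ 2)%:E <= F0%:E.

Let D : set XR := A `*` time_itv T.
Let Dn n : set XR := A `*` time_itv (Sn n)%:E.
Let mD : measurable D.
Proof. by apply: measurableX => //; exact: measurable_time_itv. Qed.
Let mS n : @measurable _ (measurableTypeR R) `[0%R, Sn n]%classic.
Proof. exact: measurable_itvR. Qed.
Let finS n : leb (`[0%R, Sn n]%classic : set (measurableTypeR R)) < +oo.
Proof. exact: lebesgue_itv_lty. Qed.

Let step k : R := k.+1%:R^-1.
Let step_gt0 k : (0 < step k)%R. Proof. by rewrite invr_gt0 ltr0n. Qed.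
Let y k (x : X) t := yosida (g0 x) (f x) (step k) t.

Let measurable_y k : measurable_fun [set: XR] (fun z => y k z.1 z.2).
Proof.
apply: measurable_funM => //; apply: measurable_funB => //.
exact: measurable_relaxation_joint.
Qed.

Let sy k x n : sq_integrable leb `[0%R, Sn n] (y k x).
Proof. by apply: sq_integrable_yosida => //; exact: ltW. Qed.

Let p k (z : XR) : R := ((fun z : XR => y k z.1 z.2) \_ D) z.

Let measurable_p k : measurable_fun setT (p k).
Proof. exact: (measurable_restrictT _ mD).1 (measurable_funTS (measurable_y k)). Qed.

Let measurable_sqE (g : XR -> R) : measurable_fun setT g ->
  measurable_fun setT (fun z => (g z ^+ 2)%:E).
Proof. by move=> mg; apply/measurable_EFinP/measurable_funX. Qed.

Let restrictE (g : XR -> R) :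
  \int[mu \x leb]_z (((g \_ D) z) ^+ 2)%:E = \int[mu \x leb]_(z in D) (g z ^+ 2)%:E.
Proof.
rewrite [RHS]integral_mkcond; apply: eq_integral => z _; rewrite !patchE.
by case: ifPn => // _; rewrite expr0n.
Qed.

Let p_bound k : \int[mu \x leb]_z (p k z ^+ 2)%:E <= F0%:E.
Proof.
rewrite restrictE; apply: (cylinder_integral_le mA Sn_nd SnT) => [|z|n].
- exact: measurable_sqE.
- by rewrite lee_fin sqr_ge0.
- exact: yF0.
Qed.

Let p_orth k l : (k <= l)%N ->
  \int[mu \x leb]_z ((p l z - p k z) ^+ 2)%:E + \int[mu \x leb]_z (p k z ^+ 2)%:E <=
  \int[mu \x leb]_z (p l z ^+ 2)%:E.
Proof.
rewrite leq_eqVlt => /predU1P[->|kl].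
  rewrite [X in X + _]integral0_eq ?add0e// => z _; by rewrite subrr expr0n.
have lk : (step l < step k)%R by rewrite ltf_pV2 ?posrE ?ltr0n// ltr_nat ltnS.
pose G (z : XR) := ((y l z.1 z.2 - y k z.1 z.2) ^+ 2 + y k z.1 z.2 ^+ 2)%R.
have mG : measurable_fun setT (fun z => (G z)%:E).
  apply/measurable_EFinP; apply: measurable_funD; last exact: measurable_funX.
  by apply: measurable_funX; exact: measurable_funB.
have G0 z : 0 <= (G z)%:E by rewrite lee_fin addr_ge0 ?sqr_ge0.
have -> : \int[mu \x leb]_z ((p l z - p k z) ^+ 2)%:E =
    \int[mu \x leb]_(z in D) ((y l z.1 z.2 - y k z.1 z.2) ^+ 2)%:E.
  rewrite [RHS]integral_mkcond; apply: eq_integral => z _; rewrite /p !patchE.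
  by case: ifPn => // _; rewrite subrr expr0n.
rewrite restrictE restrictE -ge0_integralD; [|exact: mD
  |by move=> z _; rewrite lee_fin sqr_ge0
  |by apply: measurable_funTS; apply: measurable_sqE; exact: measurable_funB
  |by move=> z _; rewrite lee_fin sqr_ge0|by apply: measurable_funTS; exact: measurable_sqE].
apply: (@le_trans _ _ (\int[mu \x leb]_(z in D) (G z)%:E)).
  by apply: le_integral_pointwise => z _; rewrite /G EFinD.
apply: (cylinder_integral_le mA Sn_nd SnT mG G0) => n.
apply: (@le_trans _ _ (\int[mu \x leb]_(z in Dn n) (y l z.1 z.2 ^+ 2)%:E)); last first.
  apply: ge0_subset_integral => //.
  - by apply: measurableX => //; exact: measurable_time_itv.
  - by apply: measurable_funTS; exact: measurable_sqE.
  - by move=> z _; rewrite lee_fin sqr_ge0.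
  - by apply: cylinder_sub; exact: SnT.
rewrite (cylinder_integralE mu mA) => [||z]; [|exact: measurable_sqE|by rewrite lee_fin sqr_ge0].
apply: le_integral_pointwise => x _.
have sd := sq_integrable_sub (mS n) (sy l x n) (sy k x n).
have H := @yosida_monotone _ (g0 x) (f x) (Sn n) (ltW (Sn0 n)) (sf x n) _ _ (step_gt0 l) lk.
have i1 : leb.-integrable `[0%R, Sn n] (fun t => (G (x, t))%:E).
  apply: (@integrable_add _ 0 (Sn n) (fun t => (y l x t - y k x t) ^+ 2)%R
    (fun t => y k x t ^+ 2)%R); [exact: sd.2|exact: (sy k x n).2].
have i2 := (sy l x n).2.
rewrite -(fineK (integrable_fin_num (mS n) i1)) -(fineK (integrable_fin_num (mS n) i2)).
rewrite lee_fin; apply: le_trans H; rewrite -RintegralD; last 3 first.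
- exact: mS.
- exact: sd.2.
- exact: (sy k x n).2.
by [].
Qed.

(** The primitive of [y k] is the relaxed function, at distance [step k * y k] from
    [f]; the primitives of [y k] and [w] are compared by [running_increment_sq]. *)
Let primitive_defect (w : X -> R -> R) n k x :
  sq_integrable leb `[0%R, Sn n] (w x) ->
  \int[leb]_(t in `[0%R, Sn n]) ((f x t - (g0 x + running (w x) t)) ^+ 2)%:E <=
  (2 * step k ^+ 2)%:E * \int[leb]_(t in `[0%R, Sn n]) (y k x t ^+ 2)%:E +
  (2 * Sn n ^+ 2)%:E * \int[leb]_(t in `[0%R, Sn n]) ((y k x t - w x t) ^+ 2)%:E.
Proof.
move=> sw; have S0 := ltW (Sn0 n).
have sd := sq_integrable_sub (mS n) (sy k x n) sw.
set Q := (\int[leb]_(t in `[0%R, Sn n]) ((y k x t - w x t) ^+ 2))%R.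
have QE : \int[leb]_(t in `[0%R, Sn n]) ((y k x t - w x t) ^+ 2)%:E = Q%:E.
  by rewrite fineK//; exact: (integrable_fin_num (mS n) sd.2).
have Q0 : (0 <= Q)%R by apply: Rintegral_ge0 => t _; exact: sqr_ge0.
have iy := sq_integrable_integrable (mS n) (finS n) (sy k x n).
have iw := sq_integrable_integrable (mS n) (finS n) sw.
have my2 : measurable_fun `[0%R, Sn n] (fun t => (y k x t ^+ 2)%:E).
  by have /integrableP[] := (sy k x n).2.
apply: (@le_trans _ _ (\int[leb]_(t in `[0%R, Sn n])
    ((2 * step k ^+ 2)%:E * (y k x t ^+ 2)%:E + (2 * (Sn n * Q))%:E))).
  apply: le_integral_pointwise => t; rewrite /= in_itv/= => /andP[t0 tS].
  rewrite -EFinM -EFinD lee_fin.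
  pose r := running (fun t => y k x t - w x t)%R t.
  have r2 : (r ^+ 2 <= Sn n * Q)%R.
    have := running_increment_sq sd (lexx 0%R) t0 tS.
    rewrite {2}/running Rintegral_itv11 !subr0 -/r -/Q => H.
    by apply: le_trans H _; rewrite ler_wpM2r.
  have rE : r = (running (y k x) t - running (w x) t)%R.
    rewrite /r /running RintegralB; [by []|exact: measurable_itvR| |];
      by apply: integrable_subitv _ (lexx _) tS.
  have yE : (f x t = step k * y k x t + (g0 x + running (y k x) t))%R.
    have <- : yosida_state (g0 x) (f x) (step k) t = (g0 x + running (y k x) t)%R.
      by apply: (@yosida_ode _ (g0 x) (f x) (Sn n)).
    by rewrite /y /yosida mulrCA mulfV ?mulr1 ?subrK// gt_eqF.
  have -> : (f x t - (g0 x + running (w x) t) = step k * y k x t + r)%R.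
    by rewrite yE rE; ring.
  have sq (a b : R) : ((a + b) ^+ 2 <= 2 * a ^+ 2 + 2 * b ^+ 2)%R.
    by rewrite -subr_ge0 (_ : (_ - _)%R = ((a - b) ^+ 2)%R) ?sqr_ge0//; ring.
  apply: le_trans (sq _ _) _; apply: lerD; last by rewrite ler_pM2l.
  by rewrite exprMn [leLHS]mulrA.
have c0 : (0 <= 2 * step k ^+ 2)%R by rewrite mulr_ge0 ?sqr_ge0.
rewrite ge0_integralD; [|exact: mS|by move=> t _; rewrite -EFinM lee_fin mulr_ge0 ?sqr_ge0
  |exact: measurable_funeM|by move=> t _; rewrite lee_fin mulr_ge0// mulr_ge0
  |exact: measurable_cst].
rewrite ge0_integralZl; [|exact: mS|exact: my2|by move=> t _; rewrite lee_fin sqr_ge0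
  |by rewrite lee_fin].
apply: leeD => //; rewrite (integral_cst leb (mS n)) QE.
have := @lebesgue_measure_itv R `[0%R, Sn n]; rewrite /= lte_fin Sn0 -EFinB subr0 => ->.
by rewrite -!EFinM lee_fin le_eqVlt; apply/orP; left; apply/eqP; ring.
Qed.

(** The difference quotients [yosida] along [step k] are bounded in [L^2] of space-time and,
    by [yosida_monotone] on each fibre, satisfy the hypotheses of [L2_limit]. Their
    primitives are the relaxed functions, which differ from [f] by [step k] times
    the quotient; so [f] is the primitive of the limit. *)
Lemma exists_velocity : exists w : X -> R -> R,
  [/\ measurable_fun [set: XR] (fun z => w z.1 z.2),
      forall x, sq_integrable leb setT (w x),
      forall B, @measurable _ (measurableTypeR R) B ->
        \int[mu]_(x in A) \int[leb]_(t in B) (w x t ^+ 2)%:E <= F0%:E &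
      \forall x \ae mu, A x -> \forall t \ae leb, time_itv T t ->
        f x t = (g0 x + running (w x) t)%R].
Proof.
have [q [mq qF0] cq] := L2_limit measurable_p p_bound p_orth.
have q20 (z : XR) : 0 <= (q z ^+ 2)%:E by rewrite lee_fin sqr_ge0.
have mq2 := measurable_sqE mq.
have mRT : @measurable _ (measurableTypeR R) setT by exact: measurableT.
have subq B : @measurable _ (measurableTypeR R) B ->
    \int[mu]_(x in A) \int[leb]_(t in B) (q (x, t) ^+ 2)%:E <= F0%:E.
  move=> mB; rewrite -(tonelli_rect1 mu mA mB mq2 q20); apply: le_trans qF0.
  by apply: ge0_subset_integral => //; exact: measurableX.
have fin (n : nat) : \int[mu]_(x in A) \int[leb]_(t in setT) (q (x, t) ^+ 2)%:E < +oo.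
  by apply: le_lt_trans (subq _ mRT) _; rewrite ltry.
have mq' : measurable_fun [set: XR] (fun z => q (z.1, z.2)).
  by rewrite (_ : (fun z => _) = q)//; apply/funext => -[].
have [w [mw sw wq wle]] := everywhere_sq_integrable mA (fun _ : nat => mRT) mq' fin.
exists w; split => //; first by move=> x; exact: (sw x 0%N).
- move=> B mB; apply: le_trans (subq B mB).
  by apply: le_integral_pointwise => x _; apply: le_integral_pointwise => t _; rewrite lee_fin.
pose Y x t := (g0 x + running (w x) t)%R.
have mY : measurable_fun [set: XR] (fun z => Y z.1 z.2).
  apply: measurable_funD; last exact: measurable_running_joint.
  by apply: (measurableT_comp mg0); exact: measurable_fst.
pose E (z : XR) := ((f z.1 z.2 - Y z.1 z.2) ^+ 2)%:E.
have mE : measurable_fun setT E by apply: measurable_sqE; exact: measurable_funB.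
have E0 z : 0 <= E z by rewrite lee_fin sqr_ge0.
have F0_ge0 : (0 <= F0)%R.
  rewrite -lee_fin; apply: le_trans qF0.
  by apply: integral_ge0 => z _; exact: q20.
have Ele n k : \int[mu]_(x in A) \int[leb]_(t in `[0%R, Sn n]) E (x, t) <=
    (2 * step k ^+ 2 * F0)%:E + (2 * Sn n ^+ 2)%:E * \int[mu \x leb]_z ((q z - p k z) ^+ 2)%:E.
  have sw' x : sq_integrable leb `[0%R, Sn n] (w x).
    have [mwx iwx] := sw x 0%N; split; first exact: measurable_funS mwx.
    exact: integrableS iwx.
  pose I1 x := \int[leb]_(t in `[0%R, Sn n]) (y k x t ^+ 2)%:E.
  pose I2 x := \int[leb]_(t in `[0%R, Sn n]) ((y k x t - w x t) ^+ 2)%:E.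
  have my2 : measurable_fun [set: XR] (fun z => (y k z.1 z.2 ^+ 2)%:E) by exact: measurable_sqE.
  have myw2 : measurable_fun [set: XR] (fun z => ((y k z.1 z.2 - w z.1 z.2) ^+ 2)%:E).
    by apply: measurable_sqE; exact: measurable_funB.
  have mI1 : measurable_fun A I1.
    apply: measurable_funTS; apply: (measurable_integral_time (mS n) my2) => z.
    by rewrite lee_fin sqr_ge0.
  have mI2 : measurable_fun A I2.
    apply: measurable_funTS; apply: (measurable_integral_time (mS n) myw2) => z.
    by rewrite lee_fin sqr_ge0.
  have I10 x : 0 <= I1 x by apply: integral_ge0 => t _; rewrite lee_fin sqr_ge0.
  have I20 x : 0 <= I2 x by apply: integral_ge0 => t _; rewrite lee_fin sqr_ge0.
  have c1 : (0 <= 2 * step k ^+ 2)%R by rewrite mulr_ge0 ?sqr_ge0.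
  have c2 : (0 <= 2 * Sn n ^+ 2)%R by rewrite mulr_ge0 ?sqr_ge0.
  apply: (@le_trans _ _ (\int[mu]_(x in A) ((2 * step k ^+ 2)%:E * I1 x +
      (2 * Sn n ^+ 2)%:E * I2 x))).
    by apply: le_integral_pointwise => x _; exact: primitive_defect.
  rewrite ge0_integralD; [|exact: mA|by move=> x _; rewrite mule_ge0 ?lee_fin
    |exact: measurable_funeM|by move=> x _; rewrite mule_ge0 ?lee_fin|exact: measurable_funeM].
  rewrite ge0_integralZl; [|exact: mA|exact: mI1|by []|by rewrite lee_fin].
  rewrite ge0_integralZl; [|exact: mA|exact: mI2|by []|by rewrite lee_fin].
  apply: leeD; first by rewrite [leRHS]EFinM; apply: lee_wpmul2l; [rewrite lee_fin|exact: yF0].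
  apply: lee_wpmul2l; first by rewrite lee_fin.
  pose G (z : XR) := ((q z - y k z.1 z.2) ^+ 2)%:E.
  have mG : measurable_fun setT G by apply: measurable_sqE; exact: measurable_funB.
  have G0 z : 0 <= G z by rewrite lee_fin sqr_ge0.
  have -> : \int[mu]_(x in A) I2 x = \int[mu \x leb]_(z in Dn n) G z.
    rewrite (@cylinder_integralE _ _ _ mu A mA Sn n G mG G0); apply: ge0_ae_eq_integral_pointwise => //.
      by move=> x _; apply: integral_ge0.
    apply: filterS wq => x H Ax; apply: eq_integral => t _.
    by rewrite /G/= H// -sqrrN opprB.
  apply: (@le_trans _ _ (\int[mu \x leb]_(z in D) G z)).
    apply: ge0_subset_integral => //.
    - by apply: measurableX => //; exact: measurable_time_itv.
    - exact: measurable_funTS.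
    - by apply: cylinder_sub; exact: SnT.
  rewrite [leLHS]integral_mkcond; apply: le_integral_pointwise => z _.
  rewrite /p !patchE; case: ifPn => // _; by rewrite lee_fin sqr_ge0.
have E_eq0 n : \int[mu]_(x in A) \int[leb]_(t in `[0%R, Sn n]) E (x, t) <= 0.
  apply/lee_addgt0Pr => e e0; rewrite add0e.
  have c0 : (0 < 4 * Sn n ^+ 2)%R by rewrite mulr_gt0// exprn_gt0.
  have e'0 : (0 < e / (4 * Sn n ^+ 2))%R by rewrite divr_gt0.
  (* for such k also 2 * step k ^+ 2 * F0 <= e / 2 *)
  have [k kN qk] := cq _ e'0 (Num.truncn (4 * F0 / e)).
  apply: le_trans (Ele n k) _.
  apply: (@le_trans _ _ ((e / 2)%:E + (e / 2)%:E)); last by rewrite -EFinD -splitr.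
  apply: leeD.
    have k1 : (4 * F0 / e < k.+1%:R)%R.
      by apply: lt_le_trans (truncnS_gt _) _; rewrite ler_nat.
    have stepF : (step k * (4 * F0) <= e)%R.
      by rewrite /step mulrC ler_pdivrMr ?ltr0n// [leRHS]mulrC -ler_pdivrMr// ltW.
    have step1 : (step k <= 1)%R by rewrite invf_le1 ?ltr0n// ler1n.
    have sF : (0 <= step k * F0)%R by rewrite mulr_ge0// ltW.
    have ssF : (step k * (step k * F0) <= step k * F0)%R by rewrite ler_piMl.
    rewrite lee_fin (_ : 2 * step k ^+ 2 * F0 = 2 * (step k * (step k * F0)))%R; last by ring.
    rewrite ler_pdivlMr// mulrAC -natrM; apply: le_trans stepF.
    by rewrite [leRHS]mulrCA ler_pM2l.
  apply: le_trans (lee_wpmul2l _ qk) _; first by rewrite lee_fin mulr_ge0 ?sqr_ge0.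
  rewrite -EFinM lee_fin le_eqVlt; apply/orP; left; apply/eqP; field.
  by rewrite gt_eqF.
have H : \int[mu]_(x in A) \int[leb]_(t in time_itv T) E (x, t) = 0.
  apply/eqP; rewrite eq_le -(tonelli_rect1 mu mA (measurable_time_itv T) mE E0).
  rewrite (cylinder_integral_le mA Sn_nd SnT mE E0 E_eq0)/=.
  by apply: integral_ge0 => z _; exact: E0.
have mJ : measurable_fun A (fun x => \int[leb]_(t in time_itv T) E (x, t)).
  by apply: measurable_funTS; exact: (measurable_integral_time (measurable_time_itv T) mE E0).
have J0 x : 0 <= \int[leb]_(t in time_itv T) E (x, t) by exact: integral_ge0.
have := (integral_eq0_ae mu mA mJ J0).1 H; apply: filterS => x Hx Ax.
have mEx : measurable_fun (time_itv T) (fun t => E (x, t)) by exact: measurable_fun_section1.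
have := (integral_eq0_ae leb (measurable_time_itv T) mEx (fun t => E0 (x, t))).1 (Hx Ax).
apply: ae_lebesgue_mono => t Ht tT; have := Ht tT.
by rewrite /E/= => -[] /eqP; rewrite sqrf_eq0 subr_eq0 => /eqP.
Qed.

End velocity.

(** * Regularity of the solution *)

Section solution_regularity.
Context {R : realType} {d : measure_display} {X : borelMetricType R d}.
Variable mu : {sigma_finite_measure set X -> \bar R}.
Hypothesis mu_doubling : doubling mu.
Variables (Omega A : set X) (oOmega : open Omega) (oA : open A) (bA : metric_bounded A).
Local Notation leb := (@lebesgue_measure R).
Local Notation XR := (X * measurableTypeR R)%type.
Local Notation TV := (total_var mu A).
Local Open Scope ereal_scope.

Let mA : measurable A. Proof. exact: measurable_open. Qed.
Let muA : mu A < +oo. Proof. exact: metric_bounded_lty. Qed.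

Variables (T : \bar R) (T_gt0 : 0 < T) (Sn : nat -> R).
Hypothesis Sn0 : forall n, (0 < Sn n)%R.
Hypothesis Sn_nd : nondecreasing_seq Sn.
Hypothesis SnT : time_itv T = \bigcup_n time_itv (Sn n)%:E.
Hypothesis Sn_le : forall tau : R, tau%:E <= T -> exists n, (tau <= Sn n)%R.
Variables (u : X -> R -> R) (u0 : X -> R).
Hypothesis u0_L2 : in_Lp mu A 2%:E u0.
Hypothesis u0_BV : BV mu A u0.
Hypothesis usol : forall n, variational_solution_on mu Omega A u0 (Sn n) u.

Let F0 := fine (TV u0).
Let F0E : TV u0 = F0%:E.
Proof. by rewrite /F0 fineK// ge0_fin_numE ?total_var_ge0//; exact: u0_BV.2. Qed.

Let g0 := u0 \_ A.
Let gu x : A x -> g0 x = u0 x.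
Proof. by move=> Ax; rewrite /g0 patchE mem_set. Qed.

Let mg0 : measurable_fun setT g0.
Proof. by apply/(measurable_restrictT _ mA).1; have [] := (in_L2P mu mA u0).1 u0_L2. Qed.

Let sg0 : sq_integrable mu A g0.
Proof.
have [mu0 iu0] := (in_L2P mu mA u0).1 u0_L2; split; first exact: measurable_funTS.
apply: eq_integrable iu0 => // x /set_mem Ax.
by rewrite gu.
Qed.

Lemma solution_regularity :
  [/\ exists2 du : X -> R -> R, weak_dt_L2 mu A T u du &
        \int[leb]_(t in time_itv T) \int[mu]_(x in A) (`|du x t| ^+ 2)%:E <= TV u0,
      forall tau : R, (0 < tau)%R -> tau%:E <= T -> in_holder_L2 mu 2^-1 A tau u &
      forall t1 t2 : R, (0 <= t1)%R -> (t1 < t2)%R -> t2%:E <= T ->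
        ((t2 - t1)^-1)%:E * \int[leb]_(t in `[t1, t2]) TV (u^~ t) <= TV u0].
Proof.
have [f [mf sf ff fuE]] := exists_normal_form oA Sn0 SnT usol.
have fuT t : time_itv T t -> \forall x \ae mu, A x -> f x t = u x t.
  by move=> tT; apply: filterS fuE => x H Ax; exact: H.
have fu n t : time_itv (Sn n)%:E t -> \forall x \ae mu, A x -> f x t = u x t.
  by move=> tn; apply: fuT; rewrite SnT; exists n.
have yF0 n (h : R) : (0 < h)%R ->
    \int[mu]_(x in A) \int[leb]_(t in `[0%R, Sn n]) (yosida (g0 x) (f x) h t ^+ 2)%:E
    <= F0%:E.
  exact: (yosida_energy mu_doubling oOmega oA bA (Sn0 n) mf (fun x => sf x n) (ff n) mg0 sg0
    (fu n) gu u0_BV (usol n)).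
have [w [mw sw wF0 wE]] := exists_velocity mA Sn0 Sn_nd SnT mf sf mg0 yF0.
have mT := measurable_time_itv T.
have sw' S x : sq_integrable leb `[0%R, S] (w x).
  have [mwx iwx] := sw x; have mS := measurable_itvR `[0%R, S].
  split; first exact: measurable_funS mwx.
  exact: integrableS iwx.
have iw S x : leb.-integrable `[0%R, S] (EFin \o w x).
  apply: sq_integrable_integrable (sw' S x); first exact: measurable_itvR.
  exact: lebesgue_itv_lty.
split.
- exists w.
    apply: (@weak_dt_L2_primitive _ _ _ mu A mA g0 w mw T) => //.
      by apply: le_lt_trans (wF0 _ mT) _; rewrite ltry.
    move: fuE wE; apply: filterS2 => x fux wx Ax; have := wx Ax.
    by apply: ae_lebesgue_mono => t H tT; rewrite -fux// H.
  have mw2 : measurable_fun [set: XR] (fun z => (w z.1 z.2 ^+ 2)%:E).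
    by apply/measurable_EFinP/measurable_funX.
  have w20 (z : XR) : 0 <= (w z.1 z.2 ^+ 2)%:E by rewrite lee_fin sqr_ge0.
  have := wF0 _ mT; rewrite -(tonelli_rect1 mu mA mT mw2 w20) (tonelli_rect2 mu mA mT mw2 w20).
  rewrite F0E; apply: le_trans; apply: le_integral_pointwise => t _.
  by apply: le_integral_pointwise => x _; rewrite real_normK ?num_real.
- move=> tau tau0 tauT; exists (fun t x => g0 x + running (w x) t)%R.
    split.
      exact: (primitive_in_C0_L2 mA mw mg0 sg0 (ltW tau0) (sw' tau) (wF0 _ (measurable_itvR _))).
    have mY : measurable_fun [set: XR] (fun z => g0 z.1 + running (w z.1) z.2)%R.
      apply: measurable_funD; last exact: measurable_running_joint.
      by apply: (measurableT_comp mg0); exact: measurable_fst.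
    have [swap _] := ae_section_swap_eq mu mA mT mf mY.
    have := swap wE; apply: ae_lebesgue_mono => t H [t0 ttau].
    have tT : time_itv T t by split => //; exact: lt_le_trans tauT.
    by move: (H tT) (fuT t tT); apply: filterS2 => x Hx fx Ax; rewrite -fx// Hx.
  exists (Num.sqrt F0) => s t stau ttau.
  exact: (@primitive_holder _ _ _ mu A mA g0 w mw tau F0 (sw' tau)
    (wF0 _ (measurable_itvR _)) s t stau ttau).
- move=> t1 t2 t10 t12 t2T; have [n t2n] := Sn_le t2T.
  have := solution_total_var_le mu_doubling oOmega oA bA (Sn0 n) mf (fun x => sf x n) (ff n)
    mg0 sg0 (fu n) gu u0_BV (usol n) t10 (ltW t12) t2n.
  have t21 : (0 < t2 - t1)%R by rewrite subr_gt0.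
  rewrite -/F0 => H; rewrite F0E.
  apply: le_trans (lee_wpmul2l _ H) _; first by rewrite lee_fin invr_ge0 ltW.
  by rewrite -EFinM mulKf// gt_eqF.
Qed.

End solution_regularity.

(** * Reduction to a sigma-finite measure *)

Section sigma_finite_case.
Context {R : realType} {d} {X : measurableType d}.
Variables (mu : {measure set X -> \bar R}) (sf : sigma_finite setT mu).
Definition sigma_finite_copy of sigma_finite setT mu : set X -> \bar R := mu.
HB.instance Definition _ := isMeasure.Build _ _ _ (sigma_finite_copy sf)
  (measure0 mu) (@measure_ge0 _ _ _ mu) (@measure_semi_sigma_additive _ _ _ mu).
HB.instance Definition _ := Measure_isSigmaFinite.Build _ _ _ (sigma_finite_copy sf) sf.
(** The product measure and Tonelli's theorem require a sigma-finite structure on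
    [mu], which under the doubling condition is only a property of it. *)
Lemma sigma_finite_case (P : {measure set X -> \bar R} -> Prop) :
  (forall nu : {sigma_finite_measure set X -> \bar R}, P nu) -> P mu.
Proof.
move=> H.
have := H (sigma_finite_copy sf : {sigma_finite_measure set X -> \bar R}).
by congr P; exact: eq_measure.
Qed.
End sigma_finite_case.

Theorem theorem2p10 (R : realType) (d : measure_display)
    (X : borelMetricType R d) (mu : {measure set X -> \bar R})
    (X_separable : separable X) (X_connected : connected [set: X])
    (mu_doubling : doubling mu) (mu_poincare : poincare mu)
    (Omega OmegaS : set X) (Omega_open : open Omega) (OmegaS_open : open OmegaS)
    (Omega_bounded : metric_bounded Omega)
    (OmegaS_bounded : metric_bounded OmegaS)
    (Omega_OmegaS : compactly_contained Omega OmegaS)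
    (u0 : X -> R) (u0_L2 : in_Lp mu OmegaS 2%:E u0) (u0_BV : BV mu OmegaS u0)
    (T : \bar R) (T_gt0 : (0 < T)%E)
    (u : X -> R -> R) (u_sol : variational_solution mu Omega OmegaS u0 T u) :
  [/\ exists2 du : X -> R -> R, weak_dt_L2 mu OmegaS T u du &
        (\int[lebesgue_measure]_(t in time_itv T)
           \int[mu]_(x in OmegaS) (`|du x t| ^+ 2)%:E
         <= total_var mu OmegaS u0)%E,
      forall tau : R, 0 < tau -> (tau%:E <= T)%E ->
        in_holder_L2 mu 2^-1 OmegaS tau u &
      forall t1 t2 : R, 0 <= t1 -> t1 < t2 -> (t2%:E <= T)%E ->
        (((t2 - t1)^-1)%:E *
           \int[lebesgue_measure]_(t in `[t1, t2]) total_var mu OmegaS (u^~ t)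
         <= total_var mu OmegaS u0)%E].
Proof.
have sfmu := doubling_sigma_finite mu_doubling.
move: mu_doubling mu_poincare u0_L2 u0_BV u_sol; pattern mu.
apply: (sigma_finite_case sfmu) => nu nu_doubling _ u0_L2' u0_BV' u_sol'.
case: T T_gt0 u_sol' => [S| |//] T_gt0 u_sol'.
  apply: (@solution_regularity _ _ _ nu nu_doubling Omega OmegaS Omega_open
    OmegaS_open OmegaS_bounded S%:E T_gt0 (fun=> S)) => //.
  - by apply/seteqP; split => [t tS|t [n _]//]; exists 0%N.
  - by move=> tau; rewrite lee_fin => tauS; exists 0%N.
apply: (@solution_regularity _ _ _ nu nu_doubling Omega OmegaS Omega_open
  OmegaS_open OmegaS_bounded +oo%E T_gt0 (fun n => n.+1%:R)) => //.
- by move=> n m nm; rewrite ler_nat.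
- apply/seteqP; split => [t [t0 _]|t [n _ [t0 _]]]; last by split => //; rewrite ltry.
  by exists (Num.truncn t) => //; split => //; rewrite lte_fin truncnS_gt.
- by move=> tau _; exists (Num.truncn tau); rewrite ltW// truncnS_gt.
- by move=> n; exact: u_sol'.
Qed.
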